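(* Let $I\subset\mathbb R$ be a bounded open interval. Consider a monic polynomial $$P(t)(Z)=Z^3+a_1(t)Z^2+a_2(t)Z+a_3(t),\qquad t\in I,$$ with coefficients $a_j\in C^6(\overline I)$, $j=1,2,3$. Then: (1) If $\lambda_j:I\to\mathbb C$, $j=1,2,3$, denotes a continuous parameterization of the roots of $P$, then each $\lambda_j'\in L^{6/5}_w(I)$; in particular, each $\lambda_j\in W^{1,q}(I)$ for $q\in[1,6/5)$. (2) Let $\{P_\nu;\nu\in\mathcal N\}$ be a family of curves of polynomials $P_\nu(t)(Z)=Z^3+a_{\nu,1}(t)Z^2+a_{\nu,2}(t)Z+a_{\nu,3}(t)$ such that the set of coefficients $\{a_{\nu,j};\nu\in\mathcal N,\ j=1,2,3\}$ is bounded in $C^6(\overline I)$. Then the set $\{\lambda_\nu';\ \lambda_\nu\in C^0(I)\text{ with }P_\nu(\lambda_\nu)=0\text{ on }I,\ \nu\in\mathcal N\}$ is bounded in $L^{6/5}_w(I)$.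
   Context: All coefficient functions are complex-valued. $C^6(\overline I)$ is the Banach space of $C^6$ functions on $I$ whose derivatives of order $\le6$ extend continuously to $\overline I$, with norm the supremum over $I$ of all derivatives of order $\le 6$. For $1\le p<\infty$ the weak Lebesgue space $L^p_w(I)$ consists of the measurable $f:I\to\mathbb C$ with $\|f\|_{p,w,I}:=\sup_{r\ge0}\{r\cdot\mathcal L^1(\{t\in I;|f(t)|>r\})^{1/p}\}<\infty$, where $\mathcal L^1$ is Lebesgue measure; boundedness in $L^p_w(I)$ is with respect to this quasinorm. Derivatives $\lambda'$ are distributional derivatives. A continuous parameterization of the roots is a triple of continuous functions with $P(t)(Z)=\prod_{j=1}^3(Z-\lambda_j(t))$ for all $t\in I$. *)

(* Defs.v *)
From HB Require Import structures.
From mathcomp Require Import all_boot all_order all_algebra.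
From mathcomp Require Import all_classical all_reals all_analysis.
From mathcomp.real_closed Require Import complex.

Set Implicit Arguments.
Unset Strict Implicit.
Unset Printing Implicit Defensive.

Import Order.TTheory GRing.Theory Num.Theory.
Import numFieldNormedType.Exports.
Import ComplexField.Normc.

Local Open Scope classical_set_scope.
Local Open Scope ring_scope.
Local Open Scope complex_scope.

(* Functions on the interval I = ]a, b[ are total functions on R of which only
   the values on I matter.  Their derivatives and integrals are taken on the
   real and imaginary parts, since R[i] is not a normed module over R in the
   library. *)

(* The library attaches its norm topology to the sort of a numFieldType, hence
   the cast. *)
Definition ccontinuous_on (R : realType) (D : set R) (f : R -> R[i]) : Prop :=
  {within D, continuous (f : R -> (R[i] : numFieldType))}.

Definition reF (R : realType) (f : R -> R[i]) : R -> R :=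
  fun t => complex.Re (f t).

Definition imF (R : realType) (f : R -> R[i]) : R -> R :=
  fun t => complex.Im (f t).

Definition cderiv (R : realType) (k : nat) (f : R -> R[i]) : R -> R[i] :=
  fun t => derive1n k (reF f) t +i* derive1n k (imF f) t.

Definition cintegral (R : realType) (D : set R) (f : R -> R[i]) : R[i] :=
  Rintegral lebesgue_measure D (reF f) +i* Rintegral lebesgue_measure D (imF f).

(* C^n of the closure of ]a, b[ *)
Definition Cn_closure (R : realType) (n : nat) (a b : R) : set (R -> R[i]) :=
  [set f | (forall k t, (k < n)%N -> t \in `]a, b[ ->
              derivable (derive1n k (reF f)) t 1 /\ derivable (derive1n k (imF f)) t 1)
         /\ (forall k, (k <= n)%N -> exists g : R -> R[i],
              ccontinuous_on `[a, b] g /\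
              (forall t, t \in `]a, b[ -> g t = cderiv k f t))].

Definition Cn_norm (R : realType) (n : nat) (a b : R) (f : R -> R[i]) : \bar R :=
  ereal_sup [set x | exists k t,
    [/\ (k <= n)%N, t \in `]a, b[ & x = (normc (cderiv k f t))%:E]].

Definition bounded_in_Cn (R : realType) (n : nat) (a b : R)
    (S : set (R -> R[i])) : Prop :=
  S `<=` Cn_closure n a b /\
  exists M : R, forall f, S f -> (Cn_norm n a b f <= M%:E)%E.

Definition cmeasurable (R : realType) (D : set R) (f : R -> R[i]) : Prop :=
  measurable_fun D (reF f) /\ measurable_fun D (imF f).

Definition weakL_norm (R : realType) (p a b : R) (f : R -> R[i]) : \bar R :=
  ereal_sup [set (r%:E * poweR
      (lebesgue_measure (`]a, b[ `&` [set t | (r < normc (f t))%R])) p^-1)%E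
    | r in [set r : R | 0 <= r]].

Definition weakL (R : realType) (p a b : R) : set (R -> R[i]) :=
  [set f | cmeasurable `]a, b[ f /\ (weakL_norm p a b f < +oo)%E].

Definition Lq (R : realType) (q a b : R) : set (R -> R[i]) :=
  [set f | cmeasurable `]a, b[ f /\
    (\int[lebesgue_measure]_(t in `]a, b[) (normc (f t) `^ q)%:E < +oo)%E].

Definition test_function (R : realType) (a b : R) (phi : R -> R) : Prop :=
  (forall k t, derivable (derive1n k phi) t 1) /\
  (exists K : set R, [/\ compact K, K `<=` `]a, b[%classic &
     forall t, ~ K t -> phi t = 0]).

(* Real-valued test functions determine the action on complex-valued ones by
   linearity. *)
Definition distribution_on (R : realType) : Type := (R -> R) -> R[i].

Definition distr_of (R : realType) (a b : R) (g : R -> R[i]) :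
    distribution_on R :=
  fun phi => cintegral `]a, b[ (fun t => g t * (phi t)%:C).

Definition distr_deriv (R : realType) (a b : R) (f : R -> R[i]) :
    distribution_on R :=
  fun phi => - cintegral `]a, b[ (fun t => f t * (derive1 phi t)%:C).

Definition represents (R : realType) (a b : R) (g : R -> R[i])
    (T : distribution_on R) : Prop :=
  [/\ locally_integrable `]a, b[ (reF g), locally_integrable `]a, b[ (imF g) &
    forall phi, test_function a b phi -> T phi = distr_of a b g phi].

(* As usual, a distribution belongs to a space X of functions when it is
   represented by an element of X. *)
Definition distr_in (R : realType) (a b : R) (X : set (R -> R[i]))
    (T : distribution_on R) : Prop :=
  exists2 g, represents a b g T & X g.

Definition distr_bounded_in_weakL (R : realType) (p a b : R)
    (S : set (distribution_on R)) : Prop :=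
  exists M : R, forall T, S T ->
    distr_in a b
      [set g | weakL p a b g /\ (weakL_norm p a b g <= M%:E)%E] T.

Definition sobolev_W1 (R : realType) (q a b : R) : set (R -> R[i]) :=
  [set f | Lq q a b f /\ distr_in a b (Lq q a b) (distr_deriv a b f)].

(* The coefficient of index j : 'I_3 stands for a_(j+1). *)
Definition cubic (R : realType) (c : 'I_3 -> R -> R[i]) (t : R) :
    {poly R[i]} :=
  'X^3 + \sum_(j < 3) (c j t)%:P * 'X^(2 - j).

Definition continuous_parameterization (R : realType) (a b : R)
    (P : R -> {poly R[i]}) (lambda : 'I_3 -> R -> R[i]) : Prop :=
  (forall j, ccontinuous_on `]a, b[ (lambda j)) /\
  (forall t, t \in `]a, b[ -> P t = \prod_(j < 3) ('X - (lambda j t)%:P)).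

(* Main.v *)
Require Import Defs.
From HB Require Import structures.
From mathcomp Require Import all_boot all_order all_algebra.
From mathcomp Require Import all_classical all_reals all_analysis.
From mathcomp.real_closed Require Import complex.
From mathcomp Require Import measurable_realfun.
From mathcomp Require Import ring lra zify.

Set Implicit Arguments.
Unset Strict Implicit.
Unset Printing Implicit Defensive.

Import Order.TTheory GRing.Theory Num.Theory.
Import numFieldNormedType.Exports.
Import ComplexField.Normc.

Local Open Scope classical_set_scope.
Local Open Scope ring_scope.
Local Open Scope complex_scope.

(** The shift of Z by a third of the first coefficient turns the polynomial into
    Z^3 + p Z + q.  Put D = 27 q^2 + 4 p^3, which vanishes at the multiple roots,
    and let rho be the scale of the roots, comparable to max(|p|^(1/2), |q|^(1/3)).
    The proof rests on the density
      h = |q'| / rho^2 + |p'| / rho + |D'| / (|D|^(1/2) rho^2),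
    where quotients by 0 count as 0 (hdens with the smoothing parameter 0).  It has
    three parts: h dominates the increments of every continuous root, h is bounded
    in L^(6/5), and a function with dominated increments is an integral.

    Domination (root_increments).  A simple root l has the derivative
    - (p' l + q') / m with m = 3 l^2 + p, and solving the formula for D' for
    p' l + q' bounds it by 16 h (root_slope_bound).  Local Lipschitz constants
    are integrated by real induction (cousin, slope_dominated), so that the
    increments of l are bounded by those of a primitive of h as long as l is
    simple.  Near a nonzero double root, l is compared with -3 q / (2 p), which is
    the double root; the difference vanishes exactly at the multiple roots.  What
    remains is the zero set of l.  In both cases an increment is bounded by the
    increments up to the first and from the last zero (zero_set_dominated).

    Integrability (hdens_integral).  If g is real of class C^6, the sixth root of |g|
    with the sign of g has a total variation of the order of the length of the
    interval and of sup |g|^(1/6): on a window with five critical points, g varies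
    by the sixth power of its length, hence the sixth root by its length, and few
    turns remain outside such windows (variation_count, tv_bound, tv_wdens).  Let A
    be the sum of the length and of these variations for the real and imaginary parts
    of q, p and D.  On an interval J where rho is constant up to a factor 2, say of
    size t^5, the integral of h^(6/5) is at most C1 A(J) + C3 t^3: by Landau's
    inequality if J is longer than rho (leaf_long), and by the variation of q and p
    otherwise (leaf_short).  Other intervals are bisected.  There one of the
    components changes by a fixed fraction of its size, so that t^3 is at most
    C |J|^(1/30) A(J) (bad_interval); the factor |J|^(1/30) is geometric in the
    depth of the bisection, and the sum over all intervals converges
    (dyadic_estimate).  All this concerns primitives of smoothed densities; Fatou's
    lemma removes the smoothing.

    Densities (dominated_density).  If the increments of f are dominated by those of a
    primitive H of h, the Stieltjes measures of H + f and H - f add up to 2 h dx, so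
    that f has a density between - h and h.  Integration by parts on short
    intervals shows that this density is the distributional derivative
    (density_weak_derivative), Chebyshev's inequality puts it in the weak space, and it
    is in L^q for q <= 6/5.

    All constants depend only on the interval and on a bound of the coefficients in
    C^6, which settles single polynomials and families alike
    (cubic_root_weak_derivative). *)

(** * Functions with bounded derivatives *)

Lemma is_derive_cont (R : realType) (f : R -> R) (t l : R) :
  is_derive t 1 f l -> {for t, continuous f}.
Proof.
by move=> [df _]; apply/differentiable_continuous/derivable1_diffP.
Qed.

Lemma derive_cont_within (R : realType) (f f' : R -> R) (a b x y : R) :
  (forall t, a < t < b -> is_derive t 1 f (f' t)) -> a < x -> y < b ->
  {within `[x, y], continuous f}.
Proof.
move=> df ax yb; apply: derivable_within_continuous => t.
rewrite in_itv/= => /andP[xt ty]; apply: ex_derive; apply: df.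
by rewrite (lt_le_trans ax)//= (le_lt_trans ty).
Qed.

Lemma mvt_oo (R : realType) (f f' : R -> R) (a b x y : R) :
  (forall t, a < t < b -> is_derive t 1 f (f' t)) ->
  a < x -> x < y -> y < b ->
  exists2 c, x < c < y & f y - f x = f' c * (y - x).
Proof.
move=> df ax xy yb.
have [||c] := @MVT R f f' x y xy.
- move=> t; rewrite in_itv/= => /andP[xt ty]; apply: df.
  by rewrite (lt_trans ax)//= (lt_trans ty).
- exact: derive_cont_within df ax yb.
by rewrite in_itv/= => cxy ->; exists c.
Qed.

Lemma derive_le (R : realType) (f f' g g' : R -> R) (a b x y : R) :
  (forall t, a < t < b -> is_derive t 1 f (f' t)) ->
  (forall t, a < t < b -> is_derive t 1 g (g' t)) ->
  a < x -> x <= y -> y < b -> (forall t, x < t < y -> f' t <= g' t) ->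
  f y - f x <= g y - g x.
Proof.
move=> df dg ax; rewrite le_eqVlt => /predU1P[<- _ _|xy yb fg].
  by rewrite !subrr.
have dgf t : a < t < b -> is_derive t 1 (g - f) (g' t - f' t).
  by move=> tab; have := df t tab; have := dg t tab => ? ?; exact: is_deriveB.
have [c cxy] := mvt_oo dgf ax xy yb.
have : 0 <= (g' c - f' c) * (y - x).
  by rewrite mulr_ge0// subr_ge0; [exact: fg|exact: ltW].
move=> /[swap] <-; rewrite -[(g - f) y]/(g y - f y) -[(g - f) x]/(g x - f x); lra.
Qed.

(** The class C^k with all derivatives bounded by M.  The derivatives are
    existentially quantified because only the values on ]a, b[ of a total function
    are meaningful. *)
Fixpoint Ckb (R : realType) (k : nat) (a b M : R) (f : R -> R) : Prop :=
  (forall t, a < t < b -> `|f t| <= M) /\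
  if k is k'.+1 then
    exists f', (forall t, a < t < b -> is_derive t 1 f (f' t)) /\ Ckb k' a b M f'
  else True.

Lemma Ckb_bound (R : realType) k (a b M : R) f t :
  Ckb k a b M f -> a < t < b -> `|f t| <= M.
Proof. by case: k => [|k] [H _]; exact: H. Qed.

Lemma Ckb_le (R : realType) k (a b M M' : R) f :
  M <= M' -> Ckb k a b M f -> Ckb k a b M' f.
Proof.
move=> MM'; elim: k f => [|k IH] f /= [Hf H]; split => //.
- by move=> t /Hf /le_trans; apply.
- by move=> t /Hf /le_trans; apply.
- by case: H => f' [df /IH Hf']; exists f'.
Qed.

Lemma Ckb_pred (R : realType) k (a b M : R) f :
  Ckb k.+1 a b M f -> Ckb k a b M f.
Proof.
elim: k f => [|k IH] f [Hf [f' [df Hf']]]; split => //.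
by exists f'; split => //; exact: IH.
Qed.

Lemma CkbD (R : realType) k (a b M N : R) f g :
  Ckb k a b M f -> Ckb k a b N g -> Ckb k a b (M + N) (fun t => f t + g t).
Proof.
elim: k f g => [|k IH] f g [Hf H] [Hg H']; split => //.
- by move=> t tab; rewrite (le_trans (ler_normD _ _))// lerD ?Hf ?Hg.
- by move=> t tab; rewrite (le_trans (ler_normD _ _))// lerD ?Hf ?Hg.
- move: H H' => [f' [df Hf']] [g' [dg Hg']].
  exists (fun t => f' t + g' t); split; last exact: IH.
  by move=> t tab; have ? := df t tab; have ? := dg t tab; exact: is_deriveD.
Qed.

(** The factor 2^k counts the terms of the Leibniz rule. *)
Lemma CkbM (R : realType) k (a b M N : R) f g : 0 <= M -> 0 <= N ->
  Ckb k a b M f -> Ckb k a b N g ->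
  Ckb k a b (2 ^+ k * (M * N)) (fun t => f t * g t).
Proof.
move=> M0 N0.
elim: k f g => [|k IH] f g [Hf H] [Hg H']; split => //.
- by move=> t tab; rewrite expr0 mul1r normrM ler_pM ?Hf ?Hg.
- move=> t tab; rewrite normrM (@le_trans _ _ (M * N))//.
    by rewrite ler_pM ?Hf ?Hg.
  by rewrite ler_peMl ?mulr_ge0// exprn_ege1// ler1n.
- move: (H) (H') => [f' [df Hf']] [g' [dg Hg']].
  exists (fun t => f t * g' t + f' t * g t); split.
    move=> t tab; have ? := df t tab; have ? := dg t tab.
    by apply: is_derive_eq; rewrite /GRing.scale/= [g t * _]mulrC.
  have -> : 2 ^+ k.+1 * (M * N) = 2 ^+ k * (M * N) + 2 ^+ k * (M * N).
    by rewrite exprS; ring.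
  by apply: CkbD; apply: IH => //; apply: Ckb_pred; split => //; exists g' || exists f'.
Qed.

Lemma CkbC (R : realType) k (a b M c : R) :
  `|c| <= M -> Ckb k a b M (fun=> c).
Proof.
elim: k c => [|k IH] c cM; split => //.
exists (fun=> 0); split; first by move=> t _; exact: is_derive_cst.
by apply: IH; rewrite normr0 (le_trans _ cM).
Qed.

(** By Rolle's theorem the derivative has one zero less, and one integration of its
    bound gains a factor y - x. *)
Lemma Ckb_zeros (R : realType) k (a b M : R) f (z : nat -> R) (x y : R) :
  0 <= M -> Ckb k a b M f -> a < x -> y < b ->
  (forall i, (i < k)%N -> x <= z i <= y) ->
  (forall i, (i.+1 < k)%N -> z i < z i.+1) ->
  (forall i, (i < k)%N -> f (z i) = 0) ->
  forall t, x <= t <= y -> `|f t| <= M * (y - x) ^+ k.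
Proof.
move=> M0; elim: k f z x y => [|k IH] f z x y Hf ax yb zxy zinc zf t txy.
  rewrite expr0 mulr1; apply: (Ckb_bound Hf).
  by move: txy => /andP[xt ty]; rewrite (lt_le_trans ax)//= (le_lt_trans ty).
have [f0 [f' [df Hf']]] := Hf.
have rolle i : exists w, (i < k)%N -> z i < w < z i.+1 /\ f' w = 0.
  case: (ltnP i k) => ik; last by exists 0.
  have zi := zxy i (leq_trans ik (leqnSn _)).
  have zi1 := zxy i.+1 ik.
  have [||w wz] := @mvt_oo R f f' a b (z i) (z i.+1) df _ (zinc i ik).
  - by case/andP: zi => xz _; exact: lt_le_trans xz.
  - by case/andP: zi1 => _ zy; exact: le_lt_trans yb.
  rewrite !zf// ?subrr; last by rewrite ltnS ltnW.
  move=> /esym/eqP; rewrite mulf_eq0 subr_eq0 (gt_eqF (zinc i ik)) orbF => /eqP fw.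
  by exists w.
have [w Hw] := choice rolle.
have f'b : forall t, x <= t <= y -> `|f' t| <= M * (y - x) ^+ k.
  apply: (IH f' w x y) => //.
  - move=> i ik; have [/andP[zw wz] _] := Hw i ik.
    have /andP[xz _] := zxy i (leq_trans ik (leqnSn _)).
    have /andP[_ zy] := zxy i.+1 ik.
    by rewrite (le_trans xz (ltW zw))/= (le_trans (ltW wz)).
  - move=> i ik; have [/andP[_ wz] _] := Hw i (ltnW ik).
    by have [/andP[zw _] _] := Hw i.+1 ik; exact: lt_trans zw.
  - by move=> i ik; have [_] := Hw i ik.
have /andP[xz zy] := zxy 0%N isT.
have xy : x <= y by exact: le_trans zy.
have key u v : x <= u -> u < v -> v <= y -> `|f v - f u| <= M * (y - x) ^+ k.+1.
  move=> xu uv vy.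
  have [c /andP[uc cv] ->] := mvt_oo df (lt_le_trans ax xu) uv (le_lt_trans vy yb).
  rewrite normrM exprSr mulrA ler_pM//.
    by apply: f'b; rewrite (le_trans xu (ltW uc)) (le_trans (ltW cv)).
  rewrite gtr0_norm ?subr_gt0//; lra.
move: txy => /andP[xt ty].
have -> : f t = f t - f (z 0%N) by rewrite zf// subr0.
have [tz|zt|->] := ltgtP t (z 0%N).
- by rewrite distrC; exact: key.
- exact: key.
- by rewrite subrr normr0 mulr_ge0// exprn_ge0// subr_ge0.
Qed.

(** Landau's inequality.  The second differences of f cancel the second-order term of
    the Taylor expansion. *)
Lemma landau3_right (R : realType) (a b M A l : R) (f f' : R -> R) t :
  (forall t, a < t < b -> is_derive t 1 f (f' t)) -> Ckb 2 a b M f' ->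
  0 < l -> a < t -> t + l < b ->
  (forall s, t <= s <= t + l -> `|f s| <= A) ->
  `|f' t| <= 8 * A / l + 5 * M * l ^+ 2.
Proof.
move=> df [_ [f2 [df2 [_ [f3 [df3 [f3M _]]]]]]] l0 at_ tlb fA.
have M0 : 0 <= M.
  by have := f3M t; rewrite at_ (lt_trans _ tlb) ?ltrDl// => /(_ isT); apply: le_trans.
pose c := f2 t.
(* Taylor remainder bounds, by two integrations of the bound on f3 *)
have r2 s : t <= s <= t + l -> `|f2 s - c| <= M * l.
  move=> /andP[ts sl]; move: ts; rewrite le_eqVlt => /predU1P[<-|ts].
    by rewrite subrr normr0 mulr_ge0// ltW.
  have [u /andP[tu us] ->] := mvt_oo df3 at_ ts (le_lt_trans sl tlb).
  rewrite normrM ler_pM//.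
    by apply: f3M; rewrite (lt_trans at_ tu)/= (lt_trans us)// (le_lt_trans sl).
  rewrite gtr0_norm ?subr_gt0//; lra.
have r1 s : t <= s <= t + l -> `|f' s - f' t - c * (s - t)| <= M * l ^+ 2.
  move=> /andP[ts sl]; move: ts; rewrite le_eqVlt => /predU1P[<-|ts].
    by rewrite !subrr mulr0 subrr normr0 mulr_ge0// ltW// exprn_gt0.
  have [u /andP[tu us] ->] := mvt_oo df2 at_ ts (le_lt_trans sl tlb).
  rewrite -mulrBl normrM expr2 mulrA ler_pM//.
    by apply: r2; rewrite (ltW tu)/= (le_trans (ltW us)).
  rewrite gtr0_norm ?subr_gt0//; lra.
pose g s := f s - f' t * (s - t) - c / 2 * (s - t) ^+ 2.
have dg s : a < s < b -> is_derive s 1 g (f' s - f' t - c * (s - t)).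
  move=> sab; have ? := df s sab; rewrite /g.
  apply: is_derive_eq; rewrite /GRing.scale/=; lra.
have r0 s : t <= s <= t + l -> `|g s - g t| <= M * l ^+ 3.
  move=> /andP[ts sl]; move: ts; rewrite le_eqVlt => /predU1P[<-|ts].
    by rewrite subrr normr0 mulr_ge0// ltW// exprn_gt0.
  have [u /andP[tu us] ->] := mvt_oo dg at_ ts (le_lt_trans sl tlb).
  rewrite normrM [l ^+ 3]exprSr mulrA ler_pM//.
    by apply: r1; rewrite (ltW tu)/= (le_trans (ltW us)).
  rewrite gtr0_norm ?subr_gt0//; lra.
have h2 : t <= t + l / 2 <= t + l by lra.
have h1 : t <= t + l <= t + l by lra.
have M3 : 0 <= M * l ^+ 3 by rewrite mulr_ge0// ltW// exprn_gt0.
suff : `|f' t * l| <= 8 * A + 5 * (M * l ^+ 3).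
  rewrite normrM (gtr0_norm l0) -ler_pdivlMr// => /le_trans; apply.
  by rewrite le_eqVlt; apply/orP; left; apply/eqP; field; rewrite gt_eqF.
rewrite ler_norml.
have := r0 _ h2; have := r0 _ h1.
have := fA _ h2; have := fA _ h1.
have /fA : t <= t <= t + l by lra.
rewrite /g !ler_norml => /andP[A1 A2] /andP[A3 A4] /andP[A5 A6] /andP[B1 B2] /andP[B3 B4].
by apply/andP; split; lra.
Qed.

(** Reflection exchanges the ends of an interval; the sign s keeps the first
    derivative in this form. *)
Lemma Ckb_reflect (R : realType) k (a b M s : R) f : `|s| <= 1 ->
  Ckb k a b M f -> Ckb k (- b) (- a) M (fun t => s * f (- t)).
Proof.
elim: k f s => [|k IH] f s s1 [Hf H]; split => //.
- move=> t tab; rewrite normrM -[M]mul1r ler_pM//; apply: Hf.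
  by rewrite ltrNr ltrNl andbC.
- move=> t tab; rewrite normrM -[M]mul1r ler_pM//; apply: Hf.
  by rewrite ltrNr ltrNl andbC.
- move: H => [f' [df Hf']]; exists (fun t => (- s) * f' (- t)); split.
    move=> t tab.
    have ? : is_derive (- t) 1 f (f' (- t)) by apply: df; rewrite ltrNr ltrNl andbC.
    have ? : is_derive t 1 (fun t => f (- t)) (f' (- t) * (- 1)).
      by apply: is_derive1_comp.
    by apply: is_derive_eq; rewrite /GRing.scale/=; ring.
  by apply: IH => //; rewrite normrN.
Qed.

(** One of the two intervals of length l that end at t stays inside. *)
Lemma landau3 (R : realType) (a b M A l x y : R) (f f' : R -> R) t :
  (forall t, a < t < b -> is_derive t 1 f (f' t)) -> Ckb 2 a b M f' ->
  0 < l -> a < x -> y < b -> 2 * l <= y - x ->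
  (forall s, x <= s <= y -> `|f s| <= A) ->
  x <= t <= y -> `|f' t| <= 8 * A / l + 5 * M * l ^+ 2.
Proof.
move=> df Hf' l0 ax yb lxy fA /andP[xt ty].
have [tly|ytl] := leP (t + l) y.
  apply: (landau3_right df Hf' l0); [lra|lra|].
  by move=> s /andP[ts sl]; apply: fA; rewrite (le_trans xt)//= (le_trans sl).
have Hg : Ckb 2 (- b) (- a) M (fun t => (-1) * f' (- t)).
  by apply: Ckb_reflect => //; rewrite normrN1.
have dg s : - b < s < - a -> is_derive s 1 (fun t => f (- t)) ((-1) * f' (- s)).
  move=> sab.
  have ? : is_derive (- s) 1 f (f' (- s)) by apply: df; rewrite ltrNr ltrNl andbC.
  by rewrite mulrC; apply: is_derive1_comp.
have := landau3_right dg Hg l0.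
move=> /(_ A (- t)); rewrite opprK mulN1r normrN; apply; [lra|lra|].
move=> s /andP[ts sl]; apply: fA; apply/andP; split; lra.
Qed.

(** * Real induction and the variation of finite sequences *)

(** Real induction: the supremum of the points t such that the property holds on
    [x, t] is y. *)
Lemma cousin (R : realType) (P : R -> R -> Prop) (x y : R) :
  x <= y ->
  (forall u v w, u <= v -> v <= w -> P u v -> P v w -> P u w) ->
  (forall t, x <= t <= y -> exists2 d, 0 < d &
     forall u v, x <= u -> u <= t -> t <= v -> v <= y -> t - d < u -> v < t + d ->
       P u v) ->
  P x y.
Proof.
move=> xy Padd Ploc.
pose A := [set t | x <= t <= y /\ P x t].
have Ax : A x.
  split; first by rewrite lexx.
  have [|d d0 H] := Ploc x; first by rewrite lexx.
  by apply: H => //; lra.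
have ubA : has_ubound A by exists y => t [/andP[]].
have supA : has_sup A by split => //; exists x.
pose s := sup A.
have xs : x <= s by apply: sup_upper_bound.
have sy : s <= y by apply: ge_sup; [exists x|move=> t [/andP[]]].
have [|d d0 H] := Ploc s; first by rewrite xs.
have [t [/andP[xt ty] Pt] ts] := sup_adherent d0 supA.
have ts' : t <= s by apply: sup_upper_bound => //; split => //; rewrite xt.
pose v := Num.min y (s + d / 2).
have sv : s <= v by rewrite le_min sy; lra.
have vy : v <= y by rewrite ge_min lexx.
have vd : v <= s + d / 2 by rewrite ge_min lexx orbT.
have Pxv : P x v.
  apply: (Padd x t v) => //; first exact: le_trans sv.
  by apply: H => //; lra.
have vs : v <= s.
  by apply: sup_upper_bound => //; split => //; rewrite (le_trans xs sv).
have : v = y.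
  by move: vs; rewrite /v; case: (leP y (s + d / 2)) => //; lra.
by move=> <-.
Qed.

Lemma continuous_eps (R : realType) (f : R -> R) t e :
  {for t, continuous f} -> 0 < e ->
  exists2 d, 0 < d & forall s, `|s - t| < d -> `|f s - f t| < e.
Proof.
move=> /cvgrPdist_lt cf e0; have /nbhs_ballP[d /= d0 H] := cf _ e0.
exists d => // s std; rewrite distrC; apply: H.
by rewrite /ball/= distrC.
Qed.

Lemma heine (R : realType) (f : R -> R) (x y e : R) : x <= y ->
  (forall t, x <= t <= y -> {for t, continuous f}) -> 0 < e ->
  exists2 d, 0 < d & forall s t, x <= s <= y -> x <= t <= y -> `|s - t| < d ->
    `|f s - f t| < e.
Proof.
move=> xy cf e0.
pose P u v := exists2 d, 0 < d & forall s t, u <= s <= v -> x <= t <= y ->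
  `|s - t| < d -> `|f s - f t| < e.
apply: (@cousin _ P) => //.
- move=> u v w uv vw [d d0 H] [d' d'0 H'].
  exists (Num.min d d'); first by rewrite lt_min d0.
  move=> s t /andP[us sw] txy; rewrite lt_min => /andP[sd sd'].
  have [sv|vs] := leP s v; first by apply: H; rewrite // us.
  by apply: H'; rewrite // (ltW vs).
- move=> t txy; have [|d d0 H] := continuous_eps (cf t txy) (e := e / 2).
    by rewrite divr_gt0.
  exists (d / 2); first by rewrite divr_gt0.
  move=> u v xu ut tv vy tdu vtd; exists (d / 2); first by rewrite divr_gt0.
  move=> s r /andP[us sv] rxy sr.
  have st : `|s - t| < d / 2 by rewrite ltr_norml; apply/andP; split; lra.
  have rt : `|r - t| < d.
    have -> : r - t = (s - t) - (s - r) by ring.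
    by rewrite (le_lt_trans (ler_normB _ _))//; lra.
  have H1 := H _ rt; have H2 := H s; have {}H2 := H2 (lt_trans st _).
  have {}H2 : `|f s - f t| < e / 2 by apply: H2; lra.
  have -> : f s - f r = (f s - f t) - (f r - f t) by ring.
  by rewrite (le_lt_trans (ler_normB _ _))//; lra.
Qed.

(** Up to the first turning point of a finite sequence there are a monotone run and
    one more step. *)
Lemma first_turn (R : realType) (F : nat -> R) (k n : nat) : (k <= n)%N ->
  \sum_(k <= i < n) `|F i.+1 - F i| = `|F n - F k| \/
  exists j, [/\ (k < j <= n)%N,
    \sum_(k <= i < j) `|F i.+1 - F i| <= `|F j.-1 - F k| + `|F j - F j.-1| &
    exists i i', [/\ (k <= i < j)%N, (k <= i' < j)%N, F i.+1 < F i & F i' < F i'.+1]].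
Proof.
move=> kn.
pose up n := forall i, (k <= i < n)%N -> F i <= F i.+1.
pose dn n := forall i, (k <= i < n)%N -> F i.+1 <= F i.
have upE m : (k <= m)%N -> up m -> \sum_(k <= i < m) `|F i.+1 - F i| = F m - F k.
  move=> km um; rewrite -telescope_sumr//; apply: eq_big_nat => i /um Fi.
  by rewrite ger0_norm// subr_ge0.
have dnE m : (k <= m)%N -> dn m -> \sum_(k <= i < m) `|F i.+1 - F i| = F k - F m.
  move=> km um; rewrite -[RHS]opprB -telescope_sumr// -sumrN.
  apply: eq_big_nat => i /um Fi.
  by rewrite ler0_norm// subr_le0.
have mono m : (k <= m)%N -> up m \/ dn m ->
    \sum_(k <= i < m) `|F i.+1 - F i| = `|F m - F k|.
  move=> km; have S0 : 0 <= \sum_(k <= i < m) `|F i.+1 - F i| by exact: sumr_ge0.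
  move=> [/upE|/dnE] /(_ km) E; rewrite {1}E in S0 *.
    by rewrite ger0_norm.
  by rewrite distrC ger0_norm.
suff : (up n \/ dn n) \/ exists j, [/\ (k < j <= n)%N, up j.-1 \/ dn j.-1 &
    exists i i', [/\ (k <= i < j)%N, (k <= i' < j)%N, F i.+1 < F i & F i' < F i'.+1]].
  move=> [/(mono _ kn)|[j [/andP[kj jn] Hj T]]]; first by left.
  right; exists j; split => //; first by rewrite kj.
  have kj1 : (k <= j.-1)%N by rewrite -ltnS prednK// (leq_trans _ kj).
  have {1}-> : j = j.-1.+1 by rewrite prednK// (leq_trans _ kj).
  by rewrite big_nat_recr//= mono// prednK// (leq_trans _ kj).
elim: n kn => [|n IH] kn.
  by left; left => i; rewrite ltn0 andbF.
move: kn; rewrite leq_eqVlt => /predU1P[kE|]; last rewrite ltnS => kn.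
  by left; left => i Hi; exfalso; lia.
have [ud|[j [/andP[kj jn] Hj T]]] := IH kn; last first.
  by right; exists j; split => //; rewrite kj (leq_trans jn).
have [|nud] := pselect (up n.+1 \/ dn n.+1); first by left.
right; exists n.+1; split => //; first by rewrite ltnS kn leqnn.
have [i [ki Fi]] : exists i, (k <= i < n.+1)%N /\ F i.+1 < F i.
  apply: contrapT => H; apply: nud; left => i ki; rewrite leNgt.
  by apply/negP => Fi; apply: H; exists i.
have [i' [ki' Fi']] : exists i, (k <= i < n.+1)%N /\ F i < F i.+1.
  apply: contrapT => H; apply: nud; right => i' ki'; rewrite leNgt.
  by apply/negP => Fi'; apply: H; exists i'.
by exists i, i'.
Qed.

(** First turning points are cut off m times, unless the sequence ends before. *)
Lemma many_turns (R : realType) (F : nat -> R) (w : nat -> R) (k n m : nat) :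
  (k <= n)%N ->
  (forall j i i', (k <= i <= j)%N -> (k <= i' <= j)%N -> (j <= n)%N ->
     `|F i - F i'| <= w j) ->
  (forall j j', (k <= j <= j')%N -> (j' <= n)%N -> w j <= w j') ->
  \sum_(k <= i < n) `|F i.+1 - F i| <= (2 * m)%:R * w n + w n \/
  exists t : nat -> nat, [/\ t 0%N = k, (t m <= n)%N,
    \sum_(k <= i < t m) `|F i.+1 - F i| <= (2 * m)%:R * w (t m),
    forall i, (i <= m)%N -> (k <= t i <= t m)%N &
    forall i, (i < m)%N -> (t i < t i.+1)%N /\
      exists j j', [/\ (t i <= j < t i.+1)%N,
      (t i <= j' < t i.+1)%N, F j.+1 < F j & F j' < F j'.+1]].
Proof.
move=> kn Fw wm.
have w0 j : (k <= j <= n)%N -> 0 <= w j.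
  move=> /andP[kj jn]; have := Fw j j j; rewrite kj leqnn subrr normr0.
  by apply.
elim: m => [|m [IH|[t [t0 tn St tinc tt]]]].
- right; exists (fun=> k); split => //; first by rewrite big_geq// mul0r.
  by move=> i _; rewrite leqnn.
- left; apply: (le_trans IH); rewrite lerD2r ler_wpM2r ?w0 ?kn ?leqnn//.
  by rewrite ler_nat; lia.
have /andP[ktm _] := tinc m (leqnn m).
have [E|[j [/andP[tj jn] Sj T]]] := first_turn F tn.
- left; rewrite (big_cat_nat ktm tn)/= E.
  have H1 : w (t m) <= w n by apply: wm; rewrite ?ktm ?tn ?leqnn.
  have H2 : `|F n - F (t m)| <= w n by apply: Fw; rewrite ?ktm ?tn ?kn ?leqnn.
  apply: (le_trans (lerD St H2)); rewrite lerD2r.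
  apply: (@le_trans _ _ ((2 * m)%:R * w n)); first by rewrite ler_wpM2l.
  by rewrite ler_wpM2r ?w0 ?kn ?leqnn// ler_nat; lia.
- right; exists (fun i => if (i <= m)%N then t i else j).
  have kj : (k <= j)%N by lia.
  split; rewrite ?leqnn ?ltnn//.
  + rewrite (big_cat_nat ktm (ltnW tj))/=.
    have H1 : w (t m) <= w j by apply: wm; rewrite ?ktm ?(ltnW tj).
    have H2 : `|F j.-1 - F (t m)| <= w j by apply: Fw; lia.
    have H3 : `|F j - F j.-1| <= w j by apply: Fw; lia.
    apply: (le_trans (lerD St (le_trans Sj (lerD H2 H3)))).
    have -> : (2 * m.+1)%:R = (2 * m)%:R + 2 :> R by rewrite -natrD; congr _%:R; lia.
    rewrite [X in _ <= X]mulrDl lerD//; first by rewrite ler_wpM2l.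
    by rewrite mulr_natl mulr2n.
  + move=> i _; case: ifP => im; last by lia.
    by have := tinc i im; lia.
  + move=> i; rewrite ltnS => im; rewrite im; case: ifP => im'; first exact: tt.
    by have -> : i = m by lia.
Qed.

(** Windows of five turning points are cut off one after the other.  Each costs its
    length, and the last, incomplete one costs the oscillation. *)
Lemma variation_count (R : realType) (F s : nat -> R) (c w : R) (k n : nat) :
  0 <= c -> (k <= n)%N ->
  (forall i j, (k <= i <= n)%N -> (k <= j <= n)%N -> `|F i - F j| <= w) ->
  (forall (t : nat -> nat), (k <= t 0%N <= t 5%N)%N -> (t 5%N <= n)%N ->
     (forall i, (i <= 5)%N -> (t 0%N <= t i <= t 5%N)%N) ->
     (forall i, (i < 5)%N -> (t i < t i.+1)%N /\
       exists j j', [/\ (t i <= j < t i.+1)%N,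
       (t i <= j' < t i.+1)%N, F j.+1 < F j & F j' < F j'.+1]) ->
     forall i j, (t 0%N <= i <= t 5%N)%N -> (t 0%N <= j <= t 5%N)%N ->
       `|F i - F j| <= c * (s (t 5%N) - s (t 0%N))) ->
  (forall i, (k <= i < n)%N -> s i <= s i.+1) ->
  \sum_(k <= i < n) `|F i.+1 - F i| <= 10 * c * (s n - s k) + 11 * w.
Proof.
move=> c0.
elim: (n - k)%N {-2}k (leqnn (n - k)) => {k} [|d IH] k dk kn Fw Fc smon.
  have -> : k = n by lia.
  rewrite big_geq// subrr mulr0 add0r mulr_ge0//.
  by have := Fw n n; rewrite kn leqnn subrr normr0; apply.
have w0 : 0 <= w by have := Fw k k; rewrite kn leqnn subrr normr0; apply.
have smono i j : (k <= i <= j)%N -> (j <= n)%N -> s i <= s j.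
  move=> /andP[ki]; elim: j => [|j IHj].
    by rewrite leqn0 => /eqP->.
  rewrite leq_eqVlt => /predU1P[->//|]; rewrite ltnS => ij jn.
  by rewrite (le_trans (IHj ij (ltnW jn)))// smon// (leq_trans ki).
pose os j := sup [set x | exists i i', [/\ (k <= i <= j)%N, (k <= i' <= j)%N & x = `|F i - F i'|]].
have osb j : (k <= j <= n)%N -> has_sup [set x | exists i i', [/\ (k <= i <= j)%N, (k <= i' <= j)%N & x = `|F i - F i'|]].
  move=> /andP[kj jn]; split.
    by exists 0, k, k; rewrite subrr normr0 leqnn kj.
  exists w => x [i [i' [Hi Hi' ->]]]; apply: Fw; lia.
have [||S|[t [t0 tn St tinc tt]]] := @many_turns R F os k n 5 kn.
- move=> j i i' Hi Hi' jn; apply: sup_upper_bound; first by apply: osb; lia.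
  by exists i, i'.
- move=> j j' Hj jn; apply: ge_sup.
    by have [] := osb j _ => //; lia.
  move=> x [i [i' [Hi Hi' ->]]]; apply: sup_upper_bound; first by apply: osb; lia.
  by exists i, i'; split => //; lia.
- apply: (le_trans S).
  have : os n <= w.
    apply: ge_sup; first by have [] := osb n _ => //; rewrite kn leqnn.
    move=> x [i [i' [Hi Hi' ->]]]; exact: Fw.
  have : 0 <= 10 * c * (s n - s k).
    by rewrite !mulr_ge0// subr_ge0 smono// leqnn.
  have -> : (2 * 5)%:R = 10 :> R by [].
  lra.
have [t01 _] := tt 0%N isT.
have /andP[_ t15] := tinc 1%N isT.
have kt5 : (k < t 5%N)%N by rewrite -t0 (leq_trans t01).
rewrite (big_cat_nat (ltnW kt5) tn)/=.
have os5 : os (t 5%N) <= c * (s (t 5%N) - s k).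
  apply: ge_sup; first by have [] := osb (t 5%N) _ => //; rewrite (ltnW kt5).
  move=> x [i [i' [Hi Hi' ->]]].
  by rewrite -t0; apply: (Fc t); rewrite ?t0 ?leqnn ?(ltnW kt5).
have IH5 : \sum_(t 5%N <= i < n) `|F i.+1 - F i| <= 10 * c * (s n - s (t 5%N)) + 11 * w.
  apply: IH => //; first lia.
  - by move=> i j Hi Hj; apply: Fw; lia.
  - by move=> t' H1 H2 H3 H4 i j H5 H6; apply: Fc => //; lia.
  - by move=> i Hi; apply: smon; lia.
apply: (le_trans (lerD St IH5)).
have -> : (2 * 5)%:R = 10 :> R by [].
lra.
Qed.

(** * Total variation of sixth roots *)

(** As u is positive, F turns only where g does. *)
Lemma turn_zero (R : realType) (a b : R) (g' F F' u : R -> R) (x0 x1 y0 y1 X Y : R) :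
  (forall t, a < t < b -> is_derive t 1 F (F' t)) ->
  (forall t, a < t < b -> {for t, continuous g'}) ->
  (forall t, a < t < b -> F' t = g' t * u t) ->
  (forall t, a < t < b -> 0 < u t) ->
  a < X -> Y < b ->
  X <= x0 -> x0 < x1 -> x1 <= Y -> X <= y0 -> y0 < y1 -> y1 <= Y ->
  F x1 < F x0 -> F y0 < F y1 ->
  exists2 z, X < z < Y & g' z = 0.
Proof.
move=> dF cg FE u0 aX Yb Xx0 x01 x1Y Xy0 y01 y1Y Fx Fy.
have [c /andP[c1 c2] Ec] := mvt_oo dF (lt_le_trans aX Xx0) x01 (le_lt_trans x1Y Yb).
have [d /andP[d1 d2] Ed] := mvt_oo dF (lt_le_trans aX Xy0) y01 (le_lt_trans y1Y Yb).
have cab : a < c < b by lra.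
have dab : a < d < b by lra.
have gc : g' c < 0.
  have : F' c * (x1 - x0) < 0 by rewrite -Ec subr_lt0.
  by rewrite pmulr_llt0 ?subr_gt0// FE// pmulr_llt0// u0.
have gd : 0 < g' d.
  have : 0 < F' d * (y1 - y0) by rewrite -Ed subr_gt0.
  by rewrite pmulr_lgt0 ?subr_gt0// FE// pmulr_lgt0// u0.
have cw p q : X < p -> q < Y -> {within `[p, q], continuous g'}.
  move=> Xp qY; apply: continuous_in_subspaceT => t; rewrite inE/= in_itv/= => tpq.
  by apply: cg; lra.
have [cd|dc] := leP c d.
- have [||z] := @IVT R g' c d 0 cd; [by apply: cw; lra| |].
    by rewrite minEle maxEle (ltW (lt_trans gc gd)) !ltW.
  by rewrite in_itv/= => Hz; exists z => //; lra.
- have [||z] := @IVT R g' d c 0 (ltW dc); [by apply: cw; lra| |].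
    by rewrite minElt maxElt (ltNge (g' d)) (ltW (lt_trans gc gd))/= !ltW.
  by rewrite in_itv/= => Hz; exists z => //; lra.
Qed.

(** Although g may oscillate infinitely often, a window with five critical points of g
    has an oscillation of g of the order of the sixth power of its length, hence one
    of F of the order of its length. *)
Lemma tv_bound (R : realType) (a b M K c w x y : R) (g g' u F F' W : R -> R) :
  (forall t, a < t < b -> is_derive t 1 g (g' t)) -> Ckb 5 a b M g' -> 0 <= M ->
  (forall t, a < t < b -> is_derive t 1 F (F' t)) ->
  (forall t, a < t < b -> {for t, continuous F'}) ->
  (forall t, a < t < b -> F' t = g' t * u t) ->
  (forall t, a < t < b -> 0 < u t) ->
  (forall t, a < t < b -> is_derive t 1 W `|F' t|) ->
  a < x -> x <= y -> y < b -> 0 <= c -> 0 <= K -> K * M <= c ^+ 6 ->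
  (forall s t, x <= s <= y -> x <= t <= y -> `|F s - F t| ^+ 6 <= K * `|g s - g t|) ->
  (forall s t, x <= s <= y -> x <= t <= y -> `|F s - F t| <= w) ->
  W y - W x <= 10 * c * (y - x) + 11 * w.
Proof.
move=> dg Cg' M0 dF cF' FE u0 dW ax xy yb c0 K0 KM FK Fw.
have w0 : 0 <= w by have := Fw x x; rewrite lexx xy subrr normr0; apply.
move: xy; rewrite le_eqVlt => /predU1P[<-|xy].
  by rewrite !subrr mulr0 add0r mulr_ge0.
have yx0 : 0 < y - x by rewrite subr_gt0.
suff H eta : 0 < eta -> W y - W x <= 10 * c * (y - x) + 11 * w + eta * (y - x).
  apply/ler_addgt0Pr => e e0.
  by have := H (e / (y - x)); rewrite divfK ?gt_eqF//; apply; rewrite divr_gt0.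
move=> eta0.
have cg t : a < t < b -> {for t, continuous g'}.
  by case: Cg' => _ [g2 [dg2 _]] tab; apply: is_derive_cont (dg2 t tab).
have cnF t : x <= t <= y -> {for t, continuous (fun t => `|F' t|)}.
  by move=> Ht; apply: cvg_norm; apply: cF'; lra.
(* A partition so fine that on each of its intervals F' varies by less than
   eta: there the variation of F is its increment, up to eta times the length. *)
have [d d0 Hd] := heine (ltW xy) cnF eta0.
have [N N0 Nd] : exists2 N : nat, 0 < N%:R :> R & (y - x) / d < N%:R.
  by exists (Num.truncn ((y - x) / d)).+1; [rewrite ltr0n|exact: truncnS_gt].
pose h := (y - x) / N%:R.
have h0 : 0 < h by rewrite divr_gt0.
have hd : h < d.
  by rewrite /h ltr_pdivrMr// mulrC -ltr_pdivrMr.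
pose s i := x + i%:R * h.
have sS i : s i.+1 - s i = h by rewrite /s mulrSr; ring.
have smon i j : (i <= j)%N -> s i <= s j.
  by move=> ij; rewrite /s lerD2l ler_wpM2r ?(ltW h0)// ler_nat.
have sN : s N = y by rewrite /s /h mulrC divfK ?gt_eqF//; ring.
have s0 : s 0%N = x by rewrite /s mul0r addr0.
have sx i : x <= s i by rewrite -s0 smon.
have sy i : (i <= N)%N -> s i <= y by move=> iN; rewrite -sN smon.
have sxy i : (i <= N)%N -> x <= s i <= y by move=> iN; rewrite sx sy.
have -> : W y - W x = \sum_(0 <= i < N) (W (s i.+1) - W (s i)).
  by rewrite telescope_sumr// sN s0.
apply: (@le_trans _ _ (\sum_(0 <= i < N) (`|F (s i.+1) - F (s i)| + eta * h))).
  apply: ler_sum_nat => i /andP[_ iN].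
  have si : s i < s i.+1 by rewrite -subr_gt0 sS.
  have xsi := sx i; have syi := sy i.+1 iN.
  have [||p Hp ->] := mvt_oo dW (x := s i) (y := s i.+1) _ si; [lra|lra|].
  have [||q Hq ->] := mvt_oo dF (x := s i) (y := s i.+1) _ si; [lra|lra|].
  rewrite sS normrM (gtr0_norm h0) -mulrDl ler_wpM2r ?(ltW h0)//.
  have := sS i => sSi.
  have : `|p - q| < d by rewrite ltr_norml; apply/andP; split; lra.
  by move=> /Hd => /(_ ltac:(lra) ltac:(lra)) /ltr_normlW; lra.
rewrite big_split/=; apply: lerD; last first.
  rewrite sumr_const_nat subn0 -mulr_natr -mulrA (mulrC h) mulrA mulrAC -mulrA.
  by rewrite /h divfK// gt_eqF.
rewrite -{1}sN -{1}s0.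
apply: (@variation_count _ (fun i => F (s i)) s) => //.
- by move=> i j /andP[_ Hi] /andP[_ Hj]; apply: Fw; apply: sxy.
- move=> t /andP[_ t05] t5N tin tt i j Hi Hj.
  have aX : a < s (t 0%N) by rewrite (lt_le_trans ax).
  have Yb : s (t 5%N) < b by rewrite (le_lt_trans (sy _ t5N)).
  have /choice[z Hz] : forall i, exists z, (i < 5)%N -> s (t i) < z < s (t i.+1) /\ g' z = 0.
    move=> k; case: (ltnP k 5) => k5; last by exists 0.
    have [tk [p [q [Hp Hq Fp Fq]]]] := tt k k5.
    have /andP[_ tk1] := tin k.+1 k5.
    have /andP[p0 p1] := Hp; have /andP[q0 q1] := Hq.
    have [||||||||z Hz gz] := turn_zero dF cg FE u0 (X := s (t k)) (Y := s (t k.+1))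
       _ _ _ _ _ _ _ _ Fp Fq.
    + by apply: (lt_le_trans ax).
    + by apply: (le_lt_trans _ yb); apply: sy; apply: leq_trans t5N.
    + exact: smon.
    + by rewrite -subr_gt0 sS.
    + exact: smon.
    + exact: smon.
    + by rewrite -subr_gt0 sS.
    + exact: smon.
    + by exists z.
  have g'b : forall r, s (t 0%N) <= r <= s (t 5%N) -> `|g' r| <= M * (s (t 5%N) - s (t 0%N)) ^+ 5.
    apply: (Ckb_zeros M0 Cg' aX Yb (z := z)).
    + move=> k k5; have [Hzk _] := Hz k k5.
      have /andP[/smon H0 _] := tin k (ltnW k5).
      have /andP[_ /smon H1] := tin k.+1 k5.
      by move: Hzk H0 H1; clear; lra.
    + move=> k k5; have [Hzk _] := Hz k (ltnW k5); have [Hzk1 _] := Hz k.+1 k5.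
      lra.
    + by move=> k k5; have [] := Hz k k5.
  set l := s (t 5%N) - s (t 0%N).
  have l0 : 0 <= l by rewrite subr_ge0 smon.
  have gosc p q : s (t 0%N) <= p -> p <= q -> q <= s (t 5%N) -> `|g p - g q| <= M * l ^+ 6.
    move=> Hp; rewrite le_eqVlt => /predU1P[-> _|pq Hq].
      by rewrite subrr normr0 mulr_ge0// exprn_ge0.
    rewrite distrC.
    have [||r Hr ->] := mvt_oo dg (x := p) (y := q) _ pq; [lra|lra|].
    rewrite normrM exprSr mulrA ler_pM//; first by apply: g'b; lra.
    by rewrite gtr0_norm ?subr_gt0// /l; lra.
  have gosc' : `|g (s i) - g (s j)| <= M * l ^+ 6.
    have /andP[/smon ? /smon ?] := Hi; have /andP[/smon ? /smon ?] := Hj.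
    have [ij|ji] := leP (s i) (s j); first exact: gosc.
    by rewrite distrC; apply: gosc => //; exact: ltW.
  rewrite -(@ler_pXn2r _ 6)// ?nnegrE ?normr_ge0 ?mulr_ge0//.
  apply: (le_trans (FK _ _ _ _)); [by apply: sxy; have /andP[_ /leq_trans ->] := Hi|by apply: sxy; have /andP[_ /leq_trans ->] := Hj|].
  rewrite exprMn (le_trans (ler_wpM2l K0 gosc'))// mulrA.
  by rewrite ler_wpM2r// exprn_ge0.
- by move=> i _; apply: smon.
Qed.

Lemma open_cts_measurable (R : realType) (a b : R) (f : R -> R) :
  (forall t, a < t < b -> {for t, continuous f}) ->
  measurable_fun (`]a, b[%classic : set R) f.
Proof.
move=> cf; apply: open_continuous_measurable_fun => //.
by move=> t; rewrite inE/= in_itv/=; exact: cf.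
Qed.

Lemma primitive_oo (R : realType) (a b B : R) (f : R -> R) :
  (forall t, a < t < b -> {for t, continuous f}) ->
  (forall t, a < t < b -> `|f t| <= B) ->
  exists F : R -> R, forall t, a < t < b -> is_derive t 1 F (f t).
Proof.
move=> cf fB.
exists (fun x => \int[@lebesgue_measure R]_(t in `]a, x]) f t)%R => t /andP[at_ tb].
have [u tu ub] : exists2 u, t < u & u < b by exists ((t + b) / 2); lra.
have sub : (`]a, u]%classic : set R) `<=` `]a, b[%classic.
  by move=> s /=; rewrite !in_itv/= => /andP[-> /le_lt_trans ->].
have intf : (@lebesgue_measure R).-integrable `]a, u]%classic (EFin \o f).
  apply: measurable_bounded_integrable => //.
  - rewrite /= lebesgue_measure_itv/= lte_fin (lt_trans at_ tu).
    by rewrite -EFinD ltry.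
  - exact: measurable_funS (open_cts_measurable cf).
  - exists B; split; first by rewrite num_real.
    move=> M BM s /=; rewrite in_itv/= => /andP[as_ su].
    by rewrite (le_trans (fB s _)) ?(ltW BM)// as_ (le_lt_trans su).
have ct : {for t, continuous f} by apply: cf; rewrite at_.
have [|df Df] := continuous_FTC1 tu intf _ ct; first by rewrite ?bnd_simp ?lteBSide/= ?lteifF ?at_.
by split; [exact: df|rewrite -derive1E Df].
Qed.

(** With the exponent 1/12 the scale of the roots becomes smooth: its twelfth power
    is a polynomial in the components of the coefficients. *)
Definition root12 (R : realType) (x : R) : R := x `^ 12^-1.

Lemma root12_ge0 (R : realType) (x : R) : 0 <= root12 x.
Proof. exact: powR_ge0. Qed.

Lemma root12_gt0 (R : realType) (x : R) : 0 < x -> 0 < root12 x.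
Proof. exact: powR_gt0. Qed.

Lemma root12K (R : realType) (x : R) : 0 <= x -> root12 x ^+ 12 = x.
Proof.
by move=> x0; rewrite -powR_mulrn ?root12_ge0// -powRrM mulVf// powRr1.
Qed.

Lemma is_derive_root12 (R : realType) (f : R -> R) (f' t : R) :
  0 < f t -> is_derive t 1 f f' ->
  is_derive t 1 (fun t => root12 (f t)) (f' / (12 * root12 (f t) ^+ 11)).
Proof.
move=> ft0 df.
have d1 := is_derive1_powR (12^-1) ft0.
have d2 : is_derive t 1 (fun t => root12 (f t)) (12^-1 * f t `^ (12^-1 - 1) * f').
  exact: is_derive1_comp.
apply: (is_derive_eq d2).
rewrite powRB; last by rewrite (gt_eqF ft0) implybT.
rewrite powRr1 ?ltW// -/(root12 (f t)) -{2}(root12K (ltW ft0)).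
have r0 := root12_gt0 ft0; field; rewrite gt_eqF//.
Qed.

Lemma root12_le (R : realType) (x c : R) : 0 <= x -> 0 <= c -> x <= c ^+ 12 -> root12 x <= c.
Proof.
by move=> x0 c0; rewrite -{1}(root12K x0) ler_pXn2r// nnegrE ?root12_ge0.
Qed.

Lemma root12_ge (R : realType) (x c : R) : 0 <= x -> 0 <= c -> c ^+ 12 <= x -> c <= root12 x.
Proof.
by move=> x0 c0; rewrite -{1}(root12K x0) ler_pXn2r// nnegrE ?root12_ge0.
Qed.

(** A smooth version, on the scale d, of the odd sixth root x |x|^(-5/6). *)
Definition sroot6 (R : realType) (d x : R) : R := x / root12 (x ^+ 2 + d ^+ 2) ^+ 5.

Lemma sqr_add_gt0 (R : realType) (x d : R) : 0 < d -> 0 < x ^+ 2 + d ^+ 2.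
Proof. by move=> d0; rewrite ltr_wpDl ?sqr_ge0// exprn_gt0. Qed.

Lemma is_derive_sroot6 (R : realType) (d x : R) : 0 < d ->
  is_derive x 1 (sroot6 d) ((1 - 5 / 6 * x ^+ 2 / (x ^+ 2 + d ^+ 2)) /
     root12 (x ^+ 2 + d ^+ 2) ^+ 5).
Proof.
move=> d0; have s0 := sqr_add_gt0 x d0; have r0 := root12_gt0 s0.
have d1 : is_derive x 1 (fun t => t ^+ 2 + d ^+ 2) (2 * x).
  by apply: is_derive_eq; rewrite /GRing.scale/=; ring.
have d2 := @is_derive_root12 R (fun t => t ^+ 2 + d ^+ 2) _ x s0 d1.
have d3 : is_derive x 1 (fun t => root12 (t ^+ 2 + d ^+ 2) ^+ 5)
   (5 * root12 (x ^+ 2 + d ^+ 2) ^+ 4 * (2 * x / (12 * root12 (x ^+ 2 + d ^+ 2) ^+ 11))).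
  by apply: is_derive_eq; rewrite /GRing.scale/=; ring.
have n0 : root12 (x ^+ 2 + d ^+ 2) ^+ 5 != 0 by rewrite expf_neq0// gt_eqF.
have d4 := @is_deriveV R (fun t => root12 (t ^+ 2 + d ^+ 2) ^+ 5) _ _ _ n0 d3.
apply: (is_derive_eq (is_deriveM (is_derive_id _ _) d4)); rewrite /GRing.scale/=.
move: (root12K (ltW s0)) r0; set r := root12 _; set s := _ + _.
rewrite -/s in r *; clearbody r s => <- r0.
by field; rewrite gt_eqF.
Qed.

Lemma continuous_expr (R : realType) (f : R -> R) (t : R) n :
  {for t, continuous f} -> {for t, continuous (fun t => f t ^+ n)}.
Proof.
by move=> cf; apply: (@continuous_comp _ _ _ f (fun x => x ^+ n)) => //; exact: exprn_continuous.
Qed.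

Lemma root12_continuous (R : realType) (f : R -> R) (t : R) :
  0 < f t -> {for t, continuous f} -> {for t, continuous (fun t => root12 (f t))}.
Proof.
move=> ft0 cf; apply: (@continuous_comp _ _ _ f (@root12 R)) => //.
exact: is_derive_cont (@is_derive_root12 R id 1 (f t) ft0 (is_derive_id _ _)).
Qed.

Lemma sroot6_le (R : realType) (d x : R) : 0 < d -> `|sroot6 d x| ^+ 6 <= `|x|.
Proof.
move=> d0; have s0 := sqr_add_gt0 x d0; have r0 := root12_gt0 s0.
have x0 : 0 <= `|x| by [].
rewrite normrM normfV (gtr0_norm (exprn_gt0 _ r0)) expr_div_n -exprM.
rewrite ler_pdivrMr ?exprn_gt0// [_ ^+ 6]exprS ler_wpM2l//.
rewrite -(@ler_pXn2r _ 2)// ?nnegrE ?exprn_ge0 ?(ltW r0)//.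
rewrite -!exprM (_ : (5 * 6 * 2 = 12 * 5)%N)// (exprM (root12 _)) (root12K (ltW s0)).
rewrite mulnC exprM ler_pXn2r// ?nnegrE ?(ltW s0) ?sqr_ge0//.
by rewrite -normrX ger0_norm ?sqr_ge0// lerDl sqr_ge0.
Qed.

(** The derivative of sroot6 at x is at most |x|^(-5/6), with sixth powers in place
    of fractional exponents. *)
Lemma sroot6_slope (R : realType) (d x D : R) : 0 < d -> 0 <= D -> D <= `|x| ->
  `|(1 - 5 / 6 * x ^+ 2 / (x ^+ 2 + d ^+ 2)) / root12 (x ^+ 2 + d ^+ 2) ^+ 5| ^+ 6
    * D ^+ 5 <= 1.
Proof.
move=> d0 D0 Dx; have s0 := sqr_add_gt0 x d0; have r0 := root12_gt0 s0.
have r5 := exprn_gt0 5 r0.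
have q1 : 0 <= x ^+ 2 / (x ^+ 2 + d ^+ 2) <= 1.
  rewrite divr_ge0 ?sqr_ge0 ?(ltW s0)//= ler_pdivrMr// mul1r lerDl sqr_ge0//.
rewrite normrM normfV (gtr0_norm r5) exprMn exprVn -exprM mulrAC.
rewrite ler_pdivrMr ?exprn_gt0// mul1r.
apply: (@le_trans _ _ (1 * `|x| ^+ 5)).
  apply: ler_pM; rewrite ?exprn_ge0//.
    rewrite exprn_ile1// -mulrA ler_norml; apply/andP; split; lra.
  by rewrite ler_pXn2r// nnegrE.
rewrite mul1r -(@ler_pXn2r _ 2)// ?nnegrE ?exprn_ge0 ?(ltW r0)//.
rewrite -!exprM (_ : (5 * 6 * 2 = 12 * 5)%N)// (exprM (root12 _)) (root12K (ltW s0)).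
rewrite mulnC exprM ler_pXn2r// ?nnegrE ?(ltW s0) ?sqr_ge0//.
by rewrite -normrX ger0_norm ?sqr_ge0// lerDl sqr_ge0.
Qed.

(** If 0 is close to u and v relative to their distance, both values are small;
    otherwise the derivative between u and v is. *)
Lemma sroot6_holder (R : realType) (d u v : R) : 0 < d ->
  `|sroot6 d u - sroot6 d v| ^+ 6 <= 128 * `|u - v|.
Proof.
move=> d0; wlog uv : u v / u <= v => [H|].
  by have [/H//|/ltW/H] := leP u v; rewrite distrC [`|v - u|]distrC.
move: uv; rewrite le_eqVlt => /predU1P[->|uv].
  by rewrite !subrr normr0 expr0n mulr0.
have D0 : 0 < `|u - v| by rewrite normr_gt0 subr_eq0 lt_eqF.
have DE : `|u - v| = v - u by rewrite distrC gtr0_norm// subr_gt0.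
have [[s us sD]|far] := pselect (exists2 s, u <= s <= v & `|s| < `|u - v|).
- have su : `|u| <= 2 * `|u - v|.
    by move: sD; rewrite DE ltr_norml => ?; rewrite ler_norml; apply/andP; split; lra.
  have sv : `|v| <= 2 * `|u - v|.
    by move: sD; rewrite DE ltr_norml => ?; rewrite ler_norml; apply/andP; split; lra.
  have Fu := le_trans (sroot6_le u d0) su; have Fv := le_trans (sroot6_le v d0) sv.
  set A := sroot6 d u in Fu *; set B := sroot6 d v in Fv *.
  have [m mD [Am Bm]] : exists2 m, m ^+ 6 <= 2 * `|u - v| & `|A| <= m /\ `|B| <= m.
    have [AB|BA] := leP `|A| `|B|; first by exists `|B|.
    by exists `|A| => //; split => //; exact: ltW.
  have m0 : 0 <= m by exact: le_trans Am.
  apply: (@le_trans _ _ ((2 * m) ^+ 6)).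
    rewrite ler_pXn2r ?nnegrE ?mulr_ge0//.
    by rewrite (le_trans (ler_normB _ _))//; lra.
  by rewrite exprMn; move: mD; lra.
- have df t : u - 1 < t < v + 1 -> is_derive t 1 (sroot6 d) _ := fun=> is_derive_sroot6 t d0.
  have [||c /andP[uc cv] ] := mvt_oo df _ uv; [lra|lra|].
  rewrite distrC => ->; rewrite normrM exprMn.
  have cD : `|u - v| <= `|c|.
    rewrite leNgt; apply/negP => cD; apply: far; exists c => //.
    by rewrite !ltW.
  have H := sroot6_slope d0 (normr_ge0 _) cD.
  rewrite [`|v - u|]distrC [`|u - v| ^+ 6]exprSr mulrA.
  by rewrite ler_wpM2r// (le_trans H)// ler1n.
Qed.

(** The variation bound for F = sroot6 d (g), whose derivative is comparable to
    |g'| / (g^2 + d^2)^(5/12). *)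
Lemma tv_sroot6 (R : realType) (a b M d B x y : R) (g g' W : R -> R) :
  (forall t, a < t < b -> is_derive t 1 g (g' t)) -> Ckb 5 a b M g' -> 1 <= M ->
  0 < d -> 0 <= B ->
  (forall t, a < t < b ->
     is_derive t 1 W (`|g' t| / root12 (g t ^+ 2 + d ^+ 2) ^+ 5)) ->
  a < x -> x <= y -> y < b -> (forall t, x <= t <= y -> `|g t| <= B ^+ 6) ->
  W y - W x <= 7680 * M * ((y - x) + B).
Proof.
move=> dg Cg' M1 d0 B0 dW ax xy yb gB.
pose u t := (1 - 5 / 6 * g t ^+ 2 / (g t ^+ 2 + d ^+ 2)) / root12 (g t ^+ 2 + d ^+ 2) ^+ 5.
pose F t := sroot6 d (g t).
pose F' t := g' t * u t.
have s0 t := sqr_add_gt0 (g t) d0.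
have r0 t : 0 < root12 (g t ^+ 2 + d ^+ 2) ^+ 5 by rewrite exprn_gt0// root12_gt0.
have u6 t : 1 <= 6 * (1 - 5 / 6 * g t ^+ 2 / (g t ^+ 2 + d ^+ 2)) <= 6.
  have : 0 <= g t ^+ 2 / (g t ^+ 2 + d ^+ 2) <= 1.
    by rewrite divr_ge0 ?sqr_ge0 ?(ltW (s0 t))//= ler_pdivrMr// mul1r lerDl sqr_ge0.
  by move=> ?; lra.
have u0 t : 0 < u t by rewrite divr_gt0//; have := u6 t; lra.
have dF t : a < t < b -> is_derive t 1 F (F' t).
  move=> tab; have := is_derive1_comp (is_derive_sroot6 (g t) d0) (dg t tab).
  by move=> H; apply: (is_derive_eq H); rewrite /F' /u mulrC.
have cg t : a < t < b -> {for t, continuous g}.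
  by move=> tab; exact: is_derive_cont (dg t tab).
have cg' t : a < t < b -> {for t, continuous g'}.
  by case: Cg' => _ [g2 [dg2 _]] tab; exact: is_derive_cont (dg2 t tab).
have cs t : a < t < b -> {for t, continuous (fun t => g t ^+ 2 + d ^+ 2)}.
  move=> tab; apply: continuousD; last exact: cst_continuous.
  by apply: continuous_expr; exact: cg.
have cr t : a < t < b -> {for t, continuous (fun t => (root12 (g t ^+ 2 + d ^+ 2) ^+ 5)^-1)}.
  move=> tab; apply: continuousV; first by rewrite gt_eqF.
  by apply: continuous_expr; apply: root12_continuous => //; exact: cs.
have cu t : a < t < b -> {for t, continuous u}.
  move=> tab; apply: continuousM; last exact: cr.
  apply: continuousB; first exact: cst_continuous.
  apply: continuousM; last by apply: continuousV; [rewrite gt_eqF|exact: cs].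
  apply: continuousM; first exact: cst_continuous.
  by apply: continuous_expr; exact: cg.
have cF' t : a < t < b -> {for t, continuous F'}.
  by move=> tab; apply: continuousM; [exact: cg'|exact: cu].
have cnF' t : a < t < b -> {for t, continuous (fun t => `|F' t|)}.
  by move=> tab; apply: cvg_norm; exact: cF'.
have M0 : 0 <= M by lra.
have [V dV] : exists V : R -> R, forall t, a < t < b -> is_derive t 1 V `|F' t|.
  apply: (@primitive_oo _ _ _ (M * (root12 (d ^+ 2) ^+ 5)^-1)) => // t tab.
  rewrite normr_id normrM ler_pM//; first exact: (Ckb_bound Cg').
  rewrite gtr0_norm// /u -[X in _ <= X]mul1r ler_pM//.
  - by have := u6 t; lra.
  - by rewrite invr_ge0 ltW.
  - by have := u6 t; lra.
  - have rd : 0 < root12 (d ^+ 2) by rewrite root12_gt0// exprn_gt0.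
    rewrite lef_pV2 ?posrE ?exprn_gt0//; last by rewrite root12_gt0.
    rewrite ler_pXn2r// ?nnegrE ?root12_ge0//.
    apply: root12_ge; rewrite ?(ltW (s0 t)) ?root12_ge0//.
    by rewrite root12K ?sqr_ge0// lerDr sqr_ge0.
have dV6 t : a < t < b -> is_derive t 1 (fun t => 6 * V t) (6 * `|F' t|).
  by move=> tab; have ? := dV t tab; apply: is_derive_eq; rewrite /GRing.scale/=; ring.
have H1 : W y - W x <= 6 * V y - 6 * V x.
  apply: (derive_le dW dV6) => // t /andP[xt ty].
  rewrite normrM (gtr0_norm (u0 t)) mulrCA ler_wpM2l// /u mulrA.
  by rewrite ler_peMl ?invr_ge0 ?(ltW (r0 _))//; have := u6 t; lra.
have FB t : x <= t <= y -> `|F t| <= B.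
  move=> /gB H; rewrite -(@ler_pXn2r _ 6)// ?nnegrE//.
  exact: le_trans (sroot6_le _ d0) H.
have H2 : V y - V x <= 10 * (128 * M) * (y - x) + 11 * (2 * B).
  apply: (tv_bound (K := 128) dg Cg' M0 dF cF' (u := u) _ _ dV) => //.
  - by rewrite mulr_ge0.
  - rewrite [X in _ <= X]exprSr ler_peMl ?mulr_ge0//.
    by rewrite exprn_ege1//; lra.
  - by move=> s t _ _; exact: sroot6_holder.
  - move=> s t sxy txy; rewrite (le_trans (ler_normB _ _))//.
    by have := FB s sxy; have := FB t txy; lra.
have yx : 0 <= y - x by rewrite subr_ge0.
have : 0 <= (M - 1) * B by rewrite mulr_ge0//; lra.
have : 0 <= M * (y - x) by rewrite mulr_ge0.
by nra.
Qed.

(** The variation bound for g itself: as g is bounded by B, its oscillation to the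
    power 6 is at most (2 B)^5 times its oscillation. *)
Lemma tv_id (R : realType) (a b M c B x y : R) (g g' W : R -> R) :
  (forall t, a < t < b -> is_derive t 1 g (g' t)) -> Ckb 5 a b M g' -> 0 <= M ->
  0 <= B -> 0 <= c -> 32 * B ^+ 5 * M <= c ^+ 6 ->
  (forall t, a < t < b -> is_derive t 1 W `|g' t|) ->
  a < x -> x <= y -> y < b -> (forall t, x <= t <= y -> `|g t| <= B) ->
  W y - W x <= 10 * c * (y - x) + 22 * B.
Proof.
move=> dg Cg' M0 B0 c0 cB dW ax xy yb gB.
have cg' t : a < t < b -> {for t, continuous g'}.
  by case: Cg' => _ [g2 [dg2 _]] tab; exact: is_derive_cont (dg2 t tab).
have H s t : x <= s <= y -> x <= t <= y -> `|g s - g t| <= 2 * B.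
  move=> sxy txy; rewrite (le_trans (ler_normB _ _))//.
  by have := gB s sxy; have := gB t txy; lra.
have -> : 22 * B = 11 * (2 * B) by ring.
apply: (tv_bound (K := 32 * B ^+ 5) dg Cg' M0 dg cg' (u := fun=> 1) _ _ dW) => //.
- by move=> t _; rewrite mulr1.
- by rewrite mulr_ge0// exprn_ge0.
- move=> s t sxy txy; rewrite exprSr ler_wpM2r//.
  have -> : 32 * B ^+ 5 = (2 * B) ^+ 5 by ring.
  by rewrite ler_pXn2r ?nnegrE ?mulr_ge0//; exact: H.
Qed.

(** * Pointwise bounds for the power 6/5 *)

Lemma expr_mono (R : realType) (x y : R) n : 0 <= x -> x <= y -> x ^+ n <= y ^+ n.
Proof. by move=> x0 xy; rewrite lerXn2r// nnegrE// (le_trans x0). Qed.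

(** Comparing sixth powers with fifth powers keeps the exponent 6/5 out of the
    estimates that follow. *)
Lemma pow65_le (R : realType) (z u : R) : 0 <= z -> 0 <= u ->
  z ^+ 6 <= u ^+ 5 -> z `^ (6 / 5) <= u.
Proof.
move=> z0 u0 zu; rewrite -(@ler_pXn2r _ 5) ?nnegrE ?powR_ge0//.
rewrite -powR_mulrn ?powR_ge0// -powRrM.
have -> : 6 / 5 * 5%:R = 6%:R :> R by field.
by rewrite powR_mulrn.
Qed.

Lemma pow65_sum (R : realType) (z1 z2 z3 u1 u2 u3 : R) :
  0 <= z1 -> 0 <= z2 -> 0 <= z3 -> 0 <= u1 -> 0 <= u2 -> 0 <= u3 ->
  z1 ^+ 6 <= u1 ^+ 5 -> z2 ^+ 6 <= u2 ^+ 5 -> z3 ^+ 6 <= u3 ^+ 5 ->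
  (z1 + z2 + z3) `^ (6 / 5) <= 2 ^+ 12 * (u1 + u2 + u3).
Proof.
move=> z10 z20 z30 u10 u20 u30 H1 H2 H3.
have U0 : 0 <= u1 + u2 + u3 by rewrite !addr_ge0.
have U7 : 0 <= 2 ^+ 12 * (u1 + u2 + u3) by rewrite mulr_ge0// exprn_ge0.
have Z0 : 0 <= z1 + z2 + z3 by rewrite !addr_ge0.
apply: (pow65_le Z0 U7).
suff [m m0 [mu mz]] : exists2 m, 0 <= m &
    m ^+ 6 <= (u1 + u2 + u3) ^+ 5 /\ z1 + z2 + z3 <= 3 * m.
  apply: (@le_trans _ _ ((4 * m) ^+ 6)); first by apply: expr_mono => //; lra.
  have c1 : 1 <= 2 ^+ 12 :> R by rewrite exprn_ege1// ler1n.
  have -> : (4 * m) ^+ 6 = 2 ^+ 12 * m ^+ 6 by ring.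
  move: (2 ^+ 12 : R) c1 => c c1; rewrite exprMn ler_pM ?exprn_ge0//; first lra.
  by rewrite -{1}[c]expr1 ler_weXn2l.
have le5 u : 0 <= u -> u <= u1 + u2 + u3 -> u ^+ 5 <= (u1 + u2 + u3) ^+ 5.
  by move=> u0 uU; apply: expr_mono.
have [z12|z21] := leP z1 z2.
- have [z23|z32] := leP z2 z3.
  + by exists z3 => //; split; [apply: (le_trans H3); apply: le5 => //; lra|lra].
  + by exists z2 => //; split; [apply: (le_trans H2); apply: le5 => //; lra|lra].
- have [z23|z32] := leP z1 z3.
  + by exists z3 => //; split; [apply: (le_trans H3); apply: le5 => //; lra|lra].
  + by exists z1 => //; split; [apply: (le_trans H1); apply: le5 => //; lra|lra].
Qed.

Lemma pow5_ge (R : realType) (c : R) : 1 <= c -> 2 ^+ 19 * c <= (2 ^+ 4 * c) ^+ 5.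
Proof.
move=> c1; rewrite exprMn -exprM ler_pM//.
- exact: le_trans c1.
- by rewrite ler_weXn2l// ler1n.
- by rewrite -{1}[c]expr1 ler_weXn2l.
Qed.

(** The numbers dq, dp, dD stand for the sizes of q', p', D' at a point, where
    D = 27 q^2 + 4 p^3, and V for |D|^(1/6).  The scale rho of the roots
    is s up to a factor 2. *)
Section leaf_numbers.
Context (R : realType) (c rho s t V dq dp dD : R).
Hypotheses (c1 : 1 <= c) (r0 : 0 < rho) (rs : rho <= s) (sr : s <= 2 * rho)
  (V0 : 0 < V) (Vr : V <= 4 * rho)
  (dq0 : 0 <= dq) (dp0 : 0 <= dp) (dD0 : 0 <= dD).

Let z3 : R := dD / (V ^+ 3 * rho ^+ 2).
Let r0' : 0 <= rho := ltW r0.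
Let V0' : 0 <= V := ltW V0.
Let c0 : 0 <= c. Proof. exact: le_trans c1. Qed.
Let s0 : 0 < s. Proof. exact: lt_le_trans rs. Qed.

(* The common shape of the two estimates of the term with the discriminant. *)
Let term3 (u C : R) : 0 <= u -> dD * V ^+ 7 * u <= C * rho ^+ 12 ->
  C <= (2 ^+ 4 * c) ^+ 5 ->
  z3 ^+ 6 * u <= (2 ^+ 4 * c) ^+ 5 * (dD / V ^+ 5) ^+ 5.
Proof.
move=> u0 H CK.
have -> : (2 ^+ 4 * c) ^+ 5 * (dD / V ^+ 5) ^+ 5 =
    (dD ^+ 5 / V ^+ 25) * (2 ^+ 4 * c) ^+ 5.
  by rewrite expr_div_n -exprM mulrC.
have -> : z3 ^+ 6 * u = (dD ^+ 5 / V ^+ 25) * (dD * V ^+ 7 * u / rho ^+ 12).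
  by rewrite /z3; field; rewrite !gt_eqF.
have P : 0 <= dD ^+ 5 / V ^+ 25 by rewrite divr_ge0// exprn_ge0.
rewrite (ler_wpM2l P)// ler_pdivrMr ?exprn_gt0// (le_trans H)//.
by rewrite ler_wpM2r// exprn_ge0.
Qed.

Let V7 : V ^+ 7 <= 2 ^+ 14 * rho ^+ 7.
Proof.
have -> : 2 ^+ 14 * rho ^+ 7 = (4 * rho) ^+ 7 by ring.
exact: expr_mono.
Qed.

Let sX n : s ^+ n <= 2 ^+ n * rho ^+ n.
Proof. by rewrite -exprMn; apply: expr_mono => //; exact: ltW. Qed.

(** Derivatives as large as the scaling of the coefficients predicts cost a
    constant, and the discriminant is charged to its own sixth root. *)
Lemma leaf_large : dq <= c * s ^+ 2 -> dp <= c * s -> dD <= c * s ^+ 5 ->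
  (dq / rho ^+ 2 + dp / rho + dD / (V ^+ 3 * rho ^+ 2)) `^ (6 / 5) <=
  2 ^+ 12 * ((4 * c) ^+ 2 + (4 * c) ^+ 2 + 2 ^+ 4 * c * (dD / V ^+ 5)).
Proof.
move=> Hq Hp HD; rewrite -/z3.
have z10 : 0 <= dq / rho ^+ 2 by rewrite divr_ge0// exprn_ge0.
have z20 : 0 <= dp / rho by rewrite divr_ge0.
have z30 : 0 <= z3 by rewrite divr_ge0// mulr_ge0// exprn_ge0.
have u30 : 0 <= 2 ^+ 4 * c * (dD / V ^+ 5).
  by rewrite !mulr_ge0 ?exprn_ge0// invr_ge0 exprn_ge0.
have sq (z : R) : 0 <= z -> z <= 4 * c -> z ^+ 6 <= ((4 * c) ^+ 2) ^+ 5.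
  move=> z0 zc; rewrite -exprM (@le_trans _ _ ((4 * c) ^+ 6))//.
    exact: expr_mono.
  by rewrite ler_weXn2l//; move: c1; lra.
apply: pow65_sum; rewrite ?sqr_ge0//.
- apply: sq => //; rewrite ler_pdivrMr ?exprn_gt0// (le_trans Hq)//.
  by rewrite [4 * c]mulrC -mulrA ler_wpM2l// (le_trans (sX 2%N))// (_ : 2 ^+ 2 = 4 :> R)//; ring.
- apply: sq => //; rewrite ler_pdivrMr// (le_trans Hp)//.
  by rewrite [4 * c]mulrC -mulrA ler_wpM2l//; move: sr r0; lra.
- rewrite [X in _ <= X]exprMn -[X in X <= _]mulr1.
  apply: (term3 (C := 2 ^+ 19 * c)) => //; last exact: pow5_ge.
  rewrite mulr1.
  have H : dD <= c * (2 ^+ 5 * rho ^+ 5) by rewrite (le_trans HD)// ler_wpM2l.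
  apply: (le_trans (ler_pM dD0 (exprn_ge0 7 V0') H V7)).
  by rewrite (_ : c * (2 ^+ 5 * rho ^+ 5) * (2 ^+ 14 * rho ^+ 7) = 2 ^+ 19 * c * rho ^+ 12)//; ring.
Qed.

(** When the derivatives are only known to be bounded, the terms with q and p are
    charged to the variations of q and p, at the price of the powers of t = s^(1/5)
    that a variation of order s^3, respectively s^2, compensates. *)
Lemma leaf_small : 0 < t -> t ^+ 5 = s -> dq <= c -> dp <= c -> dD <= c * rho ^+ 3 ->
  (dq / rho ^+ 2 + dp / rho + dD / (V ^+ 3 * rho ^+ 2)) `^ (6 / 5) <=
  2 ^+ 12 * (2 ^+ 4 * c * (dq / t ^+ 12) + 2 ^+ 4 * c * (dp / t ^+ 6) +
         2 ^+ 4 * c * (dD / V ^+ 5 / t ^+ 2)).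
Proof.
move=> t0 ts Hq Hp HD; rewrite -/z3; have t0' := ltW t0.
have z10 : 0 <= dq / rho ^+ 2 by rewrite divr_ge0// exprn_ge0.
have z20 : 0 <= dp / rho by rewrite divr_ge0.
have z30 : 0 <= z3 by rewrite divr_ge0// mulr_ge0// exprn_ge0.
have C0 : 0 <= 2 ^+ 4 * c by rewrite mulr_ge0// exprn_ge0.
have u10 : 0 <= 2 ^+ 4 * c * (dq / t ^+ 12).
  by rewrite mulr_ge0// divr_ge0// exprn_ge0.
have u20 : 0 <= 2 ^+ 4 * c * (dp / t ^+ 6).
  by rewrite mulr_ge0// divr_ge0// exprn_ge0.
have u30 : 0 <= 2 ^+ 4 * c * (dD / V ^+ 5 / t ^+ 2).
  by rewrite mulr_ge0// !divr_ge0// exprn_ge0.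
have sqq (d : R) n k : 0 <= d -> d <= c -> (k <= 19)%N -> (n * 6 = k)%N ->
    (d / rho ^+ n) ^+ 6 <= (2 ^+ 4 * c) ^+ 5 * (d ^+ 5 / s ^+ k).
  move=> d0 dM k19 nk.
  have -> : (d / rho ^+ n) ^+ 6 = d * (d ^+ 5 / rho ^+ k).
    by rewrite expr_div_n -exprM nk exprS mulrA.
  have P : 0 <= d ^+ 5 / rho ^+ k by rewrite divr_ge0// exprn_ge0.
  have Q : 0 <= d ^+ 5 / s ^+ k by rewrite divr_ge0// exprn_ge0// ltW.
  apply: (le_trans (ler_wpM2r P dM)).
  have H : d ^+ 5 / rho ^+ k <= 2 ^+ k * (d ^+ 5 / s ^+ k).
    rewrite mulrCA ler_wpM2l ?exprn_ge0//.
    rewrite ler_pdivlMr ?exprn_gt0// ler_pdivrMl ?exprn_gt0// mulrC.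
    exact: sX.
  apply: (le_trans (ler_wpM2l c0 H)); rewrite [X in X <= _]mulrA (ler_wpM2r Q)//.
  rewrite (le_trans _ (pow5_ge c1))// mulrC ler_wpM2r//.
  by rewrite ler_weXn2l// ler1n.
have tE d n : (d / t ^+ n) ^+ 5 = d ^+ 5 / s ^+ n.
  by rewrite expr_div_n -exprM mulnC exprM ts.
apply: pow65_sum => //.
- rewrite [X in _ <= X]exprMn tE; exact: sqq.
- rewrite [X in _ <= X]exprMn tE.
  by rewrite -{1}[rho]expr1; apply: sqq.
- rewrite [X in _ <= X]exprMn tE.
  rewrite mulrA ler_pdivlMr ?exprn_gt0//.
  apply: (term3 (C := 2 ^+ 19 * c)); [by rewrite exprn_ge0// ltW| |exact: pow5_ge].
  have H : dD * V ^+ 7 <= c * rho ^+ 3 * (2 ^+ 14 * rho ^+ 7).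
    by apply: ler_pM => //; rewrite exprn_ge0.
  have s20 : 0 <= s ^+ 2 by rewrite exprn_ge0// ltW.
  have B0 : 0 <= c * rho ^+ 3 * (2 ^+ 14 * rho ^+ 7) by rewrite !mulr_ge0// exprn_ge0.
  apply: (le_trans (ler_wpM2r s20 H)); apply: (le_trans (ler_wpM2l B0 (sX 2%N))).
  have -> : c * rho ^+ 3 * (2 ^+ 14 * rho ^+ 7) * (2 ^+ 2 * rho ^+ 2) =
     2 ^+ 16 * (c * rho ^+ 12) by ring.
  rewrite -mulrA ler_wpM2r//; first by rewrite mulr_ge0// exprn_ge0.
  by rewrite ler_weXn2l// ler1n.
Qed.

End leaf_numbers.

(** * The coefficients of a cubic and the scale of its roots *)

Record smooth (R : realType) (a b M : R) (g g' : R -> R) : Prop := Smooth {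
  smooth_derive : forall t, a < t < b -> is_derive t 1 g (g' t);
  smooth_Ckb : Ckb 5 a b M g';
  smooth_bound : forall t, a < t < b -> `|g t| <= M }.

Lemma smooth_continuous (R : realType) (a b M : R) g g' t :
  smooth a b M g g' -> a < t < b -> {for t, continuous g}.
Proof. by move=> [dg _ _] tab; exact: is_derive_cont (dg t tab). Qed.

Lemma smooth_continuous' (R : realType) (a b M : R) g g' t :
  smooth a b M g g' -> a < t < b -> {for t, continuous g'}.
Proof.
by move=> [_ [_ [g2 [dg2 _]]] _] tab; exact: is_derive_cont (dg2 t tab).
Qed.

Lemma smooth_bound' (R : realType) (a b M : R) g g' t :
  smooth a b M g g' -> a < t < b -> `|g' t| <= M.
Proof. by move=> [_ H _]; exact: (Ckb_bound H). Qed.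

(** The density of the variation of the sixth root of g, smoothed at scale e. *)
Definition wdens (R : realType) (e : R) (g g' : R -> R) (t : R) : R :=
  `|g' t| / root12 (g t ^+ 2 + e ^+ 12) ^+ 5.

Lemma wdens_ge0 (R : realType) (e : R) g g' t : 0 <= wdens e g g' t.
Proof. by rewrite divr_ge0// exprn_ge0// root12_ge0. Qed.

Lemma wdens_primitive (R : realType) (a b M e : R) g g' : 0 < e ->
  smooth a b M g g' ->
  exists W : R -> R, forall t, a < t < b -> is_derive t 1 W (wdens e g g' t).
Proof.
move=> e0 sg; have e12 : 0 < e ^+ 12 by rewrite exprn_gt0.
have s0 t : 0 < g t ^+ 2 + e ^+ 12 by rewrite ltr_wpDl ?sqr_ge0.
have r0 t : 0 < root12 (g t ^+ 2 + e ^+ 12) ^+ 5 by rewrite exprn_gt0// root12_gt0.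
apply: (@primitive_oo _ _ _ (M * (root12 (e ^+ 12) ^+ 5)^-1)) => t tab.
- apply: continuousM; first by apply: cvg_norm; exact: smooth_continuous' sg tab.
  apply: continuousV; first by rewrite gt_eqF.
  apply: continuous_expr; apply: root12_continuous => //.
  apply: continuousD; last exact: cst_continuous.
  by apply: continuous_expr; exact: smooth_continuous sg tab.
- rewrite ger0_norm ?wdens_ge0// ler_pM ?invr_ge0 ?(ltW (r0 t))//.
    exact: smooth_bound' sg tab.
  rewrite lef_pV2 ?posrE// ?exprn_gt0 ?root12_gt0//.
  apply: expr_mono; first exact: root12_ge0.
  apply: root12_ge; [exact: ltW|exact: root12_ge0|].
  by rewrite root12K ?(ltW e12)// lerDr sqr_ge0.
Qed.

Lemma abs_primitive (R : realType) (a b M : R) g g' : smooth a b M g g' ->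
  exists W : R -> R, forall t, a < t < b -> is_derive t 1 W `|g' t|.
Proof.
move=> sg; apply: (@primitive_oo _ _ _ M) => t tab.
- by apply: cvg_norm; exact: smooth_continuous' sg tab.
- by rewrite normr_id; exact: smooth_bound' sg tab.
Qed.

(** The variation of the sixth root of g, uniformly in the smoothing; this is what the
    six derivatives are for. *)
Lemma tv_wdens (R : realType) (a b M e B x y : R) g g' W : 1 <= M -> 0 < e -> 0 <= B ->
  smooth a b M g g' ->
  (forall t, a < t < b -> is_derive t 1 W (wdens e g g' t)) ->
  a < x -> x <= y -> y < b -> (forall t, x <= t <= y -> `|g t| <= B ^+ 6) ->
  W y - W x <= 2 ^+ 13 * M * ((y - x) + B).
Proof.
move=> M1 e0 B0 [dg Cg gb] dW ax xy yb gB.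
have e6 : 0 < e ^+ 6 by rewrite exprn_gt0.
have dW' t : a < t < b -> is_derive t 1 W (`|g' t| / root12 (g t ^+ 2 + (e ^+ 6) ^+ 2) ^+ 5).
  by move=> tab; rewrite -exprM; exact: dW.
have H := tv_sroot6 dg Cg M1 e6 B0 dW' ax xy yb gB.
apply: (le_trans H); rewrite ler_wpM2r//; first by rewrite addr_ge0 ?subr_ge0.
by rewrite ler_wpM2r//; [lra|lra].
Qed.

(** Real and imaginary parts of 27 q^2 + 4 p^3, which is minus the discriminant of
    Z^3 + p Z + q, and of its derivative. *)
Definition disc1 (R : realType) (q1 q2 p1 p2 : R) : R :=
  27 * (q1 ^+ 2 - q2 ^+ 2) + 4 * (p1 ^+ 3 - 3 * p1 * p2 ^+ 2).
Definition disc2 (R : realType) (q1 q2 p1 p2 : R) : R :=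
  54 * q1 * q2 + 4 * (3 * p1 ^+ 2 * p2 - p2 ^+ 3).
Definition disc1' (R : realType) (q1 q2 p1 p2 q1' q2' p1' p2' : R) : R :=
  54 * (q1 * q1' - q2 * q2') +
  12 * ((p1 ^+ 2 - p2 ^+ 2) * p1' - 2 * p1 * p2 * p2').
Definition disc2' (R : realType) (q1 q2 p1 p2 q1' q2' p1' p2' : R) : R :=
  54 * (q1 * q2' + q2 * q1') +
  12 * ((p1 ^+ 2 - p2 ^+ 2) * p2' + 2 * p1 * p2 * p1').

(** The cubic Z^3 + p Z + q with p = p1 + i p2 and q = q1 + i q2, and minus its
    discriminant D1 + i D2, in C^6 with a common bound. *)
Record cubic_data (R : realType) (a b M : R) := CubicData {
  q1 : R -> R; q2 : R -> R; p1 : R -> R; p2 : R -> R;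
  q1' : R -> R; q2' : R -> R; p1' : R -> R; p2' : R -> R;
  D1 := fun t => disc1 (q1 t) (q2 t) (p1 t) (p2 t);
  D2 := fun t => disc2 (q1 t) (q2 t) (p1 t) (p2 t);
  D1' := fun t => disc1' (q1 t) (q2 t) (p1 t) (p2 t) (q1' t) (q2' t) (p1' t) (p2' t);
  D2' := fun t => disc2' (q1 t) (q2 t) (p1 t) (p2 t) (q1' t) (q2' t) (p1' t) (p2' t);
  smooth_q1 : smooth a b M q1 q1'; smooth_q2 : smooth a b M q2 q2';
  smooth_p1 : smooth a b M p1 p1'; smooth_p2 : smooth a b M p2 p2';
  smooth_D1 : smooth a b M D1 D1'; smooth_D2 : smooth a b M D2 D2' }.

Section cubic_scale.
Context (R : realType) (a b M : R) (d : cubic_data a b M) (e t : R).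
Hypotheses (M1 : 1 <= M) (e0 : 0 < e) (e1 : e <= 1) (tab : a < t < b).

(** The twelfth power of the scale of the roots, which is comparable to
    max(|p|^(1/2), |q|^(1/3)).  A positive e smooths the scale where it vanishes. *)
Definition rho12 : R := q1 d t ^+ 4 + q2 d t ^+ 4 + p1 d t ^+ 6 + p2 d t ^+ 6.
Definition rho : R := root12 (rho12 + e ^+ 12).
Definition discr6 : R := root12 (D1 d t ^+ 2 + D2 d t ^+ 2 + e ^+ 12).

(** Up to constants this is |q'| / rho^2 + |p'| / rho + |D'| / (|D|^(1/2) rho^2), an
    upper gradient for every continuous root. *)
Definition hdens : R :=
  (`|q1' d t| + `|q2' d t|) / rho ^+ 2 + (`|p1' d t| + `|p2' d t|) / rho +
  (`|D1' d t| + `|D2' d t|) / (discr6 ^+ 3 * rho ^+ 2).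

(** The density that pays for the integral of hdens^(6/5): its primitive bounds the
    length and the variations of the sixth roots of the components. *)
Definition adens : R := 1 + wdens e (q1 d) (q1' d) t + wdens e (q2 d) (q2' d) t +
  wdens e (p1 d) (p1' d) t + wdens e (p2 d) (p2' d) t +
  wdens e (D1 d) (D1' d) t + wdens e (D2 d) (D2' d) t.

Let even_ge0 (x : R) n : 0 <= x ^+ n.*2.
Proof. by rewrite -muln2 mulnC exprM exprn_ge0// sqr_ge0. Qed.

Lemma rho12_ge0 : 0 <= rho12.
Proof.
by rewrite /rho12 !addr_ge0//; [exact: (even_ge0 _ 2)|exact: (even_ge0 _ 2)|
  exact: (even_ge0 _ 3)|exact: (even_ge0 _ 3)].
Qed.

Let e12 : 0 < e ^+ 12. Proof. by rewrite exprn_gt0. Qed.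

Lemma rho_gt0 : 0 < rho.
Proof. by rewrite root12_gt0// ltr_wpDl// rho12_ge0. Qed.

Lemma rhoX : rho ^+ 12 = rho12 + e ^+ 12.
Proof. by rewrite root12K// addr_ge0 ?rho12_ge0// ltW. Qed.

Lemma discr6_gt0 : 0 < discr6.
Proof. by rewrite root12_gt0// ltr_wpDl// addr_ge0// sqr_ge0. Qed.

Let abs_le (x r : R) n k : (n.*2 * k = 12)%N -> 0 <= r ->
  x ^+ n.*2 <= r ^+ 12 -> (0 < n)%N -> `|x| <= r ^+ k.
Proof.
move=> nk r0 H n0; rewrite -(@ler_pXn2r _ n.*2) ?double_gt0// ?nnegrE ?exprn_ge0//.
by rewrite -exprM mulnC nk -normrX ger0_norm.
Qed.

Lemma q1_le : `|q1 d t| <= rho ^+ 3.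
Proof.
apply: (@abs_le _ _ 2) => //; first exact: ltW rho_gt0.
rewrite rhoX /rho12; have := even_ge0 (q2 d t) 2; have := even_ge0 (p1 d t) 3.
by have := even_ge0 (p2 d t) 3; have := e12; rewrite /=; lra.
Qed.

Lemma q2_le : `|q2 d t| <= rho ^+ 3.
Proof.
apply: (@abs_le _ _ 2) => //; first exact: ltW rho_gt0.
rewrite rhoX /rho12; have := even_ge0 (q1 d t) 2; have := even_ge0 (p1 d t) 3.
by have := even_ge0 (p2 d t) 3; have := e12; rewrite /=; lra.
Qed.

Lemma p1_le : `|p1 d t| <= rho ^+ 2.
Proof.
apply: (@abs_le _ _ 3) => //; first exact: ltW rho_gt0.
rewrite rhoX /rho12; have := even_ge0 (q1 d t) 2; have := even_ge0 (q2 d t) 2.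
by have := even_ge0 (p2 d t) 3; have := e12; rewrite /=; lra.
Qed.

Lemma p2_le : `|p2 d t| <= rho ^+ 2.
Proof.
apply: (@abs_le _ _ 3) => //; first exact: ltW rho_gt0.
rewrite rhoX /rho12; have := even_ge0 (q1 d t) 2; have := even_ge0 (q2 d t) 2.
by have := even_ge0 (p1 d t) 3; have := e12; rewrite /=; lra.
Qed.

Let evn (x : R) n : `|x| <= M -> x ^+ n.*2 <= M ^+ n.*2.
Proof.
by move=> xM; rewrite -[x ^+ _]ger0_norm// normrX; apply: expr_mono.
Qed.

Lemma rho_le : rho <= 5 * M.
Proof.
have M0 : 0 <= M by exact: le_trans M1.
apply: root12_le; [exact: addr_ge0 rho12_ge0 (ltW e12)|exact: mulr_ge0|].
have b1 := evn 2 (smooth_bound (smooth_q1 d) tab).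
have b2 := evn 2 (smooth_bound (smooth_q2 d) tab).
have b3 := evn 3 (smooth_bound (smooth_p1 d) tab).
have b4 := evn 3 (smooth_bound (smooth_p2 d) tab).
have m1 : M ^+ 4 <= M ^+ 12 by rewrite ler_weXn2l.
have m2 : M ^+ 6 <= M ^+ 12 by rewrite ler_weXn2l.
have m3 : 1 <= M ^+ 12 by rewrite exprn_ege1.
have m4 : e ^+ 12 <= 1 by rewrite exprn_ile1// ltW.
have -> : (5 * M) ^+ 12 = 5 ^+ 12 * M ^+ 12 by rewrite exprMn.
have m5 : 5 * M ^+ 12 <= 5 ^+ 12 * M ^+ 12.
  by rewrite ler_wpM2r ?exprn_ge0// -{1}[5]expr1 ler_weXn2l// ler1n.
apply: le_trans m5; rewrite /rho12; move: b1 b2 b3 b4 => /=; lra.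
Qed.

Let r0 := ltW rho_gt0.

Lemma D1'_le X Y : `|q1' d t| <= X -> `|q2' d t| <= X -> `|p1' d t| <= Y ->
  `|p2' d t| <= Y -> `|D1' d t| <= 108 * rho ^+ 3 * X + 48 * rho ^+ 4 * Y.
Proof.
move=> a1 a2 a3 a4; rewrite /D1' /disc1'.
have b1 := q1_le; have b2 := q2_le; have b3 := p1_le; have b4 := p2_le.
have c1 : `|q1 d t * q1' d t| <= rho ^+ 3 * X by rewrite normrM ler_pM.
have c2 : `|q2 d t * q2' d t| <= rho ^+ 3 * X by rewrite normrM ler_pM.
have pp u v w : `|u| <= rho ^+ 2 -> `|v| <= rho ^+ 2 -> `|w| <= Y ->
    `|u * v * w| <= rho ^+ 4 * Y.
  move=> hu hv hw; rewrite !normrM ler_pM ?mulr_ge0//.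
  by rewrite (_ : 4 = 2 + 2)%N// exprD ler_pM.
have c3 := pp _ _ _ b3 b3 a3; have c4 := pp _ _ _ b4 b4 a3.
have c5 := pp _ _ _ b3 b4 a4.
move: c1 c2 c3 c4 c5; rewrite !ler_norml => *; apply/andP; split; lra.
Qed.

Lemma D2'_le X Y : `|q1' d t| <= X -> `|q2' d t| <= X -> `|p1' d t| <= Y ->
  `|p2' d t| <= Y -> `|D2' d t| <= 108 * rho ^+ 3 * X + 48 * rho ^+ 4 * Y.
Proof.
move=> a1 a2 a3 a4; rewrite /D2' /disc2'.
have b1 := q1_le; have b2 := q2_le; have b3 := p1_le; have b4 := p2_le.
have c1 : `|q1 d t * q2' d t| <= rho ^+ 3 * X by rewrite normrM ler_pM.
have c2 : `|q2 d t * q1' d t| <= rho ^+ 3 * X by rewrite normrM ler_pM.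
have pp u v w : `|u| <= rho ^+ 2 -> `|v| <= rho ^+ 2 -> `|w| <= Y ->
    `|u * v * w| <= rho ^+ 4 * Y.
  move=> hu hv hw; rewrite !normrM ler_pM ?mulr_ge0//.
  by rewrite (_ : 4 = 2 + 2)%N// exprD ler_pM.
have c3 := pp _ _ _ b3 b3 a4; have c4 := pp _ _ _ b4 b4 a4.
have c5 := pp _ _ _ b3 b4 a3.
move: c1 c2 c3 c4 c5; rewrite !ler_norml => *; apply/andP; split; lra.
Qed.

Lemma D1_le : `|D1 d t| <= 2 ^+ 7 * rho ^+ 6.
Proof.
rewrite /D1 /disc1.
have b1 := q1_le; have b2 := q2_le; have b3 := p1_le; have b4 := p2_le.
have qq u v : `|u| <= rho ^+ 3 -> `|v| <= rho ^+ 3 -> `|u * v| <= rho ^+ 6.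
  by move=> hu hv; rewrite normrM (_ : 6 = 3 + 3)%N// exprD ler_pM.
have pp u v w : `|u| <= rho ^+ 2 -> `|v| <= rho ^+ 2 -> `|w| <= rho ^+ 2 ->
    `|u * v * w| <= rho ^+ 6.
  move=> hu hv hw; rewrite !normrM (_ : 6 = 2 + 2 + 2)%N// !exprD.
  by rewrite !ler_pM ?mulr_ge0.
have := qq _ _ b1 b1; have := qq _ _ b2 b2.
have := pp _ _ _ b3 b3 b3; have := pp _ _ _ b3 b4 b4.
rewrite !ler_norml => *; apply/andP; split; lra.
Qed.

Lemma D2_le : `|D2 d t| <= 2 ^+ 7 * rho ^+ 6.
Proof.
rewrite /D2 /disc2.
have b1 := q1_le; have b2 := q2_le; have b3 := p1_le; have b4 := p2_le.
have qq u v : `|u| <= rho ^+ 3 -> `|v| <= rho ^+ 3 -> `|u * v| <= rho ^+ 6.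
  by move=> hu hv; rewrite normrM (_ : 6 = 3 + 3)%N// exprD ler_pM.
have pp u v w : `|u| <= rho ^+ 2 -> `|v| <= rho ^+ 2 -> `|w| <= rho ^+ 2 ->
    `|u * v * w| <= rho ^+ 6.
  move=> hu hv hw; rewrite !normrM (_ : 6 = 2 + 2 + 2)%N// !exprD.
  by rewrite !ler_pM ?mulr_ge0.
have := qq _ _ b1 b2.
have := pp _ _ _ b3 b3 b4; have := pp _ _ _ b4 b4 b4.
rewrite !ler_norml => *; apply/andP; split; lra.
Qed.

Lemma discr6_le : discr6 <= 4 * rho.
Proof.
apply: root12_le; [|exact: mulr_ge0|].
  by rewrite !addr_ge0 ?sqr_ge0// ltW.
have sq (x : R) : `|x| <= 2 ^+ 7 * rho ^+ 6 -> x ^+ 2 <= 2 ^+ 14 * rho ^+ 12.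
  move=> xr; rewrite -[x ^+ 2]ger0_norm ?sqr_ge0// normrX.
  have -> : 2 ^+ 14 * rho ^+ 12 = (2 ^+ 7 * rho ^+ 6) ^+ 2 by ring.
  exact: expr_mono.
have h1 := sq _ D1_le; have h2 := sq _ D2_le.
have h3 : e ^+ 12 <= rho ^+ 12 by rewrite rhoX lerDr rho12_ge0.
have -> : (4 * rho) ^+ 12 = 2 ^+ 24 * rho ^+ 12 by ring.
have h4 := exprn_ge0 12 r0; lra.
Qed.

Lemma discr6_ge_D1 : root12 (D1 d t ^+ 2 + e ^+ 12) <= discr6.
Proof.
apply: root12_ge; [by rewrite !addr_ge0 ?sqr_ge0// ltW|exact: root12_ge0|].
rewrite root12K; last by rewrite addr_ge0 ?sqr_ge0// ltW.
by have := sqr_ge0 (D2 d t); lra.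
Qed.

Lemma discr6_ge_D2 : root12 (D2 d t ^+ 2 + e ^+ 12) <= discr6.
Proof.
apply: root12_ge; [by rewrite !addr_ge0 ?sqr_ge0// ltW|exact: root12_ge0|].
rewrite root12K; last by rewrite addr_ge0 ?sqr_ge0// ltW.
by have := sqr_ge0 (D1 d t); lra.
Qed.

Lemma discr_wdens : (`|D1' d t| + `|D2' d t|) / discr6 ^+ 5 <=
  wdens e (D1 d) (D1' d) t + wdens e (D2 d) (D2' d) t.
Proof.
have V0 := discr6_gt0.
have pos (x : R) : 0 < root12 (x ^+ 2 + e ^+ 12).
  by rewrite root12_gt0// ltr_wpDl// sqr_ge0.
rewrite mulrDl; apply: lerD; rewrite /wdens; apply: ler_wpM2l => //.
- rewrite lef_pV2 ?posrE ?exprn_gt0//; apply: expr_mono (discr6_ge_D1).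
  exact: root12_ge0.
- rewrite lef_pV2 ?posrE ?exprn_gt0//; apply: expr_mono (discr6_ge_D2).
  exact: root12_ge0.
Qed.

Lemma adens_bounds : [/\ 1 <= adens,
  wdens e (q1 d) (q1' d) t <= adens /\ wdens e (q2 d) (q2' d) t <= adens,
  wdens e (p1 d) (p1' d) t <= adens /\ wdens e (p2 d) (p2' d) t <= adens &
  wdens e (D1 d) (D1' d) t + wdens e (D2 d) (D2' d) t <= adens].
Proof.
have key (w1 w2 w3 w4 w5 w6 : R) : 0 <= w1 -> 0 <= w2 -> 0 <= w3 -> 0 <= w4 ->
    0 <= w5 -> 0 <= w6 -> [/\ 1 <= 1 + w1 + w2 + w3 + w4 + w5 + w6,
    w1 <= 1 + w1 + w2 + w3 + w4 + w5 + w6 /\ w2 <= 1 + w1 + w2 + w3 + w4 + w5 + w6,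
    w3 <= 1 + w1 + w2 + w3 + w4 + w5 + w6 /\ w4 <= 1 + w1 + w2 + w3 + w4 + w5 + w6 &
    w5 + w6 <= 1 + w1 + w2 + w3 + w4 + w5 + w6].
  by move=> *; do !split; lra.
by apply: key; exact: wdens_ge0.
Qed.

End cubic_scale.

(** * The dyadic estimate *)

(** On an interval that is longer than the scale s of the roots, Landau's inequality
    gives q' and p' the size s^2 and s that scaling predicts. *)
Lemma leaf_long (R : realType) (a b M : R) (d : cubic_data a b M) (e : R)
    (S A : R -> R) (x y s : R) :
  1 <= M -> 0 < e -> e <= 1 ->
  (forall t, a < t < b -> is_derive t 1 S (hdens d e t `^ (6 / 5))) ->
  (forall t, a < t < b -> is_derive t 1 A (adens d e t)) ->
  a < x -> x <= y -> y < b -> 0 < s ->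
  (forall r, x <= r <= y -> rho d e r <= s /\ s <= 2 * rho d e r) ->
  s <= y - x ->
  forall c, c = 2 ^+ 13 * M ^+ 2 ->
  S y - S x <= 2 ^+ 12 * ((4 * c) ^+ 2 + (4 * c) ^+ 2 + 2 ^+ 4 * c) * (A y - A x).
Proof.
move=> M1 e0 e1 dS dA ax xy yb s0 Hr sl c cE.
have M0 : 0 <= M by exact: le_trans M1.
have MM : M <= M ^+ 2 by rewrite expr2 ler_peMl.
have MM1 : 1 <= M ^+ 2 by exact: le_trans M1 MM.
have c1 : 1 <= c by rewrite cE; lra.
have c0 : 0 <= c by lra.
set C := _ * (_ + _).
have dCA t : a < t < b -> is_derive t 1 (fun t => C * A t) (C * adens d e t).
  by move=> tab; have ? := dA t tab; apply: is_derive_eq; rewrite /GRing.scale/=; ring.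
rewrite mulrBr; apply: (derive_le dS dCA) => // t /andP[xt ty].
have txy : x <= t <= y by rewrite !ltW.
have tab : a < t < b by lra.
have [rs sr] := Hr t txy.
have rp := rho_gt0 d t e0.
have sM : s <= 10 * M by have := rho_le d M1 e0 e1 tab; lra.
have l0 : 0 < s / 2 by lra.
have lan g g' B K : smooth a b M g g' -> (forall r, x <= r <= y -> `|g r| <= B) ->
    8 * B / (s / 2) + 5 * M * (s / 2) ^+ 2 <= K -> `|g' t| <= K.
  move=> [dg Cg _] gB; apply: le_trans.
  apply: (landau3 dg _ l0 ax yb _ gB txy); last lra.
  by apply: Ckb_pred; apply: Ckb_pred; apply: Ckb_pred.
have sq r : x <= r <= y -> rho d e r ^+ 3 <= s ^+ 3.
  by move=> /Hr[H _]; apply: expr_mono H; exact: ltW (rho_gt0 d r e0).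
have sp r : x <= r <= y -> rho d e r ^+ 2 <= s ^+ 2.
  by move=> /Hr[H _]; apply: expr_mono H; exact: ltW (rho_gt0 d r e0).
have Xq : 8 * s ^+ 3 / (s / 2) + 5 * M * (s / 2) ^+ 2 <= 18 * M * s ^+ 2.
  have -> : 8 * s ^+ 3 / (s / 2) + 5 * M * (s / 2) ^+ 2 = 16 * s ^+ 2 + 5 / 4 * M * s ^+ 2.
    by field; rewrite gt_eqF.
  have : 0 <= (M - 1) * s ^+ 2 by rewrite mulr_ge0 ?subr_ge0// sqr_ge0.
  have := sqr_ge0 s; have : 0 <= M * s ^+ 2 by rewrite mulr_ge0// sqr_ge0.
  lra.
have Yp : 8 * s ^+ 2 / (s / 2) + 5 * M * (s / 2) ^+ 2 <= 29 * M ^+ 2 * s.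
  have -> : 8 * s ^+ 2 / (s / 2) + 5 * M * (s / 2) ^+ 2 = (16 + 5 / 4 * M * s) * s.
    by field; rewrite gt_eqF.
  apply: ler_wpM2r; first exact: ltW.
  have : M * s <= M * (10 * M) by rewrite ler_wpM2l.
  by rewrite -/(M ^+ 2) => H; lra.
have Q1 := lan _ _ _ _ (smooth_q1 d) (fun r H => le_trans (q1_le d r e0) (sq r H)) Xq.
have Q2 := lan _ _ _ _ (smooth_q2 d) (fun r H => le_trans (q2_le d r e0) (sq r H)) Xq.
have P1 := lan _ _ _ _ (smooth_p1 d) (fun r H => le_trans (p1_le d r e0) (sp r H)) Yp.
have P2 := lan _ _ _ _ (smooth_p2 d) (fun r H => le_trans (p2_le d r e0) (sp r H)) Yp.
have E1 := D1'_le e0 Q1 Q2 P1 P2.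
have E2 := D2'_le e0 Q1 Q2 P1 P2.
have s2 := sqr_ge0 s.
have Ms2 : M * s ^+ 2 <= M ^+ 2 * s ^+ 2 by rewrite ler_wpM2r.
have M20 := sqr_ge0 M.
have M2s : 0 <= M ^+ 2 * s by rewrite mulr_ge0// ltW.
have M2s2 : 0 <= M ^+ 2 * s ^+ 2 by rewrite mulr_ge0.
have EE : 108 * rho d e t ^+ 3 * (18 * M * s ^+ 2) + 48 * rho d e t ^+ 4 * (29 * M ^+ 2 * s)
   <= 2 ^+ 12 * M ^+ 2 * s ^+ 5.
  have r3 : rho d e t ^+ 3 * (M * s ^+ 2) <= s ^+ 3 * (M ^+ 2 * s ^+ 2).
    apply: ler_pM => //; [by rewrite exprn_ge0// ltW|exact: mulr_ge0|exact: sq].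
  have r4 : rho d e t ^+ 4 * (M ^+ 2 * s) <= s ^+ 4 * (M ^+ 2 * s).
    by apply: ler_wpM2r => //; apply: expr_mono => //; exact: ltW.
  have Ms5 : 0 <= M ^+ 2 * s ^+ 5 by rewrite mulr_ge0// exprn_ge0// ltW.
  clear - r3 r4 Ms5; lra.
apply: (le_trans (leaf_large c1 rp rs sr (discr6_gt0 d t e0) (discr6_le d t e0) _ _ _ _ _ _)).
- by rewrite addr_ge0.
- by rewrite addr_ge0.
- by rewrite addr_ge0.
- by rewrite cE; clear - Q1 Q2 Ms2 M2s2; lra.
- by rewrite cE; clear - P1 P2 M2s; lra.
- by rewrite cE; clear - E1 E2 EE; lra.
have W := discr_wdens d t e0.
have [a1 _ _ a2] := adens_bounds d e t.
have {}a2 := le_trans W a2.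
have k2 : 0 <= 2 ^+ 4 * c by rewrite mulr_ge0// exprn_ge0.
rewrite /C -[X in _ <= X]mulrA; apply: ler_wpM2l; first exact: exprn_ge0.
rewrite [X in _ <= X]mulrDl; apply: lerD; last by apply: (ler_wpM2l k2).
by apply: ler_peMr => //; rewrite addr_ge0// sqr_ge0.
Qed.

(** On an interval that is shorter than the scale s of the roots, the variations of q
    and p are of order s^3 and s^2, because a window with five critical points
    oscillates much less. *)
Lemma leaf_short (R : realType) (a b M : R) (d : cubic_data a b M) (e : R)
    (S : R -> R) (x y t : R) :
  1 <= M -> 0 < e -> e <= 1 ->
  (forall t, a < t < b -> is_derive t 1 S (hdens d e t `^ (6 / 5))) ->
  a < x -> x <= y -> y < b -> 0 < t ->
  (forall r, x <= r <= y -> rho d e r <= t ^+ 5 /\ t ^+ 5 <= 2 * rho d e r) ->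
  y - x <= t ^+ 5 ->
  forall c T, c = 2 ^+ 13 * M ^+ 2 -> T = 10 * M ->
  S y - S x <= 2 ^+ 12 * (2 ^+ 4 * c) *
   (2 * (20 * M * T ^+ 3 + 22) + 2 * (20 * M * T ^+ 4 + 22) * T + 2 ^+ 17 * M) * t ^+ 3.
Proof.
move=> M1 e0 e1 dS ax xy yb t0 Hr sl c T cE TE.
have M0 : 0 <= M by exact: le_trans M1.
have MM : M <= M ^+ 2 by rewrite expr2 ler_peMl.
have MM1 : 1 <= M ^+ 2 by exact: le_trans M1 MM.
have c1 : 1 <= c by rewrite cE; lra.
have c0 : 0 <= c by lra.
have T1 : 1 <= T by rewrite TE; lra.
have T0 : 0 <= T by exact: le_trans T1.
have t0' := ltW t0.
set s := t ^+ 5 in Hr sl *; have s0 : 0 < s by rewrite exprn_gt0.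
have tT : t <= T.
  rewrite leNgt; apply/negP => Tt.
  have xab : a < x < b by rewrite ax (le_lt_trans xy).
  have [|_ H] := Hr x; first by rewrite lexx xy.
  have := rho_le d M1 e0 e1 xab.
  have : T <= T ^+ 5 by rewrite -{1}[T]expr1 ler_weXn2l.
  have : T ^+ 5 < t ^+ 5 by rewrite ltr_pXn2r// nnegrE.
  rewrite -/s TE; lra.
have [WQ1 dWQ1] := abs_primitive (smooth_q1 d).
have [WQ2 dWQ2] := abs_primitive (smooth_q2 d).
have [WP1 dWP1] := abs_primitive (smooth_p1 d).
have [WP2 dWP2] := abs_primitive (smooth_p2 d).
have [WD1 dWD1] := wdens_primitive e0 (smooth_D1 d).
have [WD2 dWD2] := wdens_primitive e0 (smooth_D2 d).
set K := 2 ^+ 4 * c.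
have K0 : 0 <= K by rewrite /K mulr_ge0// exprn_ge0.
have K12 : 0 <= 2 ^+ 12 * K by rewrite mulr_ge0// exprn_ge0.
pose G r := 2 ^+ 12 * K * ((WQ1 r + WQ2 r) * t ^- 12 + (WP1 r + WP2 r) * t ^- 6 +
  (WD1 r + WD2 r) * t ^- 2).
have dG r : a < r < b -> is_derive r 1 G (2 ^+ 12 * K * (
   (`|q1' d r| + `|q2' d r|) * t ^- 12 + (`|p1' d r| + `|p2' d r|) * t ^- 6 +
   (wdens e (D1 d) (D1' d) r + wdens e (D2 d) (D2' d) r) * t ^- 2)).
  move=> rab.
  have ? := dWQ1 r rab; have ? := dWQ2 r rab; have ? := dWP1 r rab.
  have ? := dWP2 r rab; have ? := dWD1 r rab; have ? := dWD2 r rab.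
  by apply: is_derive_eq; rewrite /GRing.scale/=; ring.
have SG : S y - S x <= G y - G x.
  apply: (derive_le dS dG) => // r /andP[xr ry].
  have rxy : x <= r <= y by rewrite !ltW.
  have rab : a < r < b by lra.
  have [rs sr] := Hr r rxy.
  have rp := rho_gt0 d r e0.
  have Q1 := smooth_bound' (smooth_q1 d) rab; have Q2 := smooth_bound' (smooth_q2 d) rab.
  have P1 := smooth_bound' (smooth_p1 d) rab; have P2 := smooth_bound' (smooth_p2 d) rab.
  have E1 := D1'_le e0 Q1 Q2 P1 P2.
  have E2 := D2'_le e0 Q1 Q2 P1 P2.
  have rM := rho_le d M1 e0 e1 rab.
  have r30 : 0 <= rho d e r ^+ 3 by rewrite exprn_ge0// ltW.
  have EE : 108 * rho d e r ^+ 3 * M + 48 * rho d e r ^+ 4 * M <= 2 ^+ 12 * M ^+ 2 * rho d e r ^+ 3.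
    have r4 : rho d e r ^+ 3 * (rho d e r * M) <= rho d e r ^+ 3 * (5 * M * M).
      by rewrite ler_wpM2l// ler_wpM2r.
    have r3 : rho d e r ^+ 3 * M <= rho d e r ^+ 3 * M ^+ 2 by rewrite ler_wpM2l.
    have r32 : 0 <= rho d e r ^+ 3 * M ^+ 2 by rewrite mulr_ge0// sqr_ge0.
    clear - r3 r4 r32; lra.
  apply: (le_trans (leaf_small c1 rp rs sr (discr6_gt0 d r e0) (discr6_le d r e0)
    _ _ _ t0 (erefl _) _ _ _)).
  - by rewrite addr_ge0.
  - by rewrite addr_ge0.
  - by rewrite addr_ge0.
  - by rewrite cE; clear - Q1 Q2 M0 MM; lra.
  - by rewrite cE; clear - P1 P2 M0 MM; lra.
  - by rewrite cE; clear - E1 E2 EE; lra.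
  rewrite -/K -!mulrDr -[X in _ <= X]mulrA.
  apply: ler_wpM2l; first exact: exprn_ge0.
  apply: ler_wpM2l => //; rewrite lerD2l ler_wpM2r ?invr_ge0 ?exprn_ge0//.
  exact: discr_wdens.
apply: (le_trans SG).
have rr r : x <= r <= y -> rho d e r <= s by move=> /Hr[].
have rr0 r : 0 <= rho d e r := ltW (rho_gt0 d r e0).
have T36 : t ^+ 3 <= T ^+ 6.
  apply: (@le_trans _ _ (T ^+ 3)); first exact: expr_mono.
  by rewrite ler_weXn2l.
have T26 : t ^+ 2 <= T ^+ 6.
  apply: (@le_trans _ _ (T ^+ 2)); first exact: expr_mono.
  by rewrite ler_weXn2l.
have M6 : M <= M ^+ 6 by rewrite -{1}[M]expr1 ler_weXn2l.
have tvq g g' W : smooth a b M g g' -> (forall r, a < r < b -> is_derive r 1 W `|g' r|) ->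
    (forall r, x <= r <= y -> `|g r| <= rho d e r ^+ 3) ->
    W y - W x <= (20 * M * T ^+ 3 + 22) * t ^+ 15.
  move=> [dg Cg _] dW gr.
  have c00 : 0 <= 2 * M * t ^+ 12 * T by rewrite !mulr_ge0// exprn_ge0.
  have t15 : 0 <= t ^+ 15 by rewrite exprn_ge0.
  have H : 32 * (t ^+ 15) ^+ 5 * M <= (2 * M * t ^+ 12 * T) ^+ 6.
    have -> : 32 * (t ^+ 15) ^+ 5 * M = 32 * t ^+ 72 * (M * t ^+ 3) by ring.
    have -> : (2 * M * t ^+ 12 * T) ^+ 6 = 64 * t ^+ 72 * (M ^+ 6 * T ^+ 6) by ring.
    have h1 : M * t ^+ 3 <= M ^+ 6 * T ^+ 6 by rewrite ler_pM// exprn_ge0.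
    apply: ler_pM => //.
    - by rewrite mulr_ge0// exprn_ge0.
    - by rewrite mulr_ge0// exprn_ge0.
    - by have := exprn_ge0 72 t0'; clear => *; lra.
  have := tv_id dg Cg M0 t15 c00 H dW ax xy yb.
  have gB r : x <= r <= y -> `|g r| <= t ^+ 15.
    move=> rxy; apply: (le_trans (gr r rxy)).
    by rewrite (_ : 15 = 5 * 3)%N// exprM; apply: expr_mono => //; exact: rr.
  move=> /(_ gB) /le_trans; apply.
  have h2 : M * t ^+ 12 * T * (y - x) <= M * t ^+ 12 * T * t ^+ 5.
    by rewrite ler_wpM2l// !mulr_ge0// exprn_ge0.
  have h3 : M * T * t ^+ 15 * t ^+ 2 <= M * T * t ^+ 15 * T ^+ 2.
    by rewrite ler_wpM2l ?mulr_ge0//; exact: expr_mono.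
  clear - h2 h3; lra.
have tvp g g' W : smooth a b M g g' -> (forall r, a < r < b -> is_derive r 1 W `|g' r|) ->
    (forall r, x <= r <= y -> `|g r| <= rho d e r ^+ 2) ->
    W y - W x <= (20 * M * T ^+ 4 + 22) * t ^+ 10.
  move=> [dg Cg _] dW gr.
  have c00 : 0 <= 2 * M * t ^+ 8 * T by rewrite !mulr_ge0// exprn_ge0.
  have t10 : 0 <= t ^+ 10 by rewrite exprn_ge0.
  have H : 32 * (t ^+ 10) ^+ 5 * M <= (2 * M * t ^+ 8 * T) ^+ 6.
    have -> : 32 * (t ^+ 10) ^+ 5 * M = 32 * t ^+ 48 * (M * t ^+ 2) by ring.
    have -> : (2 * M * t ^+ 8 * T) ^+ 6 = 64 * t ^+ 48 * (M ^+ 6 * T ^+ 6) by ring.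
    have h1 : M * t ^+ 2 <= M ^+ 6 * T ^+ 6 by rewrite ler_pM// exprn_ge0.
    apply: ler_pM => //.
    - by rewrite mulr_ge0// exprn_ge0.
    - by rewrite mulr_ge0// exprn_ge0.
    - by have := exprn_ge0 48 t0'; clear => *; lra.
  have := tv_id dg Cg M0 t10 c00 H dW ax xy yb.
  have gB r : x <= r <= y -> `|g r| <= t ^+ 10.
    move=> rxy; apply: (le_trans (gr r rxy)).
    by rewrite (_ : 10 = 5 * 2)%N// exprM; apply: expr_mono => //; exact: rr.
  move=> /(_ gB) /le_trans; apply.
  have h2 : M * t ^+ 8 * T * (y - x) <= M * t ^+ 8 * T * t ^+ 5.
    by rewrite ler_wpM2l// !mulr_ge0// exprn_ge0.
  have h3 : M * T * t ^+ 10 * t ^+ 3 <= M * T * t ^+ 10 * T ^+ 3.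
    by rewrite ler_wpM2l ?mulr_ge0//; exact: expr_mono.
  clear - h2 h3; lra.
have tvD g g' W : smooth a b M g g' ->
    (forall r, a < r < b -> is_derive r 1 W (wdens e g g' r)) ->
    (forall r, x <= r <= y -> `|g r| <= 2 ^+ 7 * rho d e r ^+ 6) ->
    W y - W x <= 2 ^+ 16 * M * t ^+ 5.
  move=> sg dW gr.
  have s40 : 0 <= 4 * s by rewrite mulr_ge0// ltW.
  have gB r : x <= r <= y -> `|g r| <= (4 * s) ^+ 6.
    move=> rxy; apply: (le_trans (gr r rxy)).
    have -> : (4 * s) ^+ 6 = 2 ^+ 12 * s ^+ 6 by ring.
    apply: ler_pM; [exact: exprn_ge0|by rewrite exprn_ge0|by rewrite ler_weXn2l// ler1n|].
    by apply: expr_mono => //; exact: rr.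
  apply: (le_trans (tv_wdens M1 e0 s40 sg dW ax xy yb gB)).
  have h1 : M * (y - x + 4 * s) <= M * (5 * t ^+ 5).
    by rewrite ler_wpM2l//; rewrite -/s; lra.
  have h2 : 0 <= M * t ^+ 5 by rewrite mulr_ge0// exprn_ge0.
  clear - h1 h2; lra.
have B1 := tvq _ _ _ (smooth_q1 d) dWQ1 (fun r _ => q1_le d r e0).
have B2 := tvq _ _ _ (smooth_q2 d) dWQ2 (fun r _ => q2_le d r e0).
have B3 := tvp _ _ _ (smooth_p1 d) dWP1 (fun r _ => p1_le d r e0).
have B4 := tvp _ _ _ (smooth_p2 d) dWP2 (fun r _ => p2_le d r e0).
have B5 := tvD _ _ _ (smooth_D1 d) dWD1 (fun r _ => D1_le d r e0).
have B6 := tvD _ _ _ (smooth_D2 d) dWD2 (fun r _ => D2_le d r e0).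
rewrite /G -mulrBr -[X in _ <= X]mulrA; apply: ler_wpM2l => //.
have div (B C : R) n m : B <= C * t ^+ (n + m)%N -> B * t ^- m <= C * t ^+ n.
  move=> BC; rewrite ler_pdivrMr ?exprn_gt0// -mulrA -exprD//.
have C1 : (WQ1 y - WQ1 x + (WQ2 y - WQ2 x)) * t ^- 12 <= 2 * (20 * M * T ^+ 3 + 22) * t ^+ 3.
  by apply: div; rewrite /=; clear - B1 B2; lra.
have C2 : (WP1 y - WP1 x + (WP2 y - WP2 x)) * t ^- 6 <= 2 * (20 * M * T ^+ 4 + 22) * t ^+ 4.
  by apply: div; rewrite /=; clear - B3 B4; lra.
have C3 : (WD1 y - WD1 x + (WD2 y - WD2 x)) * t ^- 2 <= 2 ^+ 17 * M * t ^+ 3.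
  by apply: div; rewrite /=; clear - B5 B6; lra.
have C4 : 2 * (20 * M * T ^+ 4 + 22) * t ^+ 4 <= 2 * (20 * M * T ^+ 4 + 22) * T * t ^+ 3.
  have -> : t ^+ 4 = t * t ^+ 3 by rewrite exprS.
  rewrite [X in X <= _]mulrA; apply: ler_wpM2r; first exact: exprn_ge0.
  apply: ler_wpM2l => //.
  by rewrite mulr_ge0// addr_ge0// !mulr_ge0// exprn_ge0.
move: C1 C2 C3 C4; clear.
move: (t ^- 12) (t ^- 6) (t ^- 2) (t ^+ 3) (t ^+ 4) => u1 u2 u3 v3 v4; lra.
Qed.

Lemma diff_X4 (R : realType) (B u v : R) : `|u| <= B -> `|v| <= B ->
  u ^+ 4 - v ^+ 4 <= 4 * B ^+ 3 * `|u - v|.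
Proof.
move=> uB vB; have B0 : 0 <= B by exact: le_trans uB.
apply: (le_trans (ler_norm _)).
have -> : u ^+ 4 - v ^+ 4 = (u ^+ 2 * u + u ^+ 2 * v + v ^+ 2 * u + v ^+ 2 * v) * (u - v) by ring.
rewrite normrM; apply: ler_wpM2r => //.
have H p r : `|p| <= B -> `|r| <= B -> `|p ^+ 2 * r| <= B ^+ 3.
  move=> pB rB; rewrite normrM normrX (_ : B ^+ 3 = B ^+ 2 * B); last by rewrite exprSr.
  by rewrite ler_pM// ?exprn_ge0//; exact: expr_mono.
apply: (le_trans (ler_normD _ _)); apply: (@le_trans _ _ (3 * B ^+ 3 + B ^+ 3)); last lra.
apply: lerD; last exact: H.
apply: (le_trans (ler_normD _ _)); apply: (@le_trans _ _ (2 * B ^+ 3 + B ^+ 3)); last lra.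
apply: lerD; last exact: H.
apply: (le_trans (ler_normD _ _)); apply: (@le_trans _ _ (B ^+ 3 + B ^+ 3)); last lra.
by apply: lerD; exact: H.
Qed.

Lemma diff_X6 (R : realType) (B u v : R) : `|u| <= B -> `|v| <= B ->
  u ^+ 6 - v ^+ 6 <= 6 * B ^+ 5 * `|u - v|.
Proof.
move=> uB vB; have B0 : 0 <= B by exact: le_trans uB.
have uB3 : `|u ^+ 3| <= B ^+ 3 by rewrite normrX; exact: expr_mono.
have vB3 : `|v ^+ 3| <= B ^+ 3 by rewrite normrX; exact: expr_mono.
apply: (le_trans (ler_norm _)).
have -> : u ^+ 6 - v ^+ 6 = ((u ^+ 3 + v ^+ 3) * (u ^+ 2 + u * v + v ^+ 2)) * (u - v) by ring.
rewrite normrM; apply: ler_wpM2r => //.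
have -> : 6 * B ^+ 5 = (B ^+ 3 + B ^+ 3) * (B ^+ 2 + B ^+ 2 + B ^+ 2) by ring.
rewrite normrM ler_pM//.
  by rewrite (le_trans (ler_normD _ _))// lerD.
apply: (le_trans (ler_normD _ _)); apply: lerD; last by rewrite normrX; exact: expr_mono.
apply: (le_trans (ler_normD _ _)); apply: lerD; first by rewrite normrX; exact: expr_mono.
by rewrite normrM expr2 ler_pM.
Qed.

Section bad_interval.
Context (R : realType) (a b M : R) (d : cubic_data a b M) (e : R) (A : R -> R) (x y s : R).
Hypotheses (M1 : 1 <= M) (e0 : 0 < e) (e1 : e <= 1)
  (dA : forall t, a < t < b -> is_derive t 1 A (adens d e t))
  (ax : a < x) (xy : x <= y) (yb : y < b) (s0 : 0 < s)
  (rs : forall r, x <= r <= y -> rho d e r <= s) (sM : s <= 5 * M).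

Let M0 : 0 <= M. Proof. exact: le_trans M1. Qed.

Lemma adens_mono u v : x <= u -> u <= v -> v <= y -> A u <= A v.
Proof.
move=> xu uv vy.
have d0 t : a < t < b -> is_derive t 1 (fun=> 0 : R) 0 by move=> _; exact: is_derive_cst.
have := derive_le d0 dA (lt_le_trans ax xu) uv (le_lt_trans vy yb).
rewrite subrr subr_ge0; apply=> t _.
by have [/(le_trans ler01) ->] := adens_bounds d e t.
Qed.

Let vary (g g' : R -> R) (K : R) u v : 0 <= K -> smooth a b M g g' ->
  (forall t, x <= t <= y -> `|g' t| <= K * adens d e t) ->
  x <= u <= y -> x <= v <= y -> `|g u - g v| <= K * (A y - A x).
Proof.
move=> K0 [dg _ _] gK; wlog uv : u v / u <= v => [H uxy vxy|].
  by have [uv|/ltW vu] := leP u v; [exact: H|rewrite distrC; exact: H].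
move=> /andP[xu uy] /andP[xv vy].
have dKA t : a < t < b -> is_derive t 1 (fun t => K * A t) (K * adens d e t).
  by move=> tab; have ? := dA tab; apply: is_derive_eq; rewrite /GRing.scale/=; ring.
have dNg t : a < t < b -> is_derive t 1 (fun t => - g t) (- g' t).
  by move=> tab; have ? := dg t tab; exact: is_deriveN.
have au := lt_le_trans ax xu; have vb := le_lt_trans vy yb.
have H1 : g v - g u <= K * A v - K * A u.
  apply: (derive_le dg dKA au uv vb) => t /andP[ut tv].
  by apply: (le_trans (ler_norm _)); apply: gK; lra.
have H2 : - g v - - g u <= K * A v - K * A u.
  apply: (derive_le dNg dKA au uv vb) => t /andP[ut tv].
  by apply: (le_trans (ler_norm _)); rewrite normrN; apply: gK; lra.
have H3 : K * (A v - A u) <= K * (A y - A x).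
  apply: ler_wpM2l => //.
  have := adens_mono (lexx x) xu uy; have := adens_mono xv vy (lexx y); lra.
by rewrite ler_norml; apply/andP; split; lra.
Qed.

Let wbound (g g' : R -> R) (m : R) n r : `|g r| <= s ^+ n ->
  m = root12 (s ^+ (n.*2) * (6 * M) ^+ 12) -> (n.*2 <= 12)%N ->
  wdens e g g' r <= adens d e r -> rho d e r <= s -> e <= rho d e r ->
  `|g' r| <= m ^+ 5 * adens d e r.
Proof.
move=> gs -> n12 wA rs' er.
have sp : 0 < g r ^+ 2 + e ^+ 12 by rewrite ltr_wpDl ?sqr_ge0// exprn_gt0.
have rp := root12_gt0 sp.
have Ag : 0 <= adens d e r by exact: le_trans (wdens_ge0 _ _ _ _) wA.
have -> : `|g' r| = root12 (g r ^+ 2 + e ^+ 12) ^+ 5 * wdens e g g' r.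
  by rewrite /wdens mulrC divfK// gt_eqF// exprn_gt0.
have S0 : 0 <= s ^+ n.*2 * (6 * M) ^+ 12 by rewrite mulr_ge0 ?exprn_ge0 ?mulr_ge0// ltW.
apply: ler_pM => //; [by rewrite exprn_ge0// ltW|exact: wdens_ge0|].
apply: expr_mono; first exact: ltW.
apply: root12_le; [exact: ltW|exact: root12_ge0|].
rewrite root12K//.
have g2 : g r ^+ 2 <= s ^+ n.*2.
  rewrite -[g r ^+ 2]ger0_norm ?sqr_ge0// normrX -muln2 exprM.
  exact: expr_mono.
have e2 : e ^+ 12 <= s ^+ n.*2 * (5 * M) ^+ 12.
  apply: (@le_trans _ _ (s ^+ 12)).
    by apply: expr_mono; [exact: ltW|exact: le_trans rs'].
  rewrite -{1}(subnKC n12) exprD ler_wpM2l ?exprn_ge0 ?(ltW s0)//.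
  apply: (@le_trans _ _ ((5 * M) ^+ (12 - n.*2))).
    by apply: expr_mono => //; exact: ltW.
  by rewrite ler_weXn2l ?leq_subr//; move: M1; lra.
have h : 1 + (5 * M) ^+ 12 <= (6 * M) ^+ 12.
  have -> : 6 * M = 5 * M + M by ring.
  rewrite (exprS _ 11) mulrDl -exprS addrC.
  have h1 : (5 * M) ^+ 11 <= (5 * M + M) ^+ 11.
    by apply: expr_mono; [exact: mulr_ge0|move: M0; lra].
  have h2 : 1 <= M * (5 * M + M) ^+ 11.
    rewrite -[1]mulr1 ler_pM// exprn_ege1//; move: M1; lra.
  have := ler_wpM2l (mulr_ge0 (ler0n R 5) M0) h1; rewrite -exprS; lra.
have := ler_wpM2l (exprn_ge0 n.*2 (ltW s0)) h; rewrite mulrDr mulr1; lra.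
Qed.

(** If the scale of the roots changes by a factor 2 on an interval, one of the
    components of p, q varies by a fixed fraction of its size.  This bounds below
    both the length and the variation of the sixth roots, in terms of s = t^5; the
    power th = (y - x)^(1/30) of the length is gained for the sum over all dyadic
    scales. *)
Lemma bad_interval (x0 y0 t th : R) :
  x <= x0 <= y -> x <= y0 <= y -> rho d e x0 = s -> 2 * rho d e y0 < s ->
  0 < t -> t ^+ 5 = s -> 0 <= th -> th ^+ 30 = y - x ->
  t ^+ 3 <= 2 ^+ 6 * (6 * M) ^+ 6 * (2 ^+ 8 * M ^+ 2) * th * (A y - A x).
Proof.
move=> x0J y0J rx0 ry0 t0 ts th0 thE.
have ax' := ax; have yb' := yb; have xy' := xy; have sM' := sM; have M1' := M1.
have r0 r : 0 <= rho d e r := ltW (rho_gt0 d r e0).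
have er r : e <= rho d e r.
  by apply: root12_ge; [rewrite addr_ge0 ?rho12_ge0 ?exprn_ge0// ltW|exact: ltW|
    rewrite lerDr rho12_ge0].
have half : rho d e y0 ^+ 12 <= s ^+ 12 / 2.
  have : rho d e y0 ^+ 12 <= (s / 2) ^+ 12 by apply: expr_mono => //; lra.
  have -> : (s / 2) ^+ 12 = 2 ^- 11 * (s ^+ 12 / 2) by field.
  move=> /le_trans; apply; rewrite ler_piMl//.
    by rewrite mulr_ge0// exprn_ge0// ltW.
  by rewrite invf_le1 ?exprn_gt0// exprn_ege1// ler1n.
have Nd : s ^+ 12 / 2 <= rho12 d x0 - rho12 d y0.
  have := rhoX d x0 e0; have := rhoX d y0 e0; rewrite rx0; lra.
have dA0 : 0 <= A y - A x by rewrite subr_ge0; apply: adens_mono.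
set Z := 2 ^+ 6 * (6 * M) ^+ 6.
have M6 : 1 <= 6 * M by move: M1; lra.
have M60 : 0 <= 6 * M by exact: le_trans M6.
have yx0 : 0 <= y - x by rewrite subr_ge0.
have MM : M <= M ^+ 2 by rewrite expr2 ler_peMl.
have B80 : 0 <= 2 ^+ 8 * M ^+ 2 by rewrite mulr_ge0// exprn_ge0.
have B81 : 1 <= 2 ^+ 8 * M ^+ 2 by move: M1 MM; lra.
have s0' := ltW s0.
suff [G1 G2] : s ^+ 6 <= (Z * (A y - A x)) ^+ 12 /\ s ^+ 3 <= 2 ^+ 8 * M ^+ 2 * (y - x).
  have Z0 : 0 <= Z * (A y - A x) by rewrite mulr_ge0// mulr_ge0// exprn_ge0.
  rewrite -(@ler_pXn2r _ 60)// ?nnegrE ?exprn_ge0 ?(ltW t0)//; last first.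
    by rewrite !mulr_ge0// exprn_ge0.
  have -> : (t ^+ 3) ^+ 60 = (s ^+ 6) ^+ 5 * (s ^+ 3) ^+ 2 by rewrite -ts; ring.
  have -> : (Z * (2 ^+ 8 * M ^+ 2) * th * (A y - A x)) ^+ 60 =
     ((Z * (A y - A x)) ^+ 12) ^+ 5 * ((2 ^+ 8 * M ^+ 2) ^+ 60 * (th ^+ 30) ^+ 2).
    by move: (A y - A x) (2 ^+ 8 * M ^+ 2) => u w; clear; move: Z => v; ring.
  rewrite thE; apply: ler_pM; rewrite ?exprn_ge0//.
    by apply: expr_mono => //; rewrite exprn_ge0.
  apply: (le_trans (expr_mono 2 (exprn_ge0 3 s0') G2)).
  rewrite exprMn; apply: ler_wpM2r; first exact: sqr_ge0.
  by rewrite ler_weXn2l.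
have lip (g g' : R -> R) u v : smooth a b M g g' -> x <= u <= y -> x <= v <= y ->
    `|g u - g v| <= M * (y - x).
  move=> sg; wlog uv : u v / u <= v => [H uJ vJ|].
    by have [uv|/ltW vu] := leP u v; [exact: H|rewrite distrC; exact: H].
  move: uv; rewrite le_eqVlt => /predU1P[-> _ _|uv uJ vJ].
    by rewrite subrr normr0 mulr_ge0.
  rewrite distrC.
  have [||c cuv ->] := mvt_oo (smooth_derive sg) _ uv; [lra|lra|].
  rewrite normrM ler_pM//; first by apply: (smooth_bound' sg); lra.
  by rewrite gtr0_norm ?subr_gt0//; lra.
have caseq g g' : smooth a b M g g' -> (forall r, x <= r <= y -> `|g r| <= s ^+ 3) ->
    (forall r, wdens e g g' r <= adens d e r) ->
    s ^+ 12 / 8 <= g x0 ^+ 4 - g y0 ^+ 4 ->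
    s ^+ 6 <= (Z * (A y - A x)) ^+ 12 /\ s ^+ 3 <= 2 ^+ 8 * M ^+ 2 * (y - x).
  move=> sg gb gw gd.
  have gD := le_trans gd (diff_X4 (gb _ x0J) (gb _ y0J)).
  have D3 : s ^+ 3 <= 2 ^+ 5 * `|g x0 - g y0|.
    rewrite -(@ler_pM2l _ (s ^+ 9)) ?exprn_gt0//.
    have -> : s ^+ 9 * s ^+ 3 = s ^+ 12 by rewrite -exprD.
    move: gD; rewrite -exprM; lra.
  set m := root12 (s ^+ 6 * (6 * M) ^+ 12).
  have mX : m ^+ 12 = s ^+ 6 * (6 * M) ^+ 12.
    by rewrite root12K// mulr_ge0// exprn_ge0.
  have m0 : 0 <= m by exact: root12_ge0.
  have DA : `|g x0 - g y0| <= m ^+ 5 * (A y - A x).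
    apply: (vary _ sg) => //; first exact: exprn_ge0.
    by move=> r rJ; apply: (@wbound _ _ _ 3); [exact: gb|by []|by []|exact: gw|exact: rs|exact: er].
  split.
    rewrite -(@ler_pM2l _ (s ^+ 30)) ?exprn_gt0//.
    have -> : s ^+ 30 * s ^+ 6 = (s ^+ 3) ^+ 12 by rewrite -exprD -exprM.
    have H : s ^+ 3 <= 2 ^+ 5 * (m ^+ 5 * (A y - A x)).
      by apply: (le_trans D3); apply: ler_wpM2l DA; exact: exprn_ge0.
    apply: (le_trans (expr_mono 12 (exprn_ge0 3 s0') H)).
    have -> : (2 ^+ 5 * (m ^+ 5 * (A y - A x))) ^+ 12 =
       (m ^+ 12) ^+ 5 * ((2 ^+ 5) ^+ 12 * (A y - A x) ^+ 12).
      by move: (A y - A x) (2 ^+ 5 : R) => u v; ring.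
    rewrite mX.
    have -> : (s ^+ 6 * (6 * M) ^+ 12) ^+ 5 = s ^+ 30 * (6 * M) ^+ 60.
      by move: (6 * M) => v; ring.
    rewrite -mulrA; apply: ler_wpM2l; first exact: exprn_ge0.
    have -> : (Z * (A y - A x)) ^+ 12 = (6 * M) ^+ 72 * ((2 ^+ 6) ^+ 12 * (A y - A x) ^+ 12).
      by rewrite /Z; move: (A y - A x) (6 * M) (2 ^+ 6 : R) => u v w; ring.
    apply: ler_pM; [exact: exprn_ge0|by rewrite mulr_ge0 ?exprn_ge0| |].
      by rewrite ler_weXn2l.
    apply: ler_wpM2r; first exact: exprn_ge0.
    by apply: expr_mono; [exact: exprn_ge0|rewrite ler_weXn2l// ler1n].
  have L := lip _ _ _ _ sg x0J y0J.
  have : M * (y - x) <= M ^+ 2 * (y - x) by rewrite ler_wpM2r.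
  have : 0 <= M ^+ 2 * (y - x) by rewrite mulr_ge0// sqr_ge0.
  lra.
have casep g g' : smooth a b M g g' -> (forall r, x <= r <= y -> `|g r| <= s ^+ 2) ->
    (forall r, wdens e g g' r <= adens d e r) ->
    s ^+ 12 / 8 <= g x0 ^+ 6 - g y0 ^+ 6 ->
    s ^+ 6 <= (Z * (A y - A x)) ^+ 12 /\ s ^+ 3 <= 2 ^+ 8 * M ^+ 2 * (y - x).
  move=> sg gb gw gd.
  have gD := le_trans gd (diff_X6 (gb _ x0J) (gb _ y0J)).
  have D3' : s ^+ 2 <= 48 * `|g x0 - g y0|.
    rewrite -(@ler_pM2l _ (s ^+ 10)) ?exprn_gt0//.
    have -> : s ^+ 10 * s ^+ 2 = s ^+ 12 by rewrite -exprD.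
    move: gD; rewrite -exprM; lra.
  have D3 : s ^+ 2 <= 2 ^+ 6 * `|g x0 - g y0|.
    by have := normr_ge0 (g x0 - g y0); lra.
  set m := root12 (s ^+ 4 * (6 * M) ^+ 12).
  have mX : m ^+ 12 = s ^+ 4 * (6 * M) ^+ 12.
    by rewrite root12K// mulr_ge0// exprn_ge0.
  have m0 : 0 <= m by exact: root12_ge0.
  have DA : `|g x0 - g y0| <= m ^+ 5 * (A y - A x).
    apply: (vary _ sg) => //; first exact: exprn_ge0.
    by move=> r rJ; apply: (@wbound _ _ _ 2); [exact: gb|by []|by []|exact: gw|exact: rs|exact: er].
  split.
    rewrite -(@ler_pM2l _ (s ^+ 20)) ?exprn_gt0//.
    have -> : s ^+ 20 * s ^+ 6 = (s ^+ 2) ^+ 12 * s ^+ 2 by rewrite -!exprM -!exprD.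
    have H : s ^+ 2 <= 2 ^+ 6 * (m ^+ 5 * (A y - A x)).
      by apply: (le_trans D3); apply: ler_wpM2l DA; exact: exprn_ge0.
    have H2 : s ^+ 2 <= (6 * M) ^+ 2 by apply: expr_mono => //; move: sM M0; lra.
    apply: (le_trans (ler_pM (exprn_ge0 12 (exprn_ge0 2 s0')) (exprn_ge0 2 s0')
       (expr_mono 12 (exprn_ge0 2 s0') H) H2)).
    have -> : (2 ^+ 6 * (m ^+ 5 * (A y - A x))) ^+ 12 =
       (m ^+ 12) ^+ 5 * ((2 ^+ 6) ^+ 12 * (A y - A x) ^+ 12).
      by move: (A y - A x) (2 ^+ 6 : R) => u v; ring.
    rewrite mX.
    have -> : (s ^+ 4 * (6 * M) ^+ 12) ^+ 5 = s ^+ 20 * (6 * M) ^+ 60.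
      by move: (6 * M) => v; ring.
    rewrite [X in X <= _](_ : _ = s ^+ 20 *
      ((6 * M) ^+ 60 * ((2 ^+ 6) ^+ 12 * ((A y - A x) ^+ 12 * (6 * M) ^+ 2)))); last first.
      by move: (A y - A x) (6 * M) (2 ^+ 6 : R) => u v w; ring.
    apply: (ler_wpM2l (exprn_ge0 20 s0')).
    have -> : (Z * (A y - A x)) ^+ 12 = (6 * M) ^+ 72 * ((2 ^+ 6) ^+ 12 * (A y - A x) ^+ 12).
      by rewrite /Z; move: (A y - A x) (6 * M) (2 ^+ 6 : R) => u v w; ring.
    have -> : (6 * M) ^+ 60 * ((2 ^+ 6) ^+ 12 * ((A y - A x) ^+ 12 * (6 * M) ^+ 2)) =
       (6 * M) ^+ 62 * ((2 ^+ 6) ^+ 12 * (A y - A x) ^+ 12).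
      by move: (A y - A x) (6 * M) (2 ^+ 6 : R) => u v w; ring.
    apply: ler_wpM2r; first by rewrite mulr_ge0 ?exprn_ge0.
    by rewrite ler_weXn2l.
  have L := lip _ _ _ _ sg x0J y0J.
  have h1 : s * s ^+ 2 <= 5 * M * (48 * (M * (y - x))).
    apply: ler_pM => //; first exact: exprn_ge0.
    by apply: (le_trans D3'); lra.
  have : 0 <= M ^+ 2 * (y - x) by rewrite mulr_ge0// sqr_ge0.
  lra.
have [|n1] := leP (s ^+ 12 / 8) (q1 d x0 ^+ 4 - q1 d y0 ^+ 4).
  apply: (caseq _ _ (smooth_q1 d)) => r.
  - by move=> /rs rr; apply: (le_trans (q1_le d r e0)); exact: expr_mono.
  - by have [_ [? _]] := adens_bounds d e r.
have [|n2] := leP (s ^+ 12 / 8) (q2 d x0 ^+ 4 - q2 d y0 ^+ 4).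
  apply: (caseq _ _ (smooth_q2 d)) => r.
  - by move=> /rs rr; apply: (le_trans (q2_le d r e0)); exact: expr_mono.
  - by have [_ [_ ?]] := adens_bounds d e r.
have [|n3] := leP (s ^+ 12 / 8) (p1 d x0 ^+ 6 - p1 d y0 ^+ 6).
  apply: (casep _ _ (smooth_p1 d)) => r.
  - by move=> /rs rr; apply: (le_trans (p1_le d r e0)); exact: expr_mono.
  - by have [_ _ [? _]] := adens_bounds d e r.
have [|n4] := leP (s ^+ 12 / 8) (p2 d x0 ^+ 6 - p2 d y0 ^+ 6).
  apply: (casep _ _ (smooth_p2 d)) => r.
  - by move=> /rs rr; apply: (le_trans (p2_le d r e0)); exact: expr_mono.
  - by have [_ _ [_ ?]] := adens_bounds d e r.
by exfalso; move: Nd n1 n2 n3 n4; rewrite /rho12; lra.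
Qed.

End bad_interval.

Lemma nroot_ex (R : realType) (z : R) (n : nat) : 0 <= z -> (0 < n)%N ->
  exists2 w, 0 <= w & w ^+ n = z.
Proof.
move=> z0 n0; exists (z `^ n%:R^-1); first exact: powR_ge0.
by rewrite -powR_mulrn ?powR_ge0// -powRrM mulVf ?powRr1// pnatr_eq0 -lt0n.
Qed.

Lemma rho_continuous (R : realType) (a b M : R) (d : cubic_data a b M) (e t : R) :
  0 < e -> a < t < b -> {for t, continuous (rho d e)}.
Proof.
move=> e0 tab; apply: root12_continuous.
  by rewrite ltr_wpDl ?rho12_ge0// exprn_gt0.
apply: continuousD; last exact: cst_continuous.
do !apply: continuousD; apply: continuous_expr.
- exact: smooth_continuous (smooth_q1 d) tab.
- exact: smooth_continuous (smooth_q2 d) tab.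
- exact: smooth_continuous (smooth_p1 d) tab.
- exact: smooth_continuous (smooth_p2 d) tab.
Qed.

Section dyadic.
Context (R : realType) (a b M : R).
Hypothesis M1 : 1 <= M.

(** The estimate on all dyadic intervals at once: good intervals are leaves, bad
    ones are bisected, and what the bisection costs is paid by the factor th. *)
Lemma dyadic_estimate : exists C1 C2 C3 : R, [/\ 0 <= C1, 0 <= C2, 0 <= C3 &
  forall (d : cubic_data a b M) (e : R) (S A : R -> R) (x y t th : R),
  0 < e -> e <= 1 ->
  (forall t, a < t < b -> is_derive t 1 S (hdens d e t `^ (6 / 5))) ->
  (forall t, a < t < b -> is_derive t 1 A (adens d e t)) ->
  a < x -> x <= y -> y < b -> 0 < t ->
  (forall r, x <= r <= y -> rho d e r <= t ^+ 5) ->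
  0 <= th -> th ^+ 30 = y - x ->
  S y - S x <= C1 * (A y - A x) + C2 * th * (A y - A x) + C3 * t ^+ 3].
Proof.
have M0 : 0 <= M by exact: le_trans M1.
pose c := 2 ^+ 13 * M ^+ 2; pose T := 10 * M.
have c0 : 0 <= c by rewrite mulr_ge0// exprn_ge0.
have T0 : 0 <= T by rewrite mulr_ge0.
set C1 := 2 ^+ 12 * ((4 * c) ^+ 2 + (4 * c) ^+ 2 + 2 ^+ 4 * c).
set C3 := 2 ^+ 12 * (2 ^+ 4 * c) *
   (2 * (20 * M * T ^+ 3 + 22) + 2 * (20 * M * T ^+ 4 + 22) * T + 2 ^+ 17 * M).
have C10 : 0 <= C1.
  by rewrite /C1 mulr_ge0 ?exprn_ge0// !addr_ge0 ?sqr_ge0// mulr_ge0// exprn_ge0.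
have C30 : 0 <= C3.
  have t3 : 0 <= 20 * M * T ^+ 3 + 22.
    by rewrite addr_ge0 ?mulr_ge0 ?exprn_ge0.
  have t4 : 0 <= 20 * M * T ^+ 4 + 22.
    by rewrite addr_ge0 ?mulr_ge0 ?exprn_ge0.
  rewrite /C3; apply: mulr_ge0.
    by apply: mulr_ge0; [exact: exprn_ge0|apply: mulr_ge0 => //; exact: exprn_ge0].
  apply: addr_ge0; last by rewrite mulr_ge0// exprn_ge0.
  by apply: addr_ge0; [exact: mulr_ge0|apply: mulr_ge0 => //; exact: mulr_ge0].
pose G := 2 ^+ 6 * (6 * M) ^+ 6 * (2 ^+ 8 * M ^+ 2).
have G0 : 0 <= G.
  by rewrite /G !mulr_ge0 ?exprn_ge0// mulr_ge0.
have [k k0 kE] := @nroot_ex R (1 / 2) 30 ltac:(lra) isT.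
have k1 : k < 1.
  rewrite ltNge; apply/negP => /(exprn_ege1 30); rewrite kE; lra.
(* The value that the bisection reproduces, where k = 2^(-1/30) is the shrinking
   of th: C2 k + 2 C3 G = C2. *)
pose C2 := 2 * C3 * G / (1 - k).
have C20 : 0 <= C2.
  apply: divr_ge0; last by rewrite subr_ge0 ltW.
  by apply: mulr_ge0 => //; apply: mulr_ge0.
have C2E : C2 * k + 2 * C3 * G = C2.
  have : C2 * (1 - k) = 2 * C3 * G by rewrite /C2 divfK// subr_eq0 gt_eqF.
  lra.
exists C1, C2, C3; split => // d e S A X Y t th e0 e1 dS dA aX XY Yb t0 rt th0 thE.
have [delta dl0 Hdl] : exists2 dl, 0 < dl & forall s r, X <= s <= Y -> X <= r <= Y ->
    `|s - r| < dl -> `|rho d e s - rho d e r| < e / 2.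
  apply: heine => //; last by rewrite divr_gt0.
  by move=> r /andP[Xr rY]; apply: rho_continuous => //; lra.
have er r : e <= rho d e r.
  by apply: root12_ge; [rewrite addr_ge0 ?rho12_ge0 ?exprn_ge0// ltW|exact: ltW|
    rewrite lerDr rho12_ge0].
suff H n : forall x y t th, X <= x -> x <= y -> y <= Y -> y - x < 2 ^+ n * delta ->
    0 < t -> (forall r, x <= r <= y -> rho d e r <= t ^+ 5) -> 0 <= th ->
    th ^+ 30 = y - x ->
    S y - S x <= C1 * (A y - A x) + C2 * th * (A y - A x) + C3 * t ^+ 3.
  have [n Hn] : exists n, Y - X < 2 ^+ n * delta.
    exists (Num.truncn ((Y - X) / delta)).+1.
    rewrite -ltr_pdivrMr//.
    apply: (lt_le_trans (truncnS_gt _)).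
    by rewrite -natrX ler_nat ltnW// ltn_expl.
  by apply: (H n) => //.
have leaf x y t' : X <= x -> x <= y -> y <= Y -> 0 < t' ->
    (forall r, x <= r <= y -> rho d e r <= t' ^+ 5 /\ t' ^+ 5 <= 2 * rho d e r) ->
    S y - S x <= C1 * (A y - A x) + C3 * t' ^+ 3.
  move=> Xx xy yY t'0 good.
  have ax : a < x by exact: lt_le_trans Xx.
  have yb : y < b by exact: le_lt_trans Yb.
  have dA0 : 0 <= A y - A x.
    by rewrite subr_ge0; apply: (adens_mono dA ax yb).
  have [sl|/ltW sl] := leP (t' ^+ 5) (y - x).
    have := leaf_long M1 e0 e1 dS dA ax xy yb (exprn_gt0 5 t'0) good sl (erefl c).
    by rewrite -/C1; have : 0 <= C3 * t' ^+ 3 by [rewrite mulr_ge0// exprn_ge0// ltW]; lra.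
  have := leaf_short M1 e0 e1 dS ax xy yb t'0 good sl (erefl c) (erefl T).
  by rewrite -/C3; have : 0 <= C1 * (A y - A x) by [exact: mulr_ge0]; lra.
elim: n => [|n IH] x y {}t {}th Xx xy yY yxn {}t0 {}rt {}th0 {}thE;
  have ax : a < x by [exact: lt_le_trans Xx];
  have yb : y < b by [exact: le_lt_trans Yb];
  have cr : {within `[x, y], continuous (rho d e)} by
    [apply: continuous_in_subspaceT => r; rewrite inE/= in_itv/= => rJ;
     apply: rho_continuous => //; case/andP: rJ => ? ?; apply/andP;
     split; [exact: lt_le_trans ax _|exact: le_lt_trans yb]];
  have [x0 x0J x0max] := EVT_max xy cr;
  rewrite in_itv/= in x0J;
  have s0 := rho_gt0 d x0 e0;
  have [t1 t10' t1E] := nroot_ex (ltW s0) (isT : 0 < 5)%N;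
  have rt1 : forall r, x <= r <= y -> rho d e r <= t1 ^+ 5 by
    [move=> r rJ; rewrite t1E; apply: x0max; rewrite in_itv];
  have t10 : 0 < t1 by
    [rewrite lt_neqAle t10' andbT; apply/eqP => t1z; move: s0; rewrite -t1E -t1z expr0n/= ltxx];
  have t1t : t1 ^+ 3 <= t ^+ 3 by
    [apply: expr_mono => //; rewrite -(@ler_pXn2r _ 5) ?nnegrE ?(ltW t0)// t1E; exact: rt];
  have C3t : C3 * t1 ^+ 3 <= C3 * t ^+ 3 by [rewrite ler_wpM2l];
  have dA0 : 0 <= A y - A x by [rewrite subr_ge0; apply: (adens_mono dA ax yb)];
  have C2p : 0 <= C2 * th * (A y - A x) by [apply: mulr_ge0 => //; exact: mulr_ge0];
  have [good|bad] := pselect (forall r, x <= r <= y -> t1 ^+ 5 <= 2 * rho d e r);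
  try (have L := @leaf x y t1 Xx xy yY t10 (fun r rJ => conj (rt1 r rJ) (good r rJ));
    clear - L C2p C3t; lra);
  have {bad} [y0 y0J y0b] : exists2 y0, x <= y0 <= y & 2 * rho d e y0 < t1 ^+ 5 by
    [apply: contrapT => H; apply: bad => r rJ; rewrite leNgt; apply/negP => rb; apply: H; exists r].
(* The interval is too short for the scale to change by a factor 2. *)
- have := Hdl x0 y0; rewrite expr0 mul1r in yxn.
  move=> /(_ ltac:(clear - x0J Xx yY; lra) ltac:(clear - y0J Xx yY; lra)) H.
  have /H : `|x0 - y0| < delta.
    by rewrite ltr_norml; clear - x0J y0J yxn; apply/andP; split; lra.
  by move=> /ltr_normlW; have := er y0; have := e0; move: y0b; rewrite t1E; clear => *; lra.
(* Bisection; the terms C3 t1^3 of the two halves are paid by the bad interval. *)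
- pose z := (x + y) / 2.
  have [xz zy] : x <= z /\ z <= y by rewrite /z; clear - xy; split; lra.
  have [zn yn] : z - x < 2 ^+ n * delta /\ y - z < 2 ^+ n * delta.
    by move: yxn; rewrite exprS /z; clear => *; split; lra.
  have zx : (k * th) ^+ 30 = z - x.
    by rewrite exprMn kE thE /z; field.
  have yz : (k * th) ^+ 30 = y - z.
    by rewrite exprMn kE thE /z; field.
  have kth0 : 0 <= k * th by exact: mulr_ge0.
  have I1 := IH x z t1 (k * th) Xx xz (le_trans zy yY) zn t10.
  have {}I1 := I1 (fun r rJ => rt1 r ltac:(clear - rJ zy; lra)) kth0 zx.
  have I2 := IH z y t1 (k * th) (le_trans Xx xz) zy yY yn t10.
  have {}I2 := I2 (fun r rJ => rt1 r ltac:(clear - rJ xz; lra)) kth0 yz.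
  have xab : a < x0 < b by clear - x0J ax yb; lra.
  have sM := rho_le d M1 e0 e1 xab.
  have rs r : x <= r <= y -> rho d e r <= rho d e x0 by move=> /rt1; rewrite t1E.
  have B := bad_interval M1 e0 dA ax xy yb s0 rs sM x0J y0J (erefl _)
     ltac:(by rewrite -t1E) t10 t1E th0 thE.
  rewrite -/G in B.
  have B3 : C3 * t1 ^+ 3 <= C3 * (G * th * (A y - A x)) by exact: (ler_wpM2l C30 B).
  have C2E' : C2 * k * (th * (A y - A x)) + 2 * C3 * G * (th * (A y - A x)) =
     C2 * (th * (A y - A x)) by rewrite -mulrDl C2E.
  have C3tt : 0 <= C3 * t ^+ 3 by apply: mulr_ge0 => //; rewrite exprn_ge0// ltW.
  move: I1 I2 B3 C2E' C3tt; clear.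
  move: (S y) (S x) (S z) (A y) (A x) (A z) (C3 * t ^+ 3); intros; lra.
Qed.

End dyadic.

(** * The density of the roots in L^(6/5) *)

Lemma hdens_ge0 (R : realType) (a b M : R) (d : cubic_data a b M) (e t : R) :
  0 <= hdens d e t.
Proof.
have r0 : 0 <= rho d e t by exact: root12_ge0.
have v0 : 0 <= discr6 d e t by exact: root12_ge0.
by rewrite /hdens !addr_ge0// divr_ge0 ?addr_ge0 ?mulr_ge0 ?exprn_ge0.
Qed.

(** The dyadic estimate on the whole interval, where the coefficients bound the
    variations of their sixth roots. *)
Lemma hdens_total (R : realType) (a b M : R) : a < b -> 1 <= M ->
  exists2 K, 0 <= K & forall (d : cubic_data a b M) (e : R) (S : R -> R) (x y : R),
  0 < e -> e <= 1 ->
  (forall t, a < t < b -> is_derive t 1 S (hdens d e t `^ (6 / 5))) ->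
  a < x -> x <= y -> y < b -> S y - S x <= K.
Proof.
move=> ab M1; have M0 : 0 <= M by exact: le_trans M1.
have [C1 [C2 [C3 [C10 C20 C30 H]]]] := dyadic_estimate a b M1.
have ba0 : 0 <= b - a by rewrite subr_ge0 ltW.
have [L L0 LE] := nroot_ex ba0 (isT : 0 < 30)%N.
have [t t0 tE] := nroot_ex (mulr_ge0 (ler0n R 5) M0) (isT : 0 < 5)%N.
set W := 2 ^+ 13 * M * ((b - a) + M).
have W0 : 0 <= W.
  apply: mulr_ge0; last exact: addr_ge0.
  by apply: mulr_ge0 => //; exact: exprn_ge0.
set Q := (b - a) + W + W + W + W + W + W.
have Q0 : 0 <= Q by do 6!(apply: addr_ge0 => //).
have K2 : 0 <= C2 * L * Q by apply: mulr_ge0 => //; exact: mulr_ge0.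
exists (C1 * Q + C2 * L * Q + C3 * t ^+ 3).
  by apply: addr_ge0; [apply: addr_ge0 => //|]; apply: mulr_ge0 => //; exact: exprn_ge0.
move=> d e S x y e0 e1 dS ax xy yb.
have [W1 dW1] := wdens_primitive e0 (smooth_q1 d).
have [W2 dW2] := wdens_primitive e0 (smooth_q2 d).
have [W3 dW3] := wdens_primitive e0 (smooth_p1 d).
have [W4 dW4] := wdens_primitive e0 (smooth_p2 d).
have [W5 dW5] := wdens_primitive e0 (smooth_D1 d).
have [W6 dW6] := wdens_primitive e0 (smooth_D2 d).
pose A r := r + W1 r + W2 r + W3 r + W4 r + W5 r + W6 r.
have dA r : a < r < b -> is_derive r 1 A (adens d e r).
  move=> rab.
  have ? := dW1 r rab; have ? := dW2 r rab; have ? := dW3 r rab.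
  have ? := dW4 r rab; have ? := dW5 r rab; have ? := dW6 r rab.
  by apply: is_derive_eq.
have M6 : M <= M ^+ 6 by rewrite -{1}[M]expr1 ler_weXn2l.
have yx : y - x <= b - a by lra.
have tv g g' V : smooth a b M g g' ->
    (forall r, a < r < b -> is_derive r 1 V (wdens e g g' r)) -> V y - V x <= W.
  move=> sg dV; have gb r : x <= r <= y -> `|g r| <= M ^+ 6.
    by move=> rJ; apply: (le_trans _ M6); apply: (smooth_bound sg); lra.
  apply: (le_trans (tv_wdens M1 e0 M0 sg dV ax xy yb gb)).
  by rewrite /W ler_wpM2l ?mulr_ge0 ?exprn_ge0// lerD2r.
have V1 := tv _ _ _ (smooth_q1 d) dW1; have V2 := tv _ _ _ (smooth_q2 d) dW2.
have V3 := tv _ _ _ (smooth_p1 d) dW3; have V4 := tv _ _ _ (smooth_p2 d) dW4.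
have V5 := tv _ _ _ (smooth_D1 d) dW5; have V6 := tv _ _ _ (smooth_D2 d) dW6.
have AQ : A y - A x <= Q by rewrite /A /Q; lra.
have A0 : 0 <= A y - A x by rewrite subr_ge0; apply: (adens_mono dA ax yb).
have yx0 : 0 <= y - x by rewrite subr_ge0.
have [th th0 thE] := nroot_ex yx0 (isT : 0 < 30)%N.
have thL : th <= L by rewrite -(@ler_pXn2r _ 30)// ?nnegrE// thE LE.
have tp : 0 < t.
  rewrite lt_neqAle t0 andbT; apply/eqP => tz; move: tE; rewrite -tz expr0n/=; lra.
have rt r : x <= r <= y -> rho d e r <= t ^+ 5.
  by move=> rJ; rewrite tE; apply: rho_le => //; lra.
apply: (le_trans (H d e S A x y t th e0 e1 dS dA ax xy yb tp rt th0 thE)).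
rewrite lerD2r; apply: lerD; first exact: ler_wpM2l.
by apply: ler_pM => //; [exact: mulr_ge0|exact: ler_wpM2l].
Qed.

Lemma powR_continuous_ge0 (R : realType) (f : R -> R) (p t : R) : 1 <= p ->
  (forall t, 0 <= f t) -> {for t, continuous f} ->
  {for t, continuous (fun t => f t `^ p)}.
Proof.
move=> p1 f0 cf; have := f0 t; rewrite le_eqVlt => /predU1P[ft|ft].
- apply/cvgrPdist_lt => e e0.
  have m0 : 0 < Num.min e 1 by rewrite lt_min e0 ltr01.
  have [dl dl0 H] := continuous_eps cf m0.
  apply/nbhs_ballP; exists dl => // s; rewrite /ball/= distrC => /H.
  rewrite -ft subr0 ger0_norm// lt_min => /andP[fe f1].
  rewrite powR0 ?gt_eqF//; last by apply: lt_le_trans p1.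
  rewrite sub0r normrN ger0_norm ?powR_ge0//; apply: le_lt_trans fe.
  have := f0 s; rewrite le_eqVlt => /predU1P[<-|fs].
    by rewrite powR0// gt_eqF//; apply: lt_le_trans p1.
  by apply: ge1r_powR => //; rewrite fs ltW.
- apply: (@continuous_comp _ _ _ f (fun x => x `^ p)) => //.
  exact: is_derive_cont (is_derive1_powR p ft).
Qed.

Lemma hdens_continuous (R : realType) (a b M : R) (d : cubic_data a b M) (e t : R) :
  0 < rho d e t -> 0 < discr6 d e t ->
  0 < rho12 d t + e ^+ 12 -> 0 < D1 d t ^+ 2 + D2 d t ^+ 2 + e ^+ 12 ->
  a < t < b -> {for t, continuous (hdens d e)}.
Proof.
move=> r0 v0 rr0 vv0 tab.
have cq1 := smooth_continuous (smooth_q1 d) tab.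
have cq2 := smooth_continuous (smooth_q2 d) tab.
have cp1 := smooth_continuous (smooth_p1 d) tab.
have cp2 := smooth_continuous (smooth_p2 d) tab.
have cD1 := smooth_continuous (smooth_D1 d) tab.
have cD2 := smooth_continuous (smooth_D2 d) tab.
have cr : {for t, continuous (rho d e)}.
  apply: root12_continuous => //.
  apply: continuousD; last exact: cst_continuous.
  by do !apply: continuousD; apply: continuous_expr.
have cv : {for t, continuous (discr6 d e)}.
  apply: root12_continuous => //.
  apply: continuousD; last exact: cst_continuous.
  by do !apply: continuousD; apply: continuous_expr.
have cn g g' : smooth a b M g g' -> {for t, continuous (fun t => `|g' t|)}.
  by move=> sg; apply: cvg_norm; exact: smooth_continuous' sg tab.
apply: continuousD; first apply: continuousD.
- apply: continuousM; first by apply: continuousD; [exact: cn (smooth_q1 d)|exact: cn (smooth_q2 d)].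
  by apply: continuousV; [rewrite gt_eqF// exprn_gt0|exact: continuous_expr].
- apply: continuousM; first by apply: continuousD; [exact: cn (smooth_p1 d)|exact: cn (smooth_p2 d)].
  by apply: continuousV; rewrite ?gt_eqF.
- apply: continuousM; first by apply: continuousD; [exact: cn (smooth_D1 d)|exact: cn (smooth_D2 d)].
  apply: continuousV; first by rewrite gt_eqF// mulr_gt0 ?exprn_gt0.
  by apply: continuousM; exact: continuous_expr.
Qed.

Lemma hdens_continuous_e (R : realType) (a b M : R) (d : cubic_data a b M) (e t : R) :
  0 < e -> a < t < b -> {for t, continuous (hdens d e)}.
Proof.
move=> e0; apply: hdens_continuous.
- exact: rho_gt0.
- exact: discr6_gt0.
- by rewrite ltr_wpDl ?rho12_ge0// exprn_gt0.
- by rewrite ltr_wpDl ?addr_ge0 ?sqr_ge0// exprn_gt0.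
Qed.

Lemma hdens_bound (R : realType) (a b M : R) (d : cubic_data a b M) (e t : R) : 1 <= M ->
  0 < e -> a < t < b -> hdens d e t <= 2 * M / e ^+ 2 + 2 * M / e + 2 * M / (e ^+ 3 * e ^+ 2).
Proof.
move=> M1 e0 tab.
have er : e <= rho d e t.
  by apply: root12_ge; [rewrite addr_ge0 ?rho12_ge0 ?exprn_ge0// ltW|exact: ltW|
    rewrite lerDr rho12_ge0].
have ev : e <= discr6 d e t.
  apply: root12_ge; [by rewrite !addr_ge0 ?sqr_ge0 ?exprn_ge0// ltW|exact: ltW|].
  by rewrite lerDr addr_ge0// sqr_ge0.
have e0' := ltW e0.
have r0 := lt_le_trans e0 er; have v0 := lt_le_trans e0 ev.
have nn g g' h h' : smooth a b M g g' -> smooth a b M h h' -> `|g' t| + `|h' t| <= 2 * M.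
  by move=> sg sh; have := smooth_bound' sg tab; have := smooth_bound' sh tab; lra.
have hl (n D E : R) : 0 <= n -> n <= 2 * M -> 0 < E -> E <= D -> n / D <= 2 * M / E.
  move=> n0 nM E0 ED; apply: ler_pM => //.
    by rewrite invr_ge0 (le_trans (ltW E0)).
  by rewrite lef_pV2 ?posrE// (lt_le_trans E0).
apply: lerD; first apply: lerD.
- apply: hl; [by rewrite addr_ge0|exact: nn (smooth_q1 d) (smooth_q2 d)|exact: exprn_gt0|].
  exact: expr_mono.
- by apply: hl; [by rewrite addr_ge0|exact: nn (smooth_p1 d) (smooth_p2 d)| |].
- apply: hl; [by rewrite addr_ge0|exact: nn (smooth_D1 d) (smooth_D2 d)| |].
    by rewrite mulr_gt0 ?exprn_gt0.
  by apply: ler_pM; rewrite ?exprn_ge0//; exact: expr_mono.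
Qed.

(** The smoothed density is continuous and bounded on ]a, b[, so that its integral is
    a primitive. *)
Lemma hdens_primitive (R : realType) (a b M : R) (d : cubic_data a b M) (e : R) : 1 <= M ->
  0 < e -> exists S : R -> R, forall t, a < t < b ->
    is_derive t 1 S (hdens d e t `^ (6 / 5)).
Proof.
move=> M1 e0.
apply: (@primitive_oo _ _ _ ((2 * M / e ^+ 2 + 2 * M / e + 2 * M / (e ^+ 3 * e ^+ 2)) `^ (6 / 5))).
- move=> t tab; apply: powR_continuous_ge0; [lra|exact: hdens_ge0|].
  exact: hdens_continuous_e.
- move=> t tab; rewrite ger0_norm ?powR_ge0//.
  apply: ge0_ler_powR; [lra|by rewrite nnegrE hdens_ge0| |exact: hdens_bound].
  rewrite nnegrE; exact: le_trans (hdens_ge0 d e t) (hdens_bound d M1 e0 tab).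
Qed.

Local Open Scope ereal_scope.

Lemma limn_einf_ge (R : realType) (u v : (\bar R)^nat) (l : \bar R) :
  v @ \oo --> l -> (forall n, v n <= u n) -> l <= limn_einf u.
Proof.
move=> vl vu; have <- := (cvg_limn_einf_sup vl).1.
rewrite !limn_einf_lim; apply: lee_lim; [exact: is_cvg_einfs|exact: is_cvg_einfs|].
apply: nearW => n; apply: le_ereal_inf_tmp => _ [k /= nk <-].
by apply: le_trans (vu k); apply: ereal_inf_lbound; exists k.
Qed.

Local Close Scope ereal_scope.

Lemma FTC_derive (R : realType) (a b : R) (f F : R -> R) (x y : R) :
  (forall t, a < t < b -> is_derive t 1 F (f t)) ->
  (forall t, a < t < b -> {for t, continuous f}) ->
  a < x -> x < y -> y < b ->
  (\int[@lebesgue_measure R]_(t in `[x, y]) (f t)%:E = (F y - F x)%:E)%E.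
Proof.
move=> dF cf ax xy yb; have cF t : a < t < b -> {for t, continuous F}.
  by move=> tab; exact: is_derive_cont (dF t tab).
have xab : a < x < b by rewrite ax (lt_trans xy).
have yab : a < y < b by rewrite yb andbT (lt_trans ax).
rewrite (@continuous_FTC2 _ f F) ?EFinB//.
- apply: continuous_in_subspaceT => t; rewrite inE/= in_itv/= => /andP[xt ty].
  by apply: cf; rewrite (lt_le_trans ax)//= (le_lt_trans ty).
- split.
  + move=> t; rewrite in_itv/= => /andP[xt ty].
    by have [] := dF t; rewrite ?(lt_trans ax)//= (lt_trans ty).
  + by apply: cvg_at_right_filter; exact: cF.
  + by apply: cvg_at_left_filter; exact: cF.
- move=> t; rewrite in_itv/= => /andP[xt ty].
  have tab : a < t < b by rewrite (lt_trans ax)//= (lt_trans ty).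
  by rewrite derive1E; have [_ ->] := dF t tab.
Qed.

Lemma measurable_invr_ge0 (R : realType) (D : set R) (f : R -> R) :
  (forall t, 0 <= f t) -> measurable_fun D f -> measurable_fun D (fun t => (f t)^-1).
Proof.
move=> f0 mf.
have -> : (fun t => (f t)^-1) = (fun x => x `^ (-1)) \o f.
  by apply/funext => t /=; rewrite powR_inv1.
by apply: measurableT_comp => //; exact: measurable_powR.
Qed.

Lemma measurable_hdens (R : realType) (a b M e : R) (d : cubic_data a b M) :
  measurable_fun (`]a, b[%classic : set R) (hdens d e).
Proof.
have mc (f : R -> R) : (forall t, a < t < b -> {for t, continuous f}) ->
  measurable_fun (`]a, b[%classic : set R) f by exact: open_cts_measurable.
have mq1 := mc _ (fun t H => smooth_continuous (smooth_q1 d) H).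
have mq2 := mc _ (fun t H => smooth_continuous (smooth_q2 d) H).
have mp1 := mc _ (fun t H => smooth_continuous (smooth_p1 d) H).
have mp2 := mc _ (fun t H => smooth_continuous (smooth_p2 d) H).
have mD1 := mc _ (fun t H => smooth_continuous (smooth_D1 d) H).
have mD2 := mc _ (fun t H => smooth_continuous (smooth_D2 d) H).
have mn g g' : smooth a b M g g' -> measurable_fun (`]a, b[%classic : set R) (fun t => `|g' t|).
  by move=> sg; apply: mc => t tab; apply: cvg_norm; exact: smooth_continuous' sg tab.
have mX (f : R -> R) (n : nat) : measurable_fun (`]a, b[%classic : set R) f ->
    measurable_fun (`]a, b[%classic : set R) (fun t => f t ^+ n).
  by move=> mf; apply: measurable_funX.
have mr : measurable_fun (`]a, b[%classic : set R) (rho d e).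
  apply: (measurableT_comp (measurable_powR _)).
  by do !apply: measurable_funD => //; apply: mX.
have mv : measurable_fun (`]a, b[%classic : set R) (discr6 d e).
  apply: (measurableT_comp (measurable_powR _)).
  by do !apply: measurable_funD => //; apply: mX.
have r0 t : 0 <= rho d e t by exact: root12_ge0.
have v0 t : 0 <= discr6 d e t by exact: root12_ge0.
apply: measurable_funD; first apply: measurable_funD.
- apply: measurable_funM.
    by apply: measurable_funD; [exact: mn (smooth_q1 d)|exact: mn (smooth_q2 d)].
  by apply: measurable_invr_ge0; [move=> t; exact: exprn_ge0|exact: mX].
- apply: measurable_funM.
    by apply: measurable_funD; [exact: mn (smooth_p1 d)|exact: mn (smooth_p2 d)].
  exact: measurable_invr_ge0.
- apply: measurable_funM.
    by apply: measurable_funD; [exact: mn (smooth_D1 d)|exact: mn (smooth_D2 d)].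
  apply: measurable_invr_ge0; first by move=> t; rewrite mulr_ge0// exprn_ge0.
  by apply: measurable_funM; exact: mX.
Qed.

(** A term with a vanishing denominator is 0 by convention, and the others are
    continuous in the smoothing. *)
Lemma hdens_lower (R : realType) (a b M t : R) (d : cubic_data a b M) :
  exists k : R -> R, [/\ {for 0, continuous k}, k 0 = hdens d 0 t,
    forall e, 0 <= k e & forall e, 0 < e -> k e <= hdens d e t].
Proof.
have cX (n : nat) (x : R) : {for x, continuous (fun e : R => e ^+ n)}.
  exact: exprn_continuous.
have [r0|r0] := eqVneq (rho12 d t) 0.
  exists (fun=> 0); split => //; first exact: cst_continuous.
  - have rz : rho d 0 t = 0 by rewrite /rho r0 expr0n/= addr0 /root12 powR0// invr_neq0.
    by rewrite /hdens rz expr0n/= mulr0 !invr0 !mulr0 !addr0.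
  - by move=> e _; exact: hdens_ge0.
have rp : 0 < rho12 d t by rewrite lt_neqAle eq_sym r0 rho12_ge0.
have rp0 : 0 < rho12 d t + 0 ^+ 12 by rewrite expr0n/= addr0.
have cr : {for 0, continuous (fun e => rho d e t)}.
  apply: (@root12_continuous _ (fun e => rho12 d t + e ^+ 12)) => //.
  by apply: continuousD; [exact: cst_continuous|exact: cX].
have rr0 : 0 < rho d 0 t by exact: root12_gt0.
have [D0|D0] := eqVneq (D1 d t ^+ 2 + D2 d t ^+ 2) 0.
  exists (fun e => (`|q1' d t| + `|q2' d t|) / rho d e t ^+ 2 +
    (`|p1' d t| + `|p2' d t|) / rho d e t); split.
  - apply: continuousD; apply: continuousM; try exact: cst_continuous.
    + apply: (@continuousV _ _ (fun e => rho d e t ^+ 2)); first by rewrite gt_eqF// exprn_gt0.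
      exact: (@continuous_expr _ (fun e => rho d e t)).
    + by apply: (@continuousV _ _ (fun e => rho d e t)); rewrite ?gt_eqF.
  - have v0 : discr6 d 0 t = 0 by rewrite /discr6 D0 expr0n/= addr0 /root12 powR0// invr_neq0.
    by rewrite /hdens v0 expr0n/= mul0r !invr0 !mulr0 !addr0.
  - move=> e; have H : 0 <= rho d e t by exact: root12_ge0.
    by rewrite addr_ge0// divr_ge0 ?addr_ge0 ?exprn_ge0.
  - move=> e e0; rewrite /hdens lerDl divr_ge0 ?addr_ge0//.
    by rewrite mulr_ge0// exprn_ge0// root12_ge0.
have Dp : 0 < D1 d t ^+ 2 + D2 d t ^+ 2 by rewrite lt_neqAle eq_sym D0 addr_ge0// sqr_ge0.
have Dp0 : 0 < D1 d t ^+ 2 + D2 d t ^+ 2 + 0 ^+ 12 by rewrite expr0n/= addr0.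
have cv : {for 0, continuous (fun e => discr6 d e t)}.
  apply: (@root12_continuous _ (fun e => D1 d t ^+ 2 + D2 d t ^+ 2 + e ^+ 12)) => //.
  by apply: continuousD; [exact: cst_continuous|exact: cX].
have vv0 : 0 < discr6 d 0 t by exact: root12_gt0.
exists (fun e => hdens d e t); split => //; last by move=> e; exact: hdens_ge0.
apply: continuousD; first apply: continuousD; apply: continuousM; try exact: cst_continuous.
- apply: (@continuousV _ _ (fun e => rho d e t ^+ 2)); first by rewrite gt_eqF// exprn_gt0.
  exact: (@continuous_expr _ (fun e => rho d e t)).
- by apply: (@continuousV _ _ (fun e => rho d e t)); rewrite ?gt_eqF.
- apply: (@continuousV _ _ (fun e => discr6 d e t ^+ 3 * rho d e t ^+ 2)).
    by rewrite gt_eqF// mulr_gt0 ?exprn_gt0.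
  by apply: continuousM; [exact: (@continuous_expr _ (fun e => discr6 d e t))|
    exact: (@continuous_expr _ (fun e => rho d e t))].
Qed.

(** Fatou's lemma for the smoothed densities on an exhaustion of ]a, b[, as the
    smoothing tends to 0. *)
Lemma hdens_integral (R : realType) (a b M : R) : a < b -> 1 <= M ->
  exists2 K : R, 0 <= K & forall d : cubic_data a b M,
  (\int[@lebesgue_measure R]_(t in `]a, b[) (hdens d 0 t `^ (6 / 5))%:E <= K%:E)%E.
Proof.
move=> ab M1; have [K K0 HK] := hdens_total ab M1; exists K => // d.
pose en n : R := harmonic n.
pose xn n := a + (b - a) / 3 * en n; pose yn n := b - (b - a) / 3 * en n.
have en0 n : 0 < en n by rewrite /en/= invr_gt0 ltr0n.
have en1 n : en n <= 1 by rewrite /en/= invf_le1 ?ltr0n// ler1n.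
have ba3 : 0 < (b - a) / 3 by rewrite divr_gt0// subr_gt0.
have c1 n : 0 < (b - a) / 3 * en n by rewrite mulr_gt0.
have c2 n : (b - a) / 3 * en n <= (b - a) / 3 by rewrite ler_piMr// ltW.
have ax n : a < xn n by have := c1 n; rewrite /xn; lra.
have yb n : yn n < b by have := c1 n; rewrite /yn; lra.
have xy n : xn n < yn n by have := c2 n; rewrite /xn /yn; lra.
pose g n t : R := hdens d (en n) t `^ (6 / 5).
pose f n := ((EFin \o g n) \_ (`[xn n, yn n]%classic : set R)).
have sub n : `]a, b[ `&` `[xn n, yn n] = `[xn n, yn n]%classic :> set R.
  apply/setIidr => t /=; rewrite !in_itv/= => /andP[xt ty].
  by rewrite (lt_le_trans (ax n))//= (le_lt_trans ty).
have cg n t : a < t < b -> {for t, continuous (g n)}.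
  move=> tab; apply: powR_continuous_ge0; [lra|exact: hdens_ge0|].
  exact: hdens_continuous_e.
have intf n : (\int[@lebesgue_measure R]_(t in `]a, b[) f n t <= K%:E)%E.
  rewrite -integral_mkcondr sub.
  have [S dS] := hdens_primitive d M1 (en0 n).
  rewrite (FTC_derive dS (cg n) (ax n) (xy n) (yb n)) lee_fin.
  exact: (HK d (en n) S _ _ (en0 n) (en1 n) dS (ax n) (ltW (xy n)) (yb n)).
have f0 n t : (0 <= f n t)%E.
  by rewrite /f patchE; case: ifP => // _; rewrite lee_fin powR_ge0.
have mf n : measurable_fun (`]a, b[%classic : set R) (f n).
  apply/measurable_restrict => //; rewrite sub.
  apply/measurable_EFinP.
  apply: measurable_funS (open_cts_measurable (cg n)) => //.
  by rewrite -(sub n); exact: subIsetl.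
apply: (@le_trans _ _ (\int[@lebesgue_measure R]_(t in `]a, b[) limn_einf (f^~ t))%E).
  apply: ge0_le_integral => //.
  - by move=> t _; rewrite lee_fin powR_ge0.
  - apply/measurable_EFinP; apply: (measurableT_comp (measurable_powR _)).
    exact: measurable_hdens.
  - have -> : (fun t => limn_einf (f^~ t)) = (-%E \o (fun t => limn_esup (fun n => - f n t)%E)).
      apply/funext => t /=; rewrite -limn_einfN; congr limn_einf.
      by apply/funext => n /=; rewrite oppeK.
    apply: (measurableT_comp (@oppe_measurable R setT)).
    apply: measurable_fun_limn_esup => n.
    exact: (measurableT_comp (@oppe_measurable R setT) (mf n)).
  - move=> t; rewrite /= in_itv/= => tab.
    have [k [ck k0E k0 kh]] := hdens_lower t d.
    apply: (@limn_einf_ge _ _ (fun n => if t \in (`[xn n, yn n]%classic : set R) then (k (en n) `^ (6 / 5))%:E else 0%E)).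
    + have dl0 : 0 < Num.min (t - a) (b - t) / ((b - a) / 3).
        by rewrite divr_gt0// lt_min !subr_gt0.
      have Ht : \forall n \near \oo, t \in (`[xn n, yn n]%classic : set R).
        have [N _ HN] := @cvgr_lt R nat \oo _ en 0 cvg_harmonic _ dl0.
        exists N => // n /HN; rewrite /= ltr_pdivlMr// mulrC lt_min => /andP[h1 h2].
        by rewrite inE/= in_itv/= /xn /yn; apply/andP; split; lra.
      apply: cvg_trans; first apply: near_eq_cvg.
        by apply: filterS Ht => n ->.
      apply: cvg_EFin; first exact: nearW.
      rewrite -k0E; apply: (@cvg_comp _ _ _ en (fun e => k e `^ (6 / 5)) _ (nbhs (0 : R))).
        exact: cvg_harmonic.
      by apply: (powR_continuous_ge0 _ k0 ck); lra.
    + move=> n; rewrite /f patchE; case: ifP => // _; rewrite lee_fin.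
      apply: ge0_ler_powR; [lra|by rewrite nnegrE|by rewrite nnegrE hdens_ge0|].
      exact: kh.
apply: (le_trans (fatou (@lebesgue_measure R) (measurable_itv _) mf (fun n t _ => f0 n t))).
rewrite limn_einf_lim; apply: lime_le; first exact: is_cvg_einfs.
apply: nearW => n; apply: le_trans (intf n); apply: ereal_inf_lbound.
by exists n => //=.
Qed.

(** * The derivative of a simple root *)

Section normc_facts.
Context (R : realType).
Implicit Types z w : R[i].

Lemma normc_ge0 z : 0 <= normc z.
Proof. by case: z => u v; exact: sqrtr_ge0. Qed.

Lemma normc_gt0 z : z != 0 -> 0 < normc z.
Proof.
move=> z0; rewrite lt_neqAle normc_ge0 andbT eq_sym.
by apply: contra z0 => /eqP/eq0_normc ->.
Qed.

Lemma normc_def2 z : normc z ^+ 2 = complex.Re z ^+ 2 + complex.Im z ^+ 2.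
Proof. by case: z => u v /=; rewrite sqr_sqrtr// addr_ge0// sqr_ge0. Qed.

Lemma normcB z w : normc (z - w) <= normc z + normc w.
Proof. by rewrite (le_trans (le_normcD _ _))// normcN. Qed.

Lemma normcBC z w : normc (z - w) = normc (w - z).
Proof. by rewrite -normcN opprB. Qed.

Lemma normc_real (x : R) : normc x%:C = `|x|.
Proof. by rewrite /= expr0n/= addr0 sqrtr_sqr. Qed.

Lemma normcX z n : normc (z ^+ n) = normc z ^+ n.
Proof. by elim: n => [|n IH]; rewrite ?normc1// !exprS normcM IH. Qed.

Lemma normc_natr (n : nat) : normc (n%:R : R[i]) = n%:R.
Proof. by rewrite -[n%:R]/(1 *+ n) normcMn normc1. Qed.

Lemma normc_le_add z : normc z <= `|complex.Re z| + `|complex.Im z|.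
Proof.
rewrite -(@ler_pXn2r _ 2)// ?nnegrE ?normc_ge0 ?addr_ge0// normc_def2.
rewrite sqrrD !real_normK ?num_real//.
by have : 0 <= `|complex.Re z| * `|complex.Im z| by [exact: mulr_ge0]; lra.
Qed.

Lemma Re_le_normc z : `|complex.Re z| <= normc z.
Proof.
rewrite -(@ler_pXn2r _ 2)// ?nnegrE ?normc_ge0// normc_def2 real_normK ?num_real//.
by rewrite lerDl sqr_ge0.
Qed.

Lemma Im_le_normc z : `|complex.Im z| <= normc z.
Proof.
rewrite -(@ler_pXn2r _ 2)// ?nnegrE ?normc_ge0// normc_def2 real_normK ?num_real//.
by rewrite lerDr sqr_ge0.
Qed.

End normc_facts.

(** The estimate of the derivative -(p' l + q') / m of a simple root l of
    Z^3 + p Z + q, where m = 3 l^2 + p.  If m is small on the scale r of the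
    roots, then p and l are not, and D = 27 q^2 + 4 p^3 = m^2 (m + 3 p) has
    derivative -36 l p (q' + l p') + m (12 p p' - 18 l q'), which can be solved
    for p' l + q'. *)
Lemma root_slope_bound (R : realType) (l p q p' q' : R[i]) (r v : R) :
  0 < r -> l ^+ 3 + p * l + q = 0 -> 3 * l ^+ 2 + p != 0 ->
  normc p <= 2 * r ^+ 2 -> normc q <= 2 * r ^+ 3 ->
  (r ^+ 2 <= 2 * normc p \/ r ^+ 3 <= 2 * normc q) ->
  0 <= v -> v ^+ 2 = normc (27 * q ^+ 2 + 4 * p ^+ 3) ->
  normc (p' * l + q') <= 16 * normc (3 * l ^+ 2 + p) *
    (normc q' / r ^+ 2 + normc p' / r +
     normc (54 * q * q' + 12 * p ^+ 2 * p') / (v * r ^+ 2)).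
Proof.
move=> r0 lE mn0 pr qr low v0 vE.
set D' := 54 * q * q' + _; set m := 3 * l ^+ 2 + p.
have qE : q = - (l ^+ 3 + p * l) by apply/eqP; rewrite -addr_eq0 addrC lE.
have E1 : 27 * q ^+ 2 + 4 * p ^+ 3 = m ^+ 2 * (m + 3 * p) by rewrite qE /m; ring.
have E2 : 3 * q = - (l * (m + 2 * p)) by rewrite qE /m; ring.
have E3 : 3 * l ^+ 2 = m - p by rewrite /m; ring.
have E4 : 36 * l * p * (p' * l + q') = m * (12 * p * p' - 18 * l * q') - D'.
  by rewrite /D' /m qE; ring.
have L0 := normc_ge0 l; have P0 := normc_ge0 p; have Q0 := normc_ge0 q.
have M0 := normc_ge0 m; have P'0 := normc_ge0 p'; have Q'0 := normc_ge0 q'.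
have D'0 := normc_ge0 D'.
have r2 : 0 < r ^+ 2 by rewrite exprn_gt0.
have r3 : 0 < r ^+ 3 by rewrite exprn_gt0.
have T3 : 0 <= normc D' / (v * r ^+ 2) by rewrite divr_ge0// mulr_ge0// ltW.
have T2 : 0 <= normc p' / r by rewrite divr_ge0// ltW.
have T1 : 0 <= normc q' / r ^+ 2 by rewrite divr_ge0// ltW.
have L2 : normc l <= 2 * r.
  rewrite leNgt; apply/negP => Lr.
  have : normc l ^+ 3 <= normc p * normc l + normc q.
    have -> : normc l ^+ 3 = normc (- (p * l + q)).
      by rewrite -normcX; congr normc; apply/eqP; rewrite -addr_eq0 addrA lE.
    by rewrite normcN (le_trans (le_normcD _ _))// normcM.
  have h1 : normc p * normc l <= 2 * r ^+ 2 * normc l by rewrite ler_wpM2r.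
  have h2 : r ^+ 3 * 2 <= r ^+ 2 * normc l.
    by rewrite exprSr -mulrA ler_wpM2l// ?(ltW r2)//; lra.
  have h3 : 4 * r ^+ 2 * normc l < normc l ^+ 3.
    rewrite [X in _ < X]exprSr ltr_pM2r; last lra.
    have -> : 4 * r ^+ 2 = (2 * r) ^+ 2 by ring.
    by rewrite ltr_pXn2r// nnegrE; lra.
  have h4 : 0 < r ^+ 2 * normc l by rewrite mulr_gt0//; lra.
  lra.
have [big|small] := leP (r ^+ 2 / 8) (normc m).
  have h1 : normc (p' * l + q') <= r ^+ 2 * (2 * (normc p' / r) + normc q' / r ^+ 2).
    have -> : r ^+ 2 * (2 * (normc p' / r) + normc q' / r ^+ 2) = normc p' * (2 * r) + normc q'.
      by field; rewrite gt_eqF.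
    rewrite (le_trans (le_normcD _ _))// normcM lerD2r.
    by rewrite ler_wpM2l.
  apply: (le_trans h1).
  have h2 : r ^+ 2 * (2 * (normc p' / r) + normc q' / r ^+ 2) <=
     8 * normc m * (2 * (normc p' / r) + normc q' / r ^+ 2).
    by rewrite ler_wpM2r//; clear - big T1 T2; lra.
  apply: (le_trans h2).
  have -> : 16 * normc m * (normc q' / r ^+ 2 + normc p' / r + normc D' / (v * r ^+ 2)) =
    8 * normc m * (2 * (normc q' / r ^+ 2 + normc p' / r + normc D' / (v * r ^+ 2))) by ring.
  by rewrite ler_wpM2l ?mulr_ge0//; clear - T1 T2 T3; lra.
have Q3 : 3 * normc q <= normc l * (normc m + 2 * normc p).
  have -> : 3 * normc q = normc (3 * q) by rewrite normcM normc_natr.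
  rewrite E2 normcN normcM ler_wpM2l// (le_trans (le_normcD _ _))//.
  by rewrite normcM normc_natr.
have Pl : r ^+ 2 / 4 <= normc p.
  rewrite leNgt; apply/negP => Ps.
  have [|Ql] := low; first by clear - Ps r2; lra.
  have : normc l * (normc m + 2 * normc p) <= 2 * r * (5 / 8 * r ^+ 2).
    by apply: ler_pM => //; [clear - M0 P0; lra|clear - small Ps; lra].
  have eq5 : 2 * r * (5 / 8 * r ^+ 2) = 5 / 4 * r ^+ 3 by field.
  clear - Q3 Ql eq5 r3; lra.
have l2 : normc p - normc m <= 3 * normc l ^+ 2.
  have -> : 3 * normc l ^+ 2 = normc (m - p) by rewrite -E3 normcM normc_natr normcX.
  have -> : normc (m - p) = normc (p - m) by rewrite -normcN opprB.
  rewrite lerBlDr (le_trans _ (le_normcD _ _))//.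
  by rewrite subrK.
have Ll : r / 5 <= normc l.
  rewrite -(@ler_pXn2r _ 2)// ?nnegrE//; last lra.
  have -> : (r / 5) ^+ 2 = r ^+ 2 / 25 by field.
  clear - l2 small Pl r2; lra.
have lp0 : 0 < normc l by lra.
have pp0 : 0 < normc p by lra.
have n7 : normc (m + 3 * p) <= 7 * r ^+ 2.
  rewrite (le_trans (le_normcD _ _))// normcM normc_natr; clear - small pr r2; lra.
have vm : v <= 3 * r * normc m.
  rewrite -(@ler_pXn2r _ 2)// ?nnegrE ?mulr_ge0//; try lra.
  rewrite vE E1 normcM normcX.
  have -> : (3 * r * normc m) ^+ 2 = normc m ^+ 2 * (9 * r ^+ 2) by ring.
  by rewrite ler_wpM2l ?sqr_ge0//; lra.
have mp0 : 0 < normc m by apply: normc_gt0.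
have np : 0 < normc (m + 3 * p).
  have : 3 * normc p - normc m <= normc (m + 3 * p).
    rewrite lerBlDr; have -> : 3 * normc p = normc ((m + 3 * p) - m).
      by rewrite addrAC subrr add0r normcM normc_natr.
    exact: normcB.
  lra.
have vp : 0 < v.
  rewrite lt_neqAle v0 andbT; apply/eqP => vz.
  have : 0 < v ^+ 2 by rewrite vE E1 normcM normcX mulr_gt0// exprn_gt0.
  by rewrite -vz expr0n/= ltxx.
set T := normc D' / (v * r ^+ 2) in T3 *.
set P1 := normc p' / r in T2 *; set Q1 := normc q' / r ^+ 2 in T1 *.
have P1E : normc p' = P1 * r by rewrite /P1 divfK// gt_eqF.
have Q1E : normc q' = Q1 * r ^+ 2 by rewrite /Q1 divfK// gt_eqF.
have D'E : normc D' <= 3 * r ^+ 3 * normc m * T.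
  have -> : normc D' = v * (T * r ^+ 2) by rewrite /T; field; rewrite !gt_eqF.
  have -> : 3 * r ^+ 3 * normc m * T = 3 * r * normc m * (T * r ^+ 2) by ring.
  by apply: ler_wpM2r => //; rewrite mulr_ge0// ltW.
have LP : r ^+ 3 <= 20 * (normc l * normc p).
  have lP : r / 5 * (r ^+ 2 / 4) <= normc l * normc p.
    by apply: ler_pM => //; [clear - r0; lra|clear - r2; lra].
  have eq20 : r / 5 * (r ^+ 2 / 4) = r ^+ 3 / 20 by field.
  clear - lP eq20; lra.
have LP0 : 0 < 36 * (normc l * normc p) by rewrite !mulr_gt0.
rewrite -(ler_pM2l LP0).
have -> : 36 * (normc l * normc p) * normc (p' * l + q') =
    normc (m * (12 * p * p' - 18 * l * q') - D').
  by rewrite -E4 !normcM normc_natr; ring.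
rewrite (le_trans (normcB _ _))// normcM.
have c1 : normc (12 * p * p' - 18 * l * q') <= 12 * normc p * normc p' + 18 * normc l * normc q'.
  by rewrite (le_trans (normcB _ _))// !normcM !normc_natr.
have c2 : normc m * normc (12 * p * p' - 18 * l * q') <=
    normc m * (132 * (normc l * normc p) * (P1 + Q1)).
  rewrite ler_wpM2l// (le_trans c1)// P1E Q1E.
  have h1 : normc p * P1 * r <= normc p * P1 * (5 * normc l).
    by apply: ler_wpM2l; [exact: mulr_ge0|clear - Ll; lra].
  have h2 : normc l * Q1 * r ^+ 2 <= normc l * Q1 * (4 * normc p).
    by apply: ler_wpM2l; [exact: mulr_ge0|clear - Pl; lra].
  have h3 : 0 <= normc p * P1 * normc l by apply: mulr_ge0 => //; exact: mulr_ge0.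
  have h4 : 0 <= normc l * Q1 * normc p by apply: mulr_ge0 => //; exact: mulr_ge0.
  clear - h1 h2 h3 h4; lra.
have c3 : r ^+ 3 * (normc m * T) <= 20 * (normc l * normc p) * (normc m * T).
  by rewrite ler_wpM2r// mulr_ge0.
have h5 : 0 <= normc m * (normc l * normc p) * (P1 + Q1).
  by apply: mulr_ge0; [apply: mulr_ge0 => //; exact: mulr_ge0|exact: addr_ge0].
have h6 : 0 <= normc m * (normc l * normc p) * T by apply: mulr_ge0 => //; apply: mulr_ge0 => //; exact: mulr_ge0.
clear - c2 c3 D'E h5 h6; lra.
Qed.

(** * Increments dominated by local Lipschitz constants *)

(** Continuity in terms of the real-valued modulus. *)
Definition ccont (R : realType) (f : R -> R[i]) (t : R) : Prop :=
  forall e, 0 < e -> exists2 d, 0 < d & forall s, `|s - t| < d -> normc (f s - f t) < e.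

(** The local Lipschitz constant of f at t is at most L. *)
Definition slope_le (R : realType) (f : R -> R[i]) (t L : R) : Prop :=
  forall eta, 0 < eta -> exists2 d, 0 < d &
    forall s, `|s - t| < d -> normc (f s - f t) <= (L + eta) * `|s - t|.

(** A division that replaces the implicit function theorem: for a root f of a
    polynomial, the increment of the polynomial factors through that of f. *)
Lemma slope_ratio (R : realType) (f N Q : R -> R[i]) (t A : R) :
  0 <= A -> slope_le N t A -> N t = 0 -> ccont Q t -> Q t != 0 ->
  (exists2 d, 0 < d & forall s, `|s - t| < d -> (f s - f t) * Q s = N s) ->
  slope_le f t (A / normc (Q t)).
Proof.
move=> A0 HN N0 cQ Q0 [d0 d00 HQ] eta eta0.
set B := normc (Q t); have B0 : 0 < B by exact: normc_gt0.
have AB : 0 <= A / B by rewrite divr_ge0// ltW.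
have den : 0 < 1 + A / B + eta by lra.
pose e := eta * B / (1 + A / B + eta).
have e0 : 0 < e by rewrite divr_gt0// mulr_gt0.
have eE : e * (1 + A / B + eta) = eta * B by rewrite /e divfK// gt_eqF.
have eB : e < B.
  by rewrite /e ltr_pdivrMr// mulrC ltr_pM2l//; lra.
have [d1 d10 H1] := HN _ e0.
have [d2 d20 H2] := cQ _ e0.
exists (Num.min d0 (Num.min d1 d2)); first by rewrite !lt_min d00 d10.
move=> s; rewrite !lt_min => /andP[s0 /andP[s1 s2]].
have := H1 s s1; rewrite N0 subr0 -(HQ s s0) normcM => K.
have Qs : B - e <= normc (Q s).
  have : B <= normc (Q s) + normc (Q s - Q t).
    have -> : B = normc (Q s - (Q s - Q t)) by rewrite opprB addrC subrK.
    exact: normcB.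
  by have := H2 s s2; lra.
have Be : 0 < B - e by rewrite subr_gt0.
have F : (A + e) = (A / B + eta) * (B - e).
  have h : A / B * B = A by rewrite divfK// gt_eqF.
  rewrite mulrBr mulrDl h; move: eE; rewrite !mulrDr mulr1; lra.
rewrite -(ler_pM2r Be); apply: (@le_trans _ _ ((A + e) * `|s - t|)).
  apply: le_trans K; apply: ler_wpM2l => //; exact: normc_ge0.
by rewrite F mulrAC.
Qed.

Lemma slope_leD (R : realType) (f g : R -> R[i]) (t L1 L2 : R) :
  slope_le f t L1 -> slope_le g t L2 -> slope_le (fun s => f s - g s) t (L1 + L2).
Proof.
move=> Hf Hg eta eta0; have e2 : 0 < eta / 2 by rewrite divr_gt0.
have [d1 d10 H1] := Hf _ e2; have [d2 d20 H2] := Hg _ e2.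
exists (Num.min d1 d2); first by rewrite lt_min d10.
move=> s; rewrite lt_min => /andP[/H1 s1 /H2 s2].
have -> : f s - g s - (f t - g t) = (f s - f t) - (g s - g t) by ring.
rewrite (le_trans (normcB _ _))// (le_trans (lerD s1 s2))// -mulrDl.
by rewrite ler_wpM2r//; lra.
Qed.

(** Real induction, with an error proportional to the length that is removed at the
    end. *)
Lemma slope_dominated (R : realType) (f : R -> R[i]) (H : R -> R) (x y C : R) :
  x <= y -> 0 <= C ->
  (forall t, x <= t <= y -> exists k0, slope_le f t (C * k0) /\
     forall eta, 0 < eta -> exists2 d, 0 < d & forall u v, x <= u -> u <= t -> t <= v ->
       v <= y -> t - d < u -> v < t + d -> (k0 - eta) * (v - u) <= H v - H u) ->
  normc (f y - f x) <= C * (H y - H x).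
Proof.
move=> xy C0 loc.
suff G eta : 0 < eta -> normc (f y - f x) <= C * (H y - H x) + eta * (y - x).
  apply/ler_addgt0Pr => e e0.
  have den : 0 < (y - x) + 1 by rewrite ltr_wpDl// subr_ge0.
  have := G (e / ((y - x) + 1)) (divr_gt0 e0 den).
  move=> /le_trans; apply; rewrite lerD2l mulrAC ler_pdivrMr// ler_wpM2l ?ltW//; lra.
move=> eta0.
pose P u v := normc (f v - f u) <= C * (H v - H u) + eta * (v - u).
apply: (@cousin _ P) => //.
- move=> u v w uv vw; rewrite /P => h1 h2.
  have -> : f w - f u = (f w - f v) + (f v - f u) by ring.
  by rewrite (le_trans (le_normcD _ _))// (le_trans (lerD h2 h1))//; lra.
- move=> t txy; have [k0 [sl low]] := loc t txy.
  have e2 : 0 < eta / 2 by rewrite divr_gt0.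
  have C1 : 0 < C + 1 by lra.
  have [d1 d10 H1] := sl _ e2.
  have [d2 d20 H2] := low _ (divr_gt0 e2 C1).
  exists (Num.min d1 d2); first by rewrite lt_min d10.
  move=> u v xu ut tv vy; have m1 : Num.min d1 d2 <= d1 by rewrite ge_min lexx.
  have m2 : Num.min d1 d2 <= d2 by rewrite ge_min lexx orbT.
  move=> tu vt; rewrite /P.
  have K := H2 u v xu ut tv vy ltac:(lra) ltac:(lra).
  have hv := H1 v; rewrite ger0_norm ?subr_ge0// in hv.
  have {}hv := hv ltac:(lra).
  have hu := H1 u; rewrite ler0_norm ?subr_le0// in hu.
  have {}hu := hu ltac:(lra).
  have -> : f v - f u = (f v - f t) - (f u - f t) by ring.
  rewrite (le_trans (normcB _ _))// (le_trans (lerD hv hu))//.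
  have -> : (C * k0 + eta / 2) * (v - t) + (C * k0 + eta / 2) * (- (u - t)) =
    (C * k0 + eta / 2) * (v - u) by ring.
  have K2 : C * ((k0 - eta / 2 / (C + 1)) * (v - u)) <= C * (H v - H u) by rewrite ler_wpM2l.
  have K3 : C * (eta / 2 / (C + 1)) <= eta / 2.
    rewrite mulrCA; apply: ler_piMr; first exact: ltW.
    by rewrite ler_pdivrMr// mul1r; lra.
  have K4 : C * (eta / 2 / (C + 1)) * (v - u) <= eta / 2 * (v - u).
    by rewrite ler_wpM2r// subr_ge0 (le_trans ut).
  lra.
Qed.

Section zero_set.
Context (R : realType).

(** Up to its first zero z the increments of f are dominated, and |f x| = |f x - f z|. *)
Lemma to_first_zero (f : R -> R[i]) (G : R -> R) (x y : R) :
  x <= y -> (forall t, x <= t <= y -> ccont f t) ->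
  (forall u v, x <= u -> u <= v -> v <= y -> G u <= G v) ->
  (forall u v, x <= u -> u <= v -> v <= y -> (forall s, u <= s <= v -> f s != 0) ->
     normc (f v - f u) <= G v - G u) ->
  (exists2 z, x <= z <= y & f z = 0) -> normc (f x) <= G y - G x.
Proof.
move=> xy cf Gm dom [z0 z0xy fz0].
have Gxy : 0 <= G y - G x by rewrite subr_ge0 Gm.
have [fx|fx] := eqVneq (f x) 0; first by rewrite fx normc0.
pose A := [set t | x <= t <= y /\ forall s, x <= s <= t -> f s != 0].
have Ax : A x.
  split; first by rewrite lexx.
  by move=> s /andP[xs sx]; have -> : s = x by apply/eqP; rewrite eq_le xs sx.
have ubA : has_ubound A by exists y => t [/andP[]].
have supA : has_sup A by split => //; exists x.
pose z := sup A.
have xz : x <= z by exact: sup_upper_bound.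
have zy : z <= y by apply: ge_sup; [exists x|move=> t [/andP[]]].
have below t : x <= t -> t < z -> forall s, x <= s <= t -> f s != 0.
  move=> xt tz s /andP[xs st].
  have [u [uxy fu] tu] := sup_adherent (ltac:(rewrite subr_gt0; exact: tz) : 0 < z - t) supA.
  by apply: fu; rewrite xs (le_trans st)//; move: tu; rewrite -/z; lra.
have dz : normc (f z - f x) <= G y - G x.
  move: xz; rewrite le_eqVlt => /predU1P[<-|xz]; first by rewrite subrr normc0.
  apply/ler_addgt0Pr => e e0.
  have [|d d0 Hd] := cf z _ e e0; first by rewrite (ltW xz).
  pose t := Num.max x (z - d / 2).
  have tz : t < z by rewrite gt_max xz; lra.
  have xt : x <= t by rewrite le_max lexx.
  have td : z - d / 2 <= t by rewrite le_max lexx orbT.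
  have ft : normc (f t - f x) <= G y - G x.
    apply: (le_trans (dom x t (lexx x) xt (le_trans (ltW tz) zy) (below t xt tz))).
    by rewrite lerD2r Gm// (le_trans (ltW tz)).
  have : normc (f t - f z) < e by apply: Hd; rewrite ltr_norml; apply/andP; split; lra.
  have -> : f z - f x = (f t - f x) - (f t - f z) by ring.
  by move=> h; rewrite (le_trans (normcB _ _))//; lra.
have [fz|fz] := eqVneq (f z) 0; first by move: dz; rewrite fz sub0r normcN.
exfalso.
have fz0' : 0 < normc (f z) by exact: normc_gt0.
have [|d d0 Hd] := cf z _ _ fz0'; first by rewrite xz.
have near s : `|s - z| < d -> f s != 0.
  by move=> /Hd; apply: contraTneq => ->; rewrite sub0r normcN ltxx.
pose w := Num.min y (z + d / 2).
have wz : z <= w by rewrite le_min zy; lra.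
have wd : w <= z + d / 2 by rewrite ge_min lexx orbT.
have wy : w <= y by rewrite ge_min lexx.
have Aw : A w.
  split; first by rewrite (le_trans xz).
  move=> s /andP[xs sw]; have [sz|zs] := ltP s z.
    by apply: (below s) => //; rewrite xs lexx.
  by apply: near; rewrite ger0_norm ?subr_ge0//; lra.
have wz' : w <= z by exact: sup_upper_bound.
have yw : w = y by move: wz'; rewrite /w; case: (leP y (z + d / 2)) => //; lra.
by move: Aw => [_ /(_ z0)]; rewrite yw fz0 eqxx; move/(_ z0xy).
Qed.

(** Between its first and its last zero f has no increment; the two remaining
    intervals account for the factor 2. *)
Lemma zero_set_dominated (f : R -> R[i]) (G : R -> R) (x y : R) :
  x <= y -> (forall t, x <= t <= y -> ccont f t) ->
  (forall u v, x <= u -> u <= v -> v <= y -> G u <= G v) ->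
  (forall u v, x <= u -> u <= v -> v <= y -> (forall s, u <= s <= v -> f s != 0) ->
     normc (f v - f u) <= G v - G u) ->
  normc (f y - f x) <= 2 * (G y - G x).
Proof.
move=> xy cf Gm dom; have Gxy : 0 <= G y - G x by rewrite subr_ge0 Gm.
have [[z zxy fz]|nz] := pselect (exists2 z, x <= z <= y & f z = 0); last first.
  have : normc (f y - f x) <= G y - G x; last lra.
  apply: dom => // s sxy; apply/eqP => fs; apply: nz; by exists s.
have h1 : normc (f x) <= G y - G x by apply: to_first_zero => //; exists z.
have h2 : normc (f y) <= G y - G x.
  have := @to_first_zero (fun t => f (- t)) (fun t => - G (- t)) (- y) (- x).
  rewrite !opprK => /(_ _ _ _ _ _)/le_trans; apply; last lra.
  - by rewrite lerN2.
  - move=> t txy e e0; have [|d d0 Hd] := cf (- t) _ e e0; first lra.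
    exists d => // s st; apply: Hd; rewrite -opprD normrN; exact: st.
  - by move=> u v yu uv vx; rewrite lerN2 Gm; lra.
  - move=> u v yu uv vx fs; rewrite normcBC.
    have := dom (- v) (- u); have -> : - G (- v) - - G (- u) = G (- u) - G (- v) by ring.
    apply; [lra|lra|lra|] => s sv; have := fs (- s); rewrite opprK; apply; lra.
  - by exists (- z); rewrite ?opprK//; lra.
by rewrite (le_trans (normcB _ _))//; lra.
Qed.

End zero_set.

(** * The increments of a continuous root *)

Lemma derive_strict (R : realType) (g : R -> R) (t l eta : R) :
  is_derive t 1 g l -> 0 < eta ->
  exists2 d, 0 < d & forall s, `|s - t| < d -> `|g s - g t - l * (s - t)| <= eta * `|s - t|.
Proof.
move=> [dg Dg] eta0.
have : h^-1 *: ((g \o shift t) (h *: (1 : R)) - g t) @[h --> 0^'] --> l.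
  by rewrite -Dg; exact: dg.
move=> /cvgrPdist_lt/(_ _ eta0); rewrite near_withinE => /nbhs_ballP[d /= d0 H].
exists d => // s sd; have [->|st] := eqVneq s t; first by rewrite !subrr mulr0 subrr normr0 mulr0.
have st0 : s - t != 0 by rewrite subr_eq0.
have := H (s - t); rewrite /ball/= sub0r normrN => /(_ sd st0).
rewrite /GRing.scale/= mulr1 subrK => /ltW h.
have -> : g s - g t - l * (s - t) = - (l - (s - t)^-1 * (g s - g t)) * (s - t).
  by field.
by rewrite normrM normrN ler_wpM2r.
Qed.

Section ccont_algebra.
Context (R : realType).
Implicit Types f g : R -> R[i].

Lemma ccont_cst (c : R[i]) t : ccont (fun=> c) t.
Proof. by move=> e e0; exists 1 => // s _; rewrite subrr normc0. Qed.

Lemma ccontD f g t : ccont f t -> ccont g t -> ccont (fun s => f s + g s) t.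
Proof.
move=> cf cg e e0; have e2 : 0 < e / 2 by rewrite divr_gt0.
have [d1 d10 H1] := cf _ e2; have [d2 d20 H2] := cg _ e2.
exists (Num.min d1 d2); first by rewrite lt_min d10.
move=> s; rewrite lt_min => /andP[/H1 s1 /H2 s2].
have -> : f s + g s - (f t + g t) = (f s - f t) + (g s - g t) by ring.
by rewrite (le_lt_trans (le_normcD _ _))//; lra.
Qed.

Lemma ccontM f g t : ccont f t -> ccont g t -> ccont (fun s => f s * g s) t.
Proof.
move=> cf cg e e0.
pose K := 1 + normc (f t) + normc (g t).
have K1 : 1 <= K by rewrite /K; have := normc_ge0 (f t); have := normc_ge0 (g t); lra.
have K0 : 0 < K by exact: lt_le_trans K1.
pose eta := Num.min 1 (e / (2 * K)).
have eta0 : 0 < eta by rewrite lt_min ltr01 divr_gt0// mulr_gt0.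
have eta1 : eta <= 1 by rewrite ge_min lexx.
have etaK : eta * K <= e / 2.
  have : eta <= e / (2 * K) by rewrite ge_min lexx orbT.
  rewrite ler_pdivlMr ?mulr_gt0//; lra.
have [d1 d10 H1] := cf _ eta0; have [d2 d20 H2] := cg _ eta0.
exists (Num.min d1 d2); first by rewrite lt_min d10.
move=> s; rewrite lt_min => /andP[/H1 s1 /H2 s2].
have -> : f s * g s - f t * g t = (f s - f t) * (g s - g t) +
  (f t * (g s - g t) + (f s - f t) * g t) by ring.
rewrite (le_lt_trans (le_normcD _ _))//.
have h0 := le_normcD (f t * (g s - g t)) ((f s - f t) * g t).
rewrite !normcM in h0 *.
have n1 := normc_ge0 (f s - f t); have n2 := normc_ge0 (g s - g t).
have n3 := normc_ge0 (f t); have n4 := normc_ge0 (g t).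
have h1 : normc (f s - f t) * normc (g s - g t) <= 1 * eta.
  by apply: ler_pM => //; lra.
have h2 : normc (f t) * normc (g s - g t) <= normc (f t) * eta by rewrite ler_wpM2l// ltW.
have h3 : normc (f s - f t) * normc (g t) <= eta * normc (g t) by rewrite ler_wpM2r// ltW.
move: etaK; rewrite /K; lra.
Qed.

Lemma ccont_Complex (u v : R -> R) t :
  {for t, continuous u} -> {for t, continuous v} -> ccont (fun s => u s +i* v s) t.
Proof.
move=> cu cv e e0; have e2 : 0 < e / 2 by rewrite divr_gt0.
have [d1 d10 H1] := continuous_eps cu e2; have [d2 d20 H2] := continuous_eps cv e2.
exists (Num.min d1 d2); first by rewrite lt_min d10.
move=> s; rewrite lt_min => /andP[/H1 s1 /H2 s2].
have := normc_le_add ((u s +i* v s) - (u t +i* v t)).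
by move=> /le_lt_trans; apply => /=; lra.
Qed.

Lemma ccont_neq0 f t : ccont f t -> f t != 0 ->
  exists2 d, 0 < d & forall s, `|s - t| < d -> f s != 0.
Proof.
move=> cf f0; have [d d0 H] := cf _ (normc_gt0 f0).
exists d => // s /H; apply: contraTneq => ->.
by rewrite sub0r normcN ltxx.
Qed.

End ccont_algebra.

Lemma natr_Complex (R : realType) (n : nat) : (n%:R : R[i]) = n%:R +i* 0.
Proof. by rewrite -(rmorph_nat (real_complex R)). Qed.

Section cubic_root.
Context (R : realType) (a b M : R) (d : cubic_data a b M).

Definition pc (t : R) : R[i] := p1 d t +i* p2 d t.
Definition qc (t : R) : R[i] := q1 d t +i* q2 d t.
Definition pc' (t : R) : R[i] := p1' d t +i* p2' d t.
Definition qc' (t : R) : R[i] := q1' d t +i* q2' d t.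

Lemma discE t : 27 * qc t ^+ 2 + 4 * pc t ^+ 3 = D1 d t +i* D2 d t.
Proof.
rewrite !natr_Complex /qc /pc /D1 /D2 /disc1 /disc2 !exprS !expr0 !mulr1.
by apply/eqP; rewrite eq_complex /=; apply/andP; split; apply/eqP; ring.
Qed.

Lemma disc'E t : 54 * qc t * qc' t + 12 * pc t ^+ 2 * pc' t = D1' d t +i* D2' d t.
Proof.
rewrite !natr_Complex /qc /pc /qc' /pc' /D1' /D2' /disc1' /disc2' !exprS !expr0 !mulr1.
by apply/eqP; rewrite eq_complex /=; apply/andP; split; apply/eqP; ring.
Qed.

Lemma pc_strict t eta : a < t < b -> 0 < eta -> exists2 dl, 0 < dl &
  forall s, `|s - t| < dl -> normc (pc s - pc t - pc' t * (s - t)%:C) <= eta * `|s - t|.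
Proof.
move=> tab eta0; have e2 : 0 < eta / 2 by rewrite divr_gt0.
have [d1 d10 H1] := derive_strict (smooth_derive (smooth_p1 d) tab) e2.
have [d2 d20 H2] := derive_strict (smooth_derive (smooth_p2 d) tab) e2.
exists (Num.min d1 d2); first by rewrite lt_min d10.
move=> s; rewrite lt_min => /andP[/H1 s1 /H2 s2].
apply: (le_trans (normc_le_add _)) => /=.
rewrite !mulr0 subr0 add0r; lra.
Qed.

Lemma qc_strict t eta : a < t < b -> 0 < eta -> exists2 dl, 0 < dl &
  forall s, `|s - t| < dl -> normc (qc s - qc t - qc' t * (s - t)%:C) <= eta * `|s - t|.
Proof.
move=> tab eta0; have e2 : 0 < eta / 2 by rewrite divr_gt0.
have [d1 d10 H1] := derive_strict (smooth_derive (smooth_q1 d) tab) e2.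
have [d2 d20 H2] := derive_strict (smooth_derive (smooth_q2 d) tab) e2.
exists (Num.min d1 d2); first by rewrite lt_min d10.
move=> s; rewrite lt_min => /andP[/H1 s1 /H2 s2].
apply: (le_trans (normc_le_add _)) => /=.
rewrite !mulr0 subr0 add0r; lra.
Qed.

Lemma pc_cont t : a < t < b -> ccont pc t.
Proof.
by move=> tab; apply: ccont_Complex; [exact: smooth_continuous (smooth_p1 d) tab|
  exact: smooth_continuous (smooth_p2 d) tab].
Qed.

Lemma slope_lin t (u v : R[i]) : a < t < b ->
  slope_le (fun s => (pc s - pc t) * u + (qc s - qc t) * v) t (normc (pc' t * u + qc' t * v)).
Proof.
move=> tab eta eta0.
pose K := 1 + normc u + normc v.
have u0 := normc_ge0 u; have v0 := normc_ge0 v.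
have K0 : 0 < K by rewrite /K; lra.
have e0 : 0 < eta / K by rewrite divr_gt0.
have eK : eta / K * K = eta by rewrite divfK// gt_eqF.
have [d1 d10 H1] := pc_strict tab e0; have [d2 d20 H2] := qc_strict tab e0.
exists (Num.min d1 d2); first by rewrite lt_min d10.
move=> s; rewrite lt_min => /andP[/H1 s1 /H2 s2].
rewrite !subrr !mul0r addr0 subr0.
have -> : (pc s - pc t) * u + (qc s - qc t) * v =
  (pc' t * u + qc' t * v) * (s - t)%:C +
  ((pc s - pc t - pc' t * (s - t)%:C) * u + (qc s - qc t - qc' t * (s - t)%:C) * v) by ring.
rewrite (le_trans (le_normcD _ _))// [X in _ <= X]mulrDl normcM normc_real lerD2l.
rewrite (le_trans (le_normcD _ _))// !normcM.
have h1 := ler_wpM2r u0 s1; have h2 := ler_wpM2r v0 s2.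
apply: (le_trans (lerD h1 h2)).
have st0 : 0 <= eta / K * `|s - t| by rewrite mulr_ge0// ltW.
rewrite -{3}eK /K; lra.
Qed.

Lemma rho0X t : rho d 0 t ^+ 12 = rho12 d t.
Proof. by rewrite /rho expr0n/= addr0 root12K// rho12_ge0. Qed.

Let r0 t : 0 <= rho d 0 t. Proof. exact: root12_ge0. Qed.

Let abs_le4 (x r : R) : 0 <= r -> x ^+ 4 <= r ^+ 12 -> `|x| <= r ^+ 3.
Proof.
move=> rr H; rewrite -(@ler_pXn2r _ 4)// ?nnegrE ?exprn_ge0// -exprM -normrX.
by rewrite ger0_norm// (exprM x 2 2) sqr_ge0.
Qed.

Let abs_le6 (x r : R) : 0 <= r -> x ^+ 6 <= r ^+ 12 -> `|x| <= r ^+ 2.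
Proof.
move=> rr H; rewrite -(@ler_pXn2r _ 6)// ?nnegrE ?exprn_ge0// -exprM -normrX.
by rewrite ger0_norm// (exprM x 3 2) sqr_ge0.
Qed.

Let even4 (x : R) : 0 <= x ^+ 4. Proof. by rewrite (exprM x 2 2) sqr_ge0. Qed.
Let even6 (x : R) : 0 <= x ^+ 6. Proof. by rewrite (exprM x 3 2) sqr_ge0. Qed.

Lemma qc_le t : normc (qc t) <= 2 * rho d 0 t ^+ 3.
Proof.
have := normc_le_add (qc t) => /= /le_trans; apply.
have h1 : `|q1 d t| <= rho d 0 t ^+ 3.
  apply: abs_le4 => //; rewrite rho0X /rho12.
  by have := even4 (q2 d t); have := even6 (p1 d t); have := even6 (p2 d t); lra.
have h2 : `|q2 d t| <= rho d 0 t ^+ 3.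
  apply: abs_le4 => //; rewrite rho0X /rho12.
  by have := even4 (q1 d t); have := even6 (p1 d t); have := even6 (p2 d t); lra.
lra.
Qed.

Lemma pc_le t : normc (pc t) <= 2 * rho d 0 t ^+ 2.
Proof.
have := normc_le_add (pc t) => /= /le_trans; apply.
have h1 : `|p1 d t| <= rho d 0 t ^+ 2.
  apply: abs_le6 => //; rewrite rho0X /rho12.
  by have := even4 (q1 d t); have := even4 (q2 d t); have := even6 (p2 d t); lra.
have h2 : `|p2 d t| <= rho d 0 t ^+ 2.
  apply: abs_le6 => //; rewrite rho0X /rho12.
  by have := even4 (q1 d t); have := even4 (q2 d t); have := even6 (p1 d t); lra.
lra.
Qed.

Lemma rho_low t : 0 < rho d 0 t ->
  rho d 0 t ^+ 2 <= 2 * normc (pc t) \/ rho d 0 t ^+ 3 <= 2 * normc (qc t).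
Proof.
move=> rp; have [h|h1] := leP (rho d 0 t ^+ 2) (2 * normc (pc t)); first by left.
have [h|h2] := leP (rho d 0 t ^+ 3) (2 * normc (qc t)); first by right.
exfalso.
have b4 x : `|x| <= normc (qc t) -> x ^+ 4 <= rho d 0 t ^+ 12 / 16.
  move=> xq; have : `|x| <= rho d 0 t ^+ 3 / 2 by lra.
  move=> /(expr_mono 4 (normr_ge0 _)); rewrite -normrX ger0_norm//.
  by move=> /le_trans; apply; rewrite le_eqVlt; apply/orP; left; apply/eqP; field.
have b6 x : `|x| <= normc (pc t) -> x ^+ 6 <= rho d 0 t ^+ 12 / 64.
  move=> xq; have : `|x| <= rho d 0 t ^+ 2 / 2 by lra.
  move=> /(expr_mono 6 (normr_ge0 _)); rewrite -normrX ger0_norm//.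
  by move=> /le_trans; apply; rewrite le_eqVlt; apply/orP; left; apply/eqP; field.
have c1 := b4 _ (Re_le_normc (qc t)); have c2 := b4 _ (Im_le_normc (qc t)).
have c3 := b6 _ (Re_le_normc (pc t)); have c4 := b6 _ (Im_le_normc (pc t)).
have R12 := rho0X t; rewrite /rho12 in R12.
have : 0 < rho d 0 t ^+ 12 by rewrite exprn_gt0.
by move: c1 c2 c3 c4 => /=; lra.
Qed.

Lemma discr6_sqr t : (discr6 d 0 t ^+ 3) ^+ 2 = normc (27 * qc t ^+ 2 + 4 * pc t ^+ 3).
Proof.
have v0 : 0 <= discr6 d 0 t by exact: root12_ge0.
apply/eqP; rewrite -(@eqrXn2 _ 2)//; [|by rewrite exprn_ge0 ?exprn_ge0|exact: normc_ge0].
rewrite discE normc_def2 /= -!exprM /discr6 expr0n/= addr0 root12K//.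
by rewrite addr_ge0// sqr_ge0.
Qed.

(** The part of the density without D, which is continuous even where D vanishes. *)
Definition lowdens (t : R) : R :=
  (`|q1' d t| + `|q2' d t|) / rho d 0 t ^+ 2 + (`|p1' d t| + `|p2' d t|) / rho d 0 t.

Lemma lowdens_le t : lowdens t <= hdens d 0 t.
Proof.
by rewrite /hdens lerDl divr_ge0 ?addr_ge0// mulr_ge0// exprn_ge0// root12_ge0.
Qed.

Lemma rho0_continuous t : a < t < b -> 0 < rho12 d t -> {for t, continuous (rho d 0)}.
Proof.
move=> tab r12; apply: root12_continuous; first by rewrite expr0n/= addr0.
apply: continuousD; last exact: cst_continuous.
do !apply: continuousD; apply: continuous_expr.
- exact: smooth_continuous (smooth_q1 d) tab.
- exact: smooth_continuous (smooth_q2 d) tab.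
- exact: smooth_continuous (smooth_p1 d) tab.
- exact: smooth_continuous (smooth_p2 d) tab.
Qed.

(** Where D vanishes the term with D is 0 by convention and can be dropped; elsewhere
    the density is continuous. *)
Lemma hdens_minorant t : a < t < b -> 0 < rho12 d t ->
  exists k : R -> R, [/\ {for t, continuous k}, k t = hdens d 0 t &
    forall s, k s <= hdens d 0 s].
Proof.
move=> tab r12.
have rr : 0 < rho12 d t + 0 ^+ 12 by rewrite expr0n/= addr0.
have rp : 0 < rho d 0 t by exact: root12_gt0.
have [D0|D0] := eqVneq (D1 d t ^+ 2 + D2 d t ^+ 2) 0.
- exists lowdens; split; last exact: lowdens_le.
  + have cr := rho0_continuous tab r12.
    have cn g g' : smooth a b M g g' -> {for t, continuous (fun t => `|g' t|)}.
      by move=> sg; apply: cvg_norm; exact: smooth_continuous' sg tab.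
    apply: continuousD; apply: continuousM.
    * by apply: continuousD; [exact: cn (smooth_q1 d)|exact: cn (smooth_q2 d)].
    * by apply: continuousV; [rewrite gt_eqF// exprn_gt0|exact: continuous_expr].
    * by apply: continuousD; [exact: cn (smooth_p1 d)|exact: cn (smooth_p2 d)].
    * by apply: continuousV; rewrite ?gt_eqF.
  + have v0 : discr6 d 0 t = 0.
      by rewrite /discr6 D0 expr0n/= addr0 /root12 powR0// invr_neq0.
    by rewrite /hdens v0 (expr0n _ 3)/= mul0r !invr0 !mulr0 !addr0.
- have Dp : 0 < D1 d t ^+ 2 + D2 d t ^+ 2 by rewrite lt_neqAle eq_sym D0 addr_ge0// sqr_ge0.
  have Dp0 : 0 < D1 d t ^+ 2 + D2 d t ^+ 2 + 0 ^+ 12 by rewrite expr0n/= addr0.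
  exists (hdens d 0); split => //.
  by apply: hdens_continuous => //; exact: root12_gt0.
Qed.

End cubic_root.

Lemma slope_le_le (R : realType) (f : R -> R[i]) (t L1 L2 : R) :
  L1 <= L2 -> slope_le f t L1 -> slope_le f t L2.
Proof.
move=> LL Hf eta eta0; have [e e0 He] := Hf _ eta0.
by exists e => // s /He /le_trans; apply; rewrite ler_wpM2r// lerD2r.
Qed.

Section root_increments.
Context (R : realType) (a b M : R) (d : cubic_data a b M) (lam : R -> R[i]).
Hypothesis lam_root : forall t, a < t < b -> lam t ^+ 3 + pc d t * lam t + qc d t = 0.
Hypothesis lam_cont : forall t, a < t < b -> ccont lam t.

Let mult t := 3 * lam t ^+ 2 + pc d t.

Let rho_pos t : a < t < b -> lam t != 0 \/ mult t != 0 -> 0 < rho d 0 t.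
Proof.
move=> tab nz; rewrite lt_neqAle root12_ge0 andbT eq_sym; apply/eqP => r0.
have pz : pc d t = 0.
  by apply/eq0_normc/eqP; rewrite eq_le normc_ge0 andbT; have := pc_le d t; rewrite r0 expr0n/= mulr0.
have qz : qc d t = 0.
  by apply/eq0_normc/eqP; rewrite eq_le normc_ge0 andbT; have := qc_le d t; rewrite r0 expr0n/= mulr0.
have lz : lam t = 0.
  by apply/eqP; have := lam_root tab; rewrite pz qz mul0r !addr0 => /eqP; rewrite expf_eq0.
case: nz; first by rewrite lz eqxx.
by rewrite /mult pz lz expr0n/= mulr0 addr0 eqxx.
Qed.

Let rho12_pos t : a < t < b -> lam t != 0 \/ mult t != 0 -> 0 < rho12 d t.
Proof. by move=> tab nz; rewrite -rho0X exprn_gt0// rho_pos. Qed.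

(** Where m = 3 lam^2 + p does not vanish, the factorization
    (lam s - lam t) (lam s^2 + lam s lam t + lam t^2 + p s) =
    - ((p s - p t) lam t + (q s - q t))
    differentiates the root. *)
Lemma root_slope t : a < t < b -> mult t != 0 -> slope_le lam t (16 * hdens d 0 t).
Proof.
move=> tab m0; have rp := rho_pos tab (or_intror m0).
have mp : 0 < normc (mult t) by exact: normc_gt0.
pose u := - lam t; pose v : R[i] := - 1.
apply: (@slope_le_le _ _ _ (normc (pc' d t * u + qc' d t * v) / normc (mult t))); last first.
  have [d0 d00 Hd] : exists2 dl, 0 < dl & forall s, `|s - t| < dl -> a < s < b.
    exists (Num.min (t - a) (b - t)); first by rewrite lt_min !subr_gt0.
    by move=> s; rewrite lt_min !ltr_norml => /andP[/andP[? ?] /andP[? ?]]; apply/andP; split; lra.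
  pose Q s := lam s ^+ 2 + lam s * lam t + lam t ^+ 2 + pc d s.
  have -> : mult t = Q t by rewrite /mult /Q; ring.
  apply: (@slope_ratio _ _ _ Q); [exact: normc_ge0|exact: slope_lin| | | |].
  - by rewrite /= !subrr !mul0r addr0.
  - have cl := lam_cont tab; have cp := pc_cont d tab.
    apply: ccontD cp; apply: ccontD; last exact: ccont_cst.
    apply: ccontD; first exact: (ccontM cl cl).
    by apply: ccontM => //; exact: ccont_cst.
  - by move: m0; rewrite /mult /Q; apply: contra_neq => <-; ring.
  - exists d0 => // s /Hd sab; have := lam_root sab; have := lam_root tab.
    set x := lam s; set y := lam t => Ey Ex; rewrite /Q -/x -/y.
    have -> : qc d s = - (x ^+ 3 + pc d s * x) by apply/eqP; rewrite -addr_eq0 addrC Ex.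
    have -> : qc d t = - (y ^+ 3 + pc d t * y) by apply/eqP; rewrite -addr_eq0 addrC Ey.
    by rewrite /u /v -/y; ring.
rewrite ler_pdivrMr//.
have -> : normc (pc' d t * u + qc' d t * v) = normc (pc' d t * lam t + qc' d t).
  by rewrite -normcN; congr normc; rewrite /u /v; ring.
have v0 : 0 <= discr6 d 0 t ^+ 3 by rewrite exprn_ge0// root12_ge0.
have := root_slope_bound (pc' d t) (qc' d t) rp (lam_root tab) m0 (pc_le d t) (qc_le d t)
  (rho_low rp) v0 (discr6_sqr d t).
move=> /le_trans; apply; rewrite disc'E -/(mult t) mulrAC ler_wpM2r ?(ltW mp)//.
rewrite ler_wpM2l ?ler0n//; apply: lerD; first apply: lerD.
- by rewrite ler_wpM2r ?invr_ge0 ?exprn_ge0 ?(ltW rp)// (le_trans (normc_le_add _)).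
- by rewrite ler_wpM2r ?invr_ge0 ?(ltW rp)// (le_trans (normc_le_add _)).
- rewrite ler_wpM2r ?(le_trans (normc_le_add _))// invr_ge0 mulr_ge0// exprn_ge0//.
  exact: ltW.
Qed.

Let kap t := - 3 * qc d t / (2 * pc d t).

(** A double root of Z^3 + p Z + q is -3 q / (2 p). *)
Lemma double_root_slope t : a < t < b -> 0 < rho d 0 t ->
  rho d 0 t ^+ 2 <= 4 * normc (pc d t) -> slope_le kap t (48 * hdens d 0 t).
Proof.
move=> tab rp low; set r := rho d 0 t in rp low.
have r2 : 0 < r ^+ 2 by rewrite exprn_gt0.
have pp : 0 < normc (pc d t) by lra.
have p0 : pc d t != 0 by apply: contraTneq pp => ->; rewrite normc0 ltxx.
have n2 : (2 : R[i]) != 0 by rewrite pnatr_eq0.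
pose u := 3 * qc d t / pc d t; pose v : R[i] := - 3.
apply: (@slope_le_le _ _ _ (normc (pc' d t * u + qc' d t * v) / normc (2 * pc d t))); last first.
  have cp := pc_cont d tab; have [d0 d00 Hd] := ccont_neq0 cp p0.
  apply: (@slope_ratio _ _ _ (fun s => 2 * pc d s)); [exact: normc_ge0|exact: slope_lin| | | |].
  - by rewrite /= !subrr !mul0r addr0.
  - by apply: ccontM => //; exact: ccont_cst.
  - by rewrite mulf_neq0.
  - exists d0 => // s /Hd ps; rewrite /kap /u /v; field.
    by rewrite p0 ps.
have P'0 := normc_ge0 (pc' d t); have Q'0 := normc_ge0 (qc' d t).
have Q0 := normc_ge0 (qc d t).
have h1 : normc (pc' d t * u + qc' d t * v) <=
    normc (pc' d t) * (24 * r) + 3 * normc (qc' d t).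
  rewrite (le_trans (le_normcD _ _))// !normcM normcN !normc_natr.
  rewrite [normc (qc' d t) * 3]mulrC lerD2r ler_wpM2l// normcV ler_pdivrMr//.
  have := qc_le d t; rewrite -/r => qr.
  have : r * r ^+ 2 <= r * (4 * normc (pc d t)) by rewrite ler_wpM2l// ltW.
  rewrite -exprS; lra.
rewrite ler_pdivrMr ?normcM ?normc_natr ?mulr_gt0// (le_trans h1)//.
have h2 : 24 * (lowdens d t * r ^+ 2) <= 48 * hdens d 0 t * (2 * normc (pc d t)).
  have l0 : 0 <= lowdens d t.
    by rewrite addr_ge0// divr_ge0 ?addr_ge0// ?exprn_ge0// root12_ge0.
  have h3 : lowdens d t * r ^+ 2 <= hdens d 0 t * (4 * normc (pc d t)).
    by apply: ler_pM => //; [exact: ltW|exact: lowdens_le].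
  lra.
apply: le_trans h2.
have -> : lowdens d t * r ^+ 2 =
  (`|q1' d t| + `|q2' d t|) + (`|p1' d t| + `|p2' d t|) * r.
  by rewrite /lowdens -/r; field; rewrite gt_eqF.
have c1 : normc (pc' d t) <= `|p1' d t| + `|p2' d t| := normc_le_add _.
have c2 : normc (qc' d t) <= `|q1' d t| + `|q2' d t| := normc_le_add _.
have c3 : normc (pc' d t) * r <= (`|p1' d t| + `|p2' d t|) * r by rewrite ler_wpM2r// ltW.
lra.
Qed.

Variable H : R -> R.
Hypothesis Hmono : forall u v, a < u -> u <= v -> v < b -> H u <= H v.
Hypothesis Hlow : forall t (k : R -> R), a < t < b -> {for t, continuous k} ->
  (forall s, k s <= hdens d 0 s) -> forall eta, 0 < eta -> exists2 dl, 0 < dl &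
    forall u v, a < u -> u <= t -> t <= v -> v < b -> t - dl < u -> v < t + dl ->
      (k t - eta) * (v - u) <= H v - H u.

Lemma dens_dominated (f : R -> R[i]) x y C : a < x -> x <= y -> y < b -> 0 <= C ->
  (forall t, x <= t <= y -> 0 < rho12 d t /\ slope_le f t (C * hdens d 0 t)) ->
  normc (f y - f x) <= C * (H y - H x).
Proof.
move=> ax xy yb C0 sl; apply: slope_dominated => // t txy.
have [rp st] := sl t txy.
have tab : a < t < b by apply/andP; split; lra.
have [k [ck kt kh]] := hdens_minorant tab rp.
exists (k t); rewrite {1}kt; split => // eta eta0.
have [dl dl0 Hd] := Hlow tab ck kh eta0.
by exists dl => // u v xu ut tv vy tu vt; apply: Hd => //; lra.
Qed.

Let near_simple t : a < t < b -> mult t != 0 -> exists2 dl, 0 < dl &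
  forall u v, a < u -> u <= t -> t <= v -> v < b -> t - dl < u -> v < t + dl ->
    normc (lam v - lam u) <= 176 * (H v - H u).
Proof.
move=> tab m0.
have [dl dl0 Hd] : exists2 dl, 0 < dl & forall s, `|s - t| < dl -> mult s != 0.
  apply: ccont_neq0 m0; have cl := lam_cont tab; apply: ccontD (pc_cont d tab).
  by apply: ccontM; [exact: ccont_cst|exact: (ccontM cl cl)].
exists dl => // u v au ut tv vb tu vt.
have HH := Hmono au (le_trans ut tv) vb.
suff : normc (lam v - lam u) <= 16 * (H v - H u) by lra.
apply: dens_dominated => //; first exact: le_trans tv.
move=> s /andP[us sv].
have sab : a < s < b by apply/andP; split; lra.
have ms : mult s != 0 by apply: Hd; rewrite ltr_norml; apply/andP; split; lra.
by split; [apply: rho12_pos => //; right|exact: root_slope].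
Qed.

(** Where two nonzero roots collide, the multiple root is -3 q / (2 p) and p is
    not small on the scale of the roots.  The difference of the root and
    -3 q / (2 p) vanishes exactly where the root is multiple. *)
Let near_double t : a < t < b -> lam t != 0 -> mult t = 0 -> exists2 dl, 0 < dl &
  forall u v, a < u -> u <= t -> t <= v -> v < b -> t - dl < u -> v < t + dl ->
    normc (lam v - lam u) <= 176 * (H v - H u).
Proof.
move=> tab l0 m0; have rp := rho_pos tab (or_introl l0).
have lp := normc_gt0 l0.
set r := rho d 0 t in rp; have r2 : 0 < r ^+ 2 by rewrite exprn_gt0.
have pE : pc d t = - (3 * lam t ^+ 2) by apply/eqP; rewrite -addr_eq0 addrC -[X in X == 0]/(mult t) m0.
have qE : qc d t = 2 * lam t ^+ 3.
  have := lam_root tab; rewrite pE => h; apply/eqP; rewrite -subr_eq0 -h; apply/eqP; ring.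
have pn : normc (pc d t) = 3 * normc (lam t) ^+ 2.
  by rewrite pE normcN normcM normc_natr normcX.
have low : r ^+ 2 <= 2 * normc (pc d t).
  have [//|] := rho_low rp; rewrite -/r qE normcM normc_natr normcX => h.
  have : r ^+ 2 <= normc (pc d t); last by have := normc_ge0 (pc d t); lra.
  rewrite -(@ler_pXn2r _ 3)// ?nnegrE ?normc_ge0 ?(ltW r2)// pn.
  have -> : (r ^+ 2) ^+ 3 = r ^+ 3 * r ^+ 3 by ring.
  set L := normc (lam t) in lp h *.
  have L3 : 0 < L ^+ 3 by rewrite exprn_gt0.
  have h' : r ^+ 3 * r ^+ 3 <= (4 * L ^+ 3) * (4 * L ^+ 3).
    have r30 : 0 <= r ^+ 3 by rewrite exprn_ge0// ltW.
    by apply: ler_pM => //; lra.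
  apply: (le_trans h').
  have -> : 4 * L ^+ 3 * (4 * L ^+ 3) = 16 * (L ^+ 3 * L ^+ 3) by ring.
  have -> : (3 * L ^+ 2) ^+ 3 = 27 * (L ^+ 3 * L ^+ 3) by ring.
  have : 0 < L ^+ 3 * L ^+ 3 by rewrite mulr_gt0.
  lra.
have e0 : 0 < r ^+ 2 / 5 by rewrite divr_gt0.
have [d1 d10 H1] := pc_cont d tab e0.
have cr2 : {for t, continuous (fun s => rho d 0 s ^+ 2)}.
  by apply: continuous_expr; apply: rho0_continuous => //; apply: rho12_pos => //; left.
have [d2 d20 H2] := continuous_eps cr2 e0.
have [d3 d30 H3] := ccont_neq0 (lam_cont tab) l0.
exists (Num.min d1 (Num.min d2 d3)); first by rewrite !lt_min d10 d20.
move=> u v au ut tv vb tu vt.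
have uv := le_trans ut tv; have HH := Hmono au uv vb.
have dm s : u <= s <= v -> `|s - t| < Num.min d1 (Num.min d2 d3).
  by move=> /andP[us sv]; rewrite ltr_norml; apply/andP; split; lra.
have loc s : u <= s <= v -> [/\ a < s < b, lam s != 0, pc d s != 0 &
    rho d 0 s ^+ 2 <= 4 * normc (pc d s)].
  move=> suv; have := dm s suv; rewrite !lt_min => /andP[s1 /andP[s2 s3]].
  have h1 := H1 s s1; have h2 := H2 s s2; have h3 := H3 s s3.
  have h4 : normc (pc d t) <= normc (pc d s) + normc (pc d s - pc d t).
    have -> : pc d t = pc d s - (pc d s - pc d t) by ring.
    by rewrite (le_trans (normcB _ _))//; have -> : pc d s - (pc d s - pc d t) = pc d t by ring.
  have h5 : rho d 0 s ^+ 2 - r ^+ 2 < r ^+ 2 / 5 by rewrite (le_lt_trans (ler_norm _)).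
  move: suv => /andP[us sv]; split => //; first by apply/andP; split; lra.
    by apply/eqP => ps; move: h4; rewrite {1}ps normc0; lra.
  lra.
have rps s : u <= s <= v -> 0 < rho d 0 s.
  by move=> /loc[sab ls _ _]; apply: rho_pos => //; left.
have dkap x y : u <= x -> x <= y -> y <= v -> normc (kap y - kap x) <= 48 * (H y - H x).
  move=> ux xy yv; apply: dens_dominated => //; try lra.
  move=> s /andP[xs sy]; have suv : u <= s <= v by apply/andP; split; lra.
  have [sab ls ps lows] := loc s suv.
  by split; [apply: rho12_pos => //; left|apply: double_root_slope => //; exact: rps].
pose eta s := lam s - kap s.
have etaE s : u <= s <= v -> eta s = - lam s * mult s / (2 * pc d s).
  move=> /loc[sab _ ps _]; have := lam_root sab; rewrite /eta /kap /mult => h.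
  have -> : qc d s = - (lam s ^+ 3 + pc d s * lam s) by apply/eqP; rewrite -addr_eq0 addrC h.
  by field.
have deta : normc (eta v - eta u) <= 2 * (64 * H v - 64 * H u).
  apply: (@zero_set_dominated _ eta (fun s => 64 * H s)) => //.
  - move=> s suv; have [sab _ ps lows] := loc s suv.
    apply: ccontD; first exact: lam_cont.
    have := double_root_slope sab (rps s suv) lows.
    move=> /(_ 1 ltr01)[dl dl0 Hd] e ep.
    set K := _ + 1 in Hd.
    pose K' := `|K| + 1; have K'0 : 0 < K' by rewrite ltr_wpDl.
    exists (Num.min dl (e / K')); first by rewrite lt_min dl0 divr_gt0.
    move=> w; rewrite lt_min => /andP[/Hd hw]; rewrite ltr_pdivlMr// => hw2.
    have -> : - kap w - - kap s = - (kap w - kap s) by ring.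
    rewrite normcN (le_lt_trans hw)// (le_lt_trans _ hw2)// [X in _ <= X]mulrC.
    by rewrite ler_wpM2r// /K' (le_trans (ler_norm _))// lerDl.
  - by move=> x y ux xy yv; rewrite ler_wpM2l// Hmono//; lra.
  - move=> x y ux xy yv nz; rewrite -mulrBr; apply: dens_dominated => //; try lra.
    move=> s sxy; have suv : u <= s <= v by move: sxy => /andP[xs sy]; apply/andP; split; lra.
    have [sab ls ps lows] := loc s suv.
    split; first by apply: rho12_pos => //; left.
    have ms : mult s != 0.
      by apply: contraNneq (nz s sxy) => ms; rewrite (etaE s suv) ms mulr0 mul0r.
    have -> : 64 * hdens d 0 s = 16 * hdens d 0 s + 48 * hdens d 0 s by lra.
    by apply: slope_leD; [exact: root_slope|apply: double_root_slope => //; exact: rps].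
have dk := dkap u v (lexx _) uv (lexx _).
have -> : lam v - lam u = (eta v - eta u) + (kap v - kap u) by rewrite /eta; ring.
by rewrite (le_trans (le_normcD _ _))//; lra.
Qed.

(** Multiple roots are crossed in two steps: nonzero ones by comparison with
    -3 q / (2 p), and then the zeros of the root itself. *)
Lemma root_increments x y : a < x -> x <= y -> y < b ->
  normc (lam y - lam x) <= 352 * (H y - H x).
Proof.
move=> ax xy yb.
have -> : 352 * (H y - H x) = 2 * (176 * H y - 176 * H x) by ring.
apply: (@zero_set_dominated _ lam (fun s => 176 * H s)) => //.
- by move=> t txy; apply: lam_cont; apply/andP; split; lra.
- by move=> u v xu uv vy; rewrite ler_wpM2l// Hmono//; lra.
- move=> u v xu uv vy nz; rewrite -mulrBr.
  apply: (@cousin _ (fun u v => normc (lam v - lam u) <= 176 * (H v - H u))) => //.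
  + move=> r s t rs st h1 h2.
    have -> : lam t - lam r = (lam t - lam s) + (lam s - lam r) by ring.
    by rewrite (le_trans (le_normcD _ _))//; lra.
  + move=> t tuv; have tab : a < t < b by apply/andP; split; lra.
    have [dl dl0 Hd] : exists2 dl, 0 < dl &
      forall u v, a < u -> u <= t -> t <= v -> v < b -> t - dl < u -> v < t + dl ->
        normc (lam v - lam u) <= 176 * (H v - H u).
      by have [m0|m0] := eqVneq (mult t) 0; [apply: near_double => //; exact: nz|exact: near_simple].
    by exists dl => // r s ur rt ts sv tr st; apply: Hd => //; lra.
Qed.

End root_increments.

(** * Densities of dominated increments *)

Section cumulative_integral.
Context (R : realType) (h : R -> R).
Local Notation mu := (@lebesgue_measure R).
Hypothesis h0 : forall t, 0 <= h t.
Hypothesis ih : mu.-integrable setT (EFin \o h).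

Let ihS A : measurable A -> mu.-integrable A (EFin \o h).
Proof. by move=> mA; apply: (integrableS measurableT mA) ih. Qed.

Definition cumul (t : R) : R := Rintegral mu `]-oo, t] h.

Lemma cumulB x y : x <= y -> cumul y - cumul x = Rintegral mu `]x, y] h.
Proof. by move=> xy; rewrite /cumul Rintegral_itvB//; exact: ihS. Qed.

Lemma cumul_mono x y : x <= y -> cumul x <= cumul y.
Proof. by move=> xy; rewrite -subr_ge0 cumulB// Rintegral_ge0. Qed.

Lemma cumul_ge0 t : 0 <= cumul t.
Proof. exact: Rintegral_ge0. Qed.

Lemma cumul_le t : cumul t <= Rintegral mu setT h.
Proof.
rewrite /cumul /Rintegral fine_le//.
- by apply: integrable_fin_num => //; exact: ihS.
- exact: integrable_fin_num.
- apply: ge0_subset_integral => //; first exact: (measurable_int mu).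
  by move=> x _; rewrite lee_fin.
Qed.

Lemma cumul_uniform e : 0 < e ->
  exists2 d, 0 < d & forall x y, x <= y -> y < x + d -> cumul y - cumul x < e.
Proof.
move=> e0; have [d [d0 Hd]] := integral_normr_continuous ih e0.
exists d => // x y xy yx; rewrite cumulB//.
have -> : Rintegral mu `]x, y] h = Rintegral mu `]x, y] (fun t => `|h t|).
  by apply: eq_Rintegral => t _; rewrite ger0_norm.
have small : (mu `]x, y] < d%:E)%E.
  rewrite lebesgue_measure_itv/=; case: ifP => _; last by rewrite lte_fin.
  by rewrite -EFinB lte_fin; lra.
exact: Hd.
Qed.

(** Near t the primitive grows at least as fast as every continuous minorant of h;
    this is how the dominating function enters the estimate of the roots. *)
Lemma cumul_low (a b t : R) (k : R -> R) : a < t < b -> {for t, continuous k} ->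
  (forall s, a < s < b -> k s <= h s) -> forall eta, 0 < eta -> exists2 dl, 0 < dl &
    forall u v, a < u -> u <= t -> t <= v -> v < b -> t - dl < u -> v < t + dl ->
      (k t - eta) * (v - u) <= cumul v - cumul u.
Proof.
move=> tab ck kh eta eta0; have [d d0 Hd] := continuous_eps ck eta0.
exists d => // u v au ut tv vb tu vt; have uv := le_trans ut tv.
rewrite cumulB//.
have len : mu `]u, v] = (v - u)%:E.
  rewrite lebesgue_measure_itv/= lte_fin; case: ltP => // vu.
  by have -> : v = u by [apply/eqP; rewrite eq_le vu]; rewrite subrr.
have -> : (k t - eta) * (v - u) = Rintegral mu `]u, v] (fun=> k t - eta).
  by rewrite Rintegral_cst// -[v - u]/(fine (v - u)%:E) -len.
apply: le_Rintegral => //.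
- apply/integrableP; split; first exact: measurable_cst.
  by rewrite integral_cst// [X in (_ * X)%E]len -EFinM ltry.
- exact: ihS.
- move=> s /=; rewrite in_itv/= => /andP[us sv].
  have sab : a < s < b by apply/andP; split; lra.
  apply: le_trans (kh s sab).
  have := Hd s; rewrite ltr_norml => /(_ ltac:(apply/andP; split; lra)).
  by rewrite ltr_norml => /andP[]; lra.
Qed.

End cumulative_integral.

Lemma stieltjes_itvoc (R : realType) (F : cumulative R R) (x y : R) : x <= y ->
  lebesgue_stieltjes_measure F `]x, y] = (F y - F x)%:E.
Proof.
move=> xy; rewrite /lebesgue_stieltjes_measure /measure_extension/=.
by rewrite measurable_mu_extE/= ?wlength_itv_bnd//; exact: is_ocitv.
Qed.

Section lipschitz_density.
Context (R : realType) (h : R -> R).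
Local Notation mu := (@lebesgue_measure R).
Hypothesis h0 : forall t, 0 <= h t.
Hypothesis ih : mu.-integrable setT (EFin \o h).
Variable f : R -> R.
Hypothesis fH : forall x y, x <= y -> `|f y - f x| <= cumul h y - cumul h x.

Let mono_cont (F : R -> R) (C : R) :
  (forall x y, x <= y -> 0 <= F y - F x <= C * (cumul h y - cumul h x)) ->
  nondecreasing F /\ right_continuous F.
Proof.
move=> HF; split; first by move=> x y xy; rewrite -subr_ge0; have /andP[] := HF x y xy.
apply: right_continuousW => x; apply/cvgrPdist_lt => e e0.
have e1 : 0 < e / (`|C| + 1) by rewrite divr_gt0// ltr_wpDl.
have [d d0 Hd] := cumul_uniform h0 ih e1.
have key u v : u <= v -> v < u + d -> 0 <= F v - F u < e.
  move=> uv vu; have /andP[-> /le_lt_trans ->] := HF u v uv => //.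
  have K := Hd u v uv vu; have K0 := cumul_mono h0 ih uv.
  have C1 : 0 < `|C| + 1 by rewrite ltr_wpDl.
  have : (`|C| + 1) * (cumul h v - cumul h u) < e.
    by rewrite -ltr_pdivlMl// mulrC.
  apply: le_lt_trans; apply: ler_wpM2r; first by rewrite subr_ge0.
  by rewrite (le_trans (ler_norm _))// lerDl.
apply/nbhs_ballP; exists d => // t; rewrite /ball/= ltr_norml => /andP[t1 t2].
have [xt|tx] := leP x t.
  by have := key x t xt ltac:(lra); rewrite distrC ltr_norml; lra.
by have := key t x (ltW tx) ltac:(lra); rewrite ltr_norml; lra.
Qed.

Let Fp t := cumul h t + f t.
Let Fm t := cumul h t - f t.
Let F2 t := 2 * cumul h t.

Let Fp_cum : nondecreasing Fp /\ right_continuous Fp.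
Proof.
apply: (@mono_cont _ 2) => x y xy; have := fH xy; rewrite ler_norml /Fp => /andP[].
by move=> *; apply/andP; split; lra.
Qed.

Let Fm_cum : nondecreasing Fm /\ right_continuous Fm.
Proof.
apply: (@mono_cont _ 2) => x y xy; have := fH xy; rewrite ler_norml /Fm => /andP[].
by move=> *; apply/andP; split; lra.
Qed.

Let F2_cum : nondecreasing F2 /\ right_continuous F2.
Proof.
apply: (@mono_cont _ 2) => x y xy; have := cumul_mono h0 ih xy.
by rewrite /F2; move=> *; apply/andP; split; lra.
Qed.

HB.instance Definition _ := isCumulative.Build R _ R Fp Fp_cum.1 Fp_cum.2.
HB.instance Definition _ := isCumulative.Build R _ R Fm Fm_cum.1 Fm_cum.2.
HB.instance Definition _ := isCumulative.Build R _ R F2 F2_cum.1 F2_cum.2.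

Let nup := lebesgue_stieltjes_measure Fp.
Let num := lebesgue_stieltjes_measure Fm.
HB.instance Definition _ := Measure.on nup.
HB.instance Definition _ := Measure.on num.

Let nu2 (A : set (measurableTypeR R)) := (\int[mu]_(t in A) (2 * h t)%:E)%E.

Let m2h : measurable_fun setT (fun t => (2 * h t)%:E).
Proof.
apply/measurable_EFinP; apply: measurable_funM => //.
by apply/measurable_EFinP; exact: (measurable_int mu).
Qed.

Let nu2_0 : nu2 set0 = 0%E. Proof. exact: integral_set0. Qed.
Let nu2_ge0 A : (0 <= nu2 A)%E.
Proof. by apply: integral_ge0 => t _; rewrite lee_fin mulr_ge0. Qed.
Let nu2_sigma : semi_sigma_additive nu2.
Proof.
by apply: semi_sigma_additive_nng_induced => // t; rewrite lee_fin mulr_ge0.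
Qed.
HB.instance Definition _ := isMeasure.Build _ _ _ nu2 nu2_0 nu2_ge0 nu2_sigma.

Let i2h A : measurable A -> mu.-integrable A (fun t => (2 * h t)%:E).
Proof.
move=> mA; apply: (integrableS measurableT) => //.
have := integrableZl measurableT 2 ih.
by apply: eq_integrable => // t _ /=; rewrite EFinM.
Qed.

Let nu2E A : measurable A -> (nup A + num A = nu2 A)%E.
Proof.
move=> mA; rewrite -[LHS](measure_addE [the measure _ _ of nup] [the measure _ _ of num]).
transitivity (lebesgue_stieltjes_measure F2 A); last first.
  apply: lebesgue_stieltjes_measure_unique mA => _ [[x y]] _ <- /=.
  have [xy|yx] := leP x y; last first.
    by rewrite set_itv_ge ?measure0// bnd_simp -leNgt ltW.
  rewrite stieltjes_itvoc// /nu2 /F2 -mulrBr cumulB//.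
  rewrite -RintegralZl//; last exact: (integrableS measurableT).
  rewrite /Rintegral fineK// integrable_fin_num//; exact: i2h.
apply/esym; apply: lebesgue_stieltjes_measure_unique mA => _ [[x y]] _ <- /=.
have [xy|yx] := leP x y; last first.
  by rewrite set_itv_ge ?measure0// bnd_simp -leNgt ltW.
rewrite -[RHS]/(measure_add [the measure _ _ of nup] [the measure _ _ of num] `]x, y]%classic).
rewrite measure_addE /= /nup /num !stieltjes_itvoc// -EFinD; congr (_%:E).
change (2 * cumul h y - 2 * cumul h x = (cumul h y + f y - (cumul h x + f x)) +
  (cumul h y - f y - (cumul h x - f x))); ring.
Qed.

Let nu_le A : measurable A -> (nup A <= nu2 A)%E /\ (num A <= nu2 A)%E.
Proof. by move=> mA; rewrite -nu2E//; split; [exact: leeDl|exact: leeDr]. Qed.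

Let nu2_fin A : measurable A -> nu2 A \is a fin_num.
Proof. by move=> mA; apply: integrable_fin_num => //; exact: i2h. Qed.

Let nu2_null A : measurable A -> mu A = 0%E -> nu2 A = 0%E.
Proof. by move=> mA A0; apply: null_set_integral => //; exact: measurable_funTS. Qed.

Let fin_of (nu : {measure set (measurableTypeR R) -> \bar R}) :
  (forall A, measurable A -> (nu A <= nu2 A)%E) -> fin_num_fun nu.
Proof.
move=> H A mA; rewrite ge0_fin_numE// (le_lt_trans (H A mA))//.
by rewrite -ge0_fin_numE// nu2_fin.
Qed.

HB.instance Definition _ := @Measure_isFinite.Build _ _ _ nup
  (fin_of (fun A mA => (nu_le mA).1)).
HB.instance Definition _ := @Measure_isFinite.Build _ _ _ num
  (fin_of (fun A mA => (nu_le mA).2)).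

Let dom_of (nu : {measure set (measurableTypeR R) -> \bar R}) :
  (forall A, measurable A -> (nu A <= nu2 A)%E) -> nu `<< mu.
Proof.
move=> H; apply/null_content_dominatesP => A mA A0.
by apply/eqP; rewrite eq_le measure_ge0 andbT -(nu2_null mA A0) H.
Qed.

(** The Stieltjes measures of H + f and H - f, where H is the primitive of h,
    add up to 2 h dx, hence both have densities. *)
Lemma lipschitz_density : exists g : R -> R, [/\ measurable_fun setT g,
  forall t, `|g t| <= h t &
  forall x y, x <= y -> f y - f x = Rintegral mu `]x, y] g].
Proof.
have [gp [gp0 gpf igp gpE]] := radon_nikodym_sigma_finite
  (dom_of (fun A mA => (nu_le mA).1)).
have [gm [gm0 gmf igm gmE]] := radon_nikodym_sigma_finite
  (dom_of (fun A mA => (nu_le mA).2)).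
have mgp := measurable_int _ igp; have mgm := measurable_int _ igm.
have sum_ae : ae_eq mu setT (fun t => (2 * h t)%:E) (gp \+ gm)%E.
  apply: integral_ae_eq => //; [exact: i2h|exact: emeasurable_funD|].
  move=> E _ mE; rewrite integralD//; [|exact: (integrableS measurableT)..].
  by rewrite -gpE// -gmE// nu2E.
pose g (t : R) : R := Num.min (Num.max (fine (gp t) - h t) (- h t)) (h t).
have mh : measurable_fun setT h.
  by apply/measurable_EFinP; exact: (measurable_int mu).
have mg : measurable_fun setT g.
  apply: measurable_minr => //; apply: measurable_maxr; last exact: measurableT_comp.
  by apply: measurable_funB => //; exact: measurableT_comp.
have gh t : `|g t| <= h t.
  rewrite ler_norml /g le_min le_max ge_min lexx !orbT/= andbT.
  by have := h0 t; lra.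
exists g; split => // x y xy.
have gae : ae_eq mu `]x, y]%classic (EFin \o g) (fun t => gp t - (h t)%:E)%E.
  apply: filterS sum_ae => t /(_ I) E _.
  have E' : 2 * h t = fine (gp t) + fine (gm t).
    by apply: EFin_inj; rewrite E EFinD !fineK.
  have gp0' : 0 <= fine (gp t) by apply: fine_ge0.
  have gm0' : 0 <= fine (gm t) by apply: fine_ge0.
  rewrite -[in RHS](fineK (gpf t)) -EFinB /=; congr (_%:E).
  rewrite /g; case: (leP (fine (gp t) - h t)) => ?; case: leP => ?; lra.
have -> : Rintegral mu `]x, y] g = fine (\int[mu]_(t in `]x, y]) (gp t - (h t)%:E))%E.
  congr fine; apply: ae_eq_integral => //.
  - by apply/measurable_EFinP; exact: measurable_funTS.
  - by apply: emeasurable_funB; [exact: measurable_funTS|apply/measurable_EFinP; exact: measurable_funTS].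
rewrite integralB//; [|exact: (integrableS measurableT)..].
rewrite fineB; [|by apply: integrable_fin_num => //; exact: (integrableS measurableT)..].
have -> : fine (\int[mu]_(t in `]x, y]) (h t)%:E)%E = cumul h y - cumul h x by rewrite cumulB.
have -> : (\int[mu]_(t in `]x, y]) gp t)%E = (cumul h y + f y - (cumul h x + f x))%:E.
  by rewrite -gpE//; exact: stieltjes_itvoc.
by rewrite /=; ring.
Qed.

End lipschitz_density.

(** The extension sup_s (f s - |H t - H s|) of McShane, with the distance |H t - H s|
    in place of |t - s|, gives f a Stieltjes measure on the whole line. *)
Lemma mcshane_extension (R : realType) (a b : R) (H f : R -> R) : a < b ->
  {homo H : x y / x <= y} ->
  (forall x y, a < x -> x <= y -> y < b -> `|f y - f x| <= H y - H x) ->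
  exists F : R -> R, (forall t, a < t < b -> F t = f t) /\
    (forall x y, x <= y -> `|F y - F x| <= H y - H x).
Proof.
move=> ab Hm fH.
have fH' x y : a < x < b -> a < y < b -> f x - f y <= `|H x - H y|.
  move=> /andP[ax xb] /andP[ay yb]; have [xy|yx] := leP x y.
    rewrite distrC (le_trans _ (ler_norm _))//.
    by have := fH x y ax xy yb; rewrite ler_norml => /andP[]; lra.
  rewrite (le_trans _ (ler_norm _))//.
  by have := fH y x ay (ltW yx) xb; rewrite ler_norml => /andP[]; lra.
pose A t := [set f s - `|H t - H s| | s in [set s | a < s < b]].
have A0 t : A t !=set0.
  exists (f ((a + b) / 2) - `|H t - H ((a + b) / 2)|), ((a + b) / 2) => //=.
  by apply/andP; split; lra.
have ub t s0 : a < s0 < b -> ubound (A t) (f s0 + `|H t - H s0|).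
  move=> s0ab _ [s /= sab <-]; have := fH' s s0 sab s0ab.
  have : `|H s - H s0| <= `|H t - H s| + `|H t - H s0|.
    have -> : H s - H s0 = (H t - H s0) - (H t - H s) by ring.
    by rewrite (le_trans (ler_normB _ _))// addrC.
  lra.
have m : a < (a + b) / 2 < b by apply/andP; split; lra.
have Au t : has_ubound (A t) by exists (f ((a + b) / 2) + `|H t - H ((a + b) / 2)|); exact: ub.
exists (fun t => sup (A t)); split.
- move=> t tab; apply/eqP; rewrite eq_le; apply/andP; split.
    apply: ge_sup => //; have := ub t t tab.
    by rewrite subrr normr0 addr0.
  apply: sup_upper_bound; first by split.
  by exists t => //; rewrite subrr normr0 subr0.
- have one x y : sup (A x) <= sup (A y) + `|H y - H x|.
    apply: ge_sup => // _ [s /= sab <-].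
    have : f s - `|H y - H s| <= sup (A y) by apply: sup_upper_bound; [split|exists s].
    have : `|H y - H s| <= `|H y - H x| + `|H x - H s|.
      have -> : H y - H s = (H y - H x) + (H x - H s) by ring.
      exact: ler_normD.
    lra.
  move=> x y xy; have := one x y; have := one y x.
  have d0 : 0 <= H y - H x by rewrite subr_ge0 Hm.
  rewrite [`|H x - H y|]distrC ger0_norm// => h1 h2.
  by rewrite ler_norml; lra.
Qed.

(** A function of a real variable whose increments are dominated by an integral is an
    integral. *)
Lemma dominated_density (R : realType) (a b C : R) (h f : R -> R) : a < b -> 0 < C ->
  (forall t, 0 <= h t) -> (@lebesgue_measure R).-integrable setT (EFin \o h) ->
  (forall x y, a < x -> x <= y -> y < b ->
     `|f y - f x| <= C * (cumul h y - cumul h x)) ->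
  exists g : R -> R, [/\ measurable_fun setT g, forall t, `|g t| <= C * h t &
    forall x y, a < x -> x <= y -> y < b ->
      f y - f x = Rintegral (@lebesgue_measure R) `]x, y] g].
Proof.
move=> ab C0 h0 ih fH.
have [F [Ff FH]] := @mcshane_extension _ a b (cumul h) (fun t => C^-1 * f t) ab
  ltac:(move=> ? ? ?; exact: cumul_mono) ltac:(by move=> x y ax xy yb;
    rewrite -mulrBr normrM gtr0_norm ?invr_gt0// ler_pdivrMl//; exact: fH).
have [g [mg gh gE]] := lipschitz_density h0 ih FH.
have ig A : measurable A -> (@lebesgue_measure R).-integrable A (EFin \o g).
  move=> mA; apply: (integrableS measurableT) => //.
  apply: le_integrable ih => //; first exact/measurable_EFinP.
  by move=> t _ /=; rewrite lee_fin (le_trans (gh t))// ler_norm.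
exists (fun t => C * g t); split.
- exact: measurable_funM.
- by move=> t; rewrite normrM gtr0_norm// ler_pM2l.
- move=> x y ax xy yb.
  rewrite RintegralZl ?ig// -gE// !Ff; try by apply/andP; split; lra.
  by rewrite -mulrBr mulrA divff ?gt_eqF// mul1r.
Qed.

(** * Integration by parts against test functions *)

Lemma Rintegral_derive (R : realType) (f f' : R -> R) (u v : R) : u <= v ->
  (forall t : R, is_derive t 1 f (f' t)) -> continuous f' ->
  Rintegral (@lebesgue_measure R) `]u, v] f' = f v - f u.
Proof.
rewrite le_eqVlt => /predU1P[->|uv] df cf.
  by rewrite set_itvoc0 Rintegral_set0 subrr.
rewrite /Rintegral integral_itv_obnd_cbnd.
  have -> : (\int[@lebesgue_measure R]_(t in `[u, v]) (f' t)%:E = (f v - f u)%:E)%E.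
    apply: (@FTC_derive _ (u - 1) (v + 1)) => //; try lra.
    by move=> t _; exact: cf.
  by [].
by apply/measurable_EFinP; apply: measurable_funTS; exact: continuous_measurable_fun.
Qed.

Section real_integrable.
Context (R : realType).
Local Notation mu := (@lebesgue_measure R).
Implicit Types (D : set R) (f g : R -> R).

Lemma integrable_fctD D f g : measurable D -> mu.-integrable D (EFin \o f) ->
  mu.-integrable D (EFin \o g) -> mu.-integrable D (EFin \o (fun t => f t + g t)).
Proof.
move=> mD fi gi; apply: eq_integrable (integrableD _ fi gi) => //.
Qed.

Lemma integrable_fctB D f g : measurable D -> mu.-integrable D (EFin \o f) ->
  mu.-integrable D (EFin \o g) -> mu.-integrable D (EFin \o (fun t => f t - g t)).
Proof.
move=> mD fi gi; apply: eq_integrable (integrableB _ fi gi) => //.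
Qed.

Lemma integrable_fctZ D f (k : R) : measurable D -> mu.-integrable D (EFin \o f) ->
  mu.-integrable D (EFin \o (fun t => k * f t)).
Proof.
move=> mD fi; apply: eq_integrable (integrableZl _ k fi) => //.
Qed.

Lemma integrable_abs D f : measurable D -> mu.-integrable D (EFin \o f) ->
  mu.-integrable D (EFin \o (fun t => `|f t|)).
Proof.
move=> mD fi; apply: eq_integrable (integrable_abse fi) => //.
Qed.

Lemma integrable_continuous (u v : R) f : continuous f ->
  mu.-integrable `]u, v] (EFin \o f).
Proof.
move=> cf; have : mu.-integrable `[u, v] (EFin \o f).
  apply: continuous_compact_integrable; first exact: segment_compact.
  exact: continuous_subspaceT.
by apply: integrableS => //; exact: subset_itv_oc_cc.
Qed.

Lemma Rintegral_itvoc_cst (u v k : R) : u <= v ->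
  Rintegral mu `]u, v] (fun=> k) = k * (v - u).
Proof.
move=> uv; rewrite Rintegral_cst// -[v - u]/(fine (v - u)%:E); congr (_ * fine _).
rewrite [LHS]lebesgue_measure_itv/= lte_fin; case: ltP => // vu.
by have -> : v = u by [apply/eqP; rewrite eq_le vu]; rewrite subrr.
Qed.

End real_integrable.

Section integration_by_parts.
Context (R : realType).
Local Notation mu := (@lebesgue_measure R).
Variables (g phi phi' : R -> R) (c B : R).
Hypothesis ig : mu.-integrable setT (EFin \o g).
Hypothesis dphi : forall t : R, is_derive t 1 phi (phi' t).
Hypothesis cphi' : continuous phi'.
Hypothesis phiB : forall t, `|phi t| <= B.
Hypothesis phi'B : forall t, `|phi' t| <= B.

Let G t := c + Rintegral mu `]-oo, t] g.

Let absg t := `|g t|.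
Let iabsg : mu.-integrable setT (EFin \o absg).
Proof. exact: integrable_abs. Qed.
Let absg0 t : 0 <= absg t. Proof. exact: normr_ge0. Qed.
Local Notation H := (cumul absg).

Let igS A : measurable A -> mu.-integrable A (EFin \o g).
Proof. by move=> mA; exact: (integrableS measurableT). Qed.

Let GB x y : x <= y -> G y - G x = Rintegral mu `]x, y] g.
Proof.
move=> xy; rewrite -(@Rintegral_itvB _ g (BInfty _ true) (BRight y) x)//.
  by rewrite /G; ring.
exact: igS.
Qed.

Let GH x y : x <= y -> `|G y - G x| <= H y - H x.
Proof.
move=> xy; rewrite GB// cumulB//.
by apply: le_normr_Rintegral => //; exact: igS.
Qed.

Let cG : continuous G.
Proof.
move=> x; apply/cvgrPdist_lt => e e0.
have [d d0 Hd] := cumul_uniform absg0 iabsg e0.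
apply/nbhs_ballP; exists d => // t; rewrite /ball/= ltr_norml => /andP[t1 t2].
have [xt|tx] := leP x t.
  by rewrite distrC (le_lt_trans (GH xt))// Hd//; lra.
by rewrite (le_lt_trans (GH (ltW tx)))// Hd ?(ltW tx)//; lra.
Qed.

Let cphi : continuous phi.
Proof. by move=> t; exact: is_derive_cont (dphi t). Qed.

Let igM u v (k : R -> R) K : continuous k -> (forall t, `|k t| <= K) ->
  mu.-integrable `]u, v] (EFin \o (fun t => g t * k t)).
Proof.
move=> ck kK; have K0 : 0 <= K := le_trans (normr_ge0 _) (kK 0).
have iK := integrable_fctZ K measurableT iabsg.
apply: (integrableS measurableT) => //; apply: le_integrable iK => //.
  apply/measurable_EFinP; apply: measurable_funM; last exact: continuous_measurable_fun.
  by apply/measurable_EFinP; exact: (measurable_int mu).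
move=> t _ /=; rewrite lee_fin !normrM normr_id mulrC ler_wpM2r//.
by rewrite (ger0_norm K0).
Qed.

Let F t := g t * phi t + G t * phi' t.

Let iG u v : mu.-integrable `]u, v] (EFin \o (fun t => G t * phi' t)).
Proof.
by apply: integrable_continuous => t; apply: continuousM; [exact: cG|exact: cphi'].
Qed.

Let iF u v : mu.-integrable `]u, v] (EFin \o F).
Proof.
by apply: integrable_fctD => //; exact: igM cphi phiB.
Qed.

Let local_ibp t e : 0 < e -> exists2 d, 0 < d & forall u v, u <= t -> t <= v ->
  t - d < u -> v < t + d ->
  `|G v * phi v - G u * phi u - Rintegral mu `]u, v] F| <=
    e * ((H v - H u) + 2 * B * (v - u)).
Proof.
move=> e0; have [d1 d10 H1] := continuous_eps (@cphi t) e0.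
have [d2 d20 H2] := continuous_eps (@cG t) e0.
exists (Num.min d1 d2); first by rewrite lt_min d10.
move=> u v ut tv tu vt; have uv := le_trans ut tv.
have near s : u <= s <= v -> `|phi s - phi t| <= e /\ `|G s - G t| <= e.
  move=> /andP[us sv]; have : `|s - t| < Num.min d1 d2 by rewrite ltr_norml; lra.
  by rewrite lt_min => /andP[/H1/ltW s1 /H2/ltW s2].
have B0 : 0 <= B := le_trans (normr_ge0 _) (phiB 0).
have phiL x y : x <= y -> `|phi y - phi x| <= B * (y - x).
  move=> xy; rewrite -(Rintegral_derive xy dphi cphi').
  rewrite (le_trans (le_normr_Rintegral _ _))//; first exact: integrable_continuous.
  rewrite -(Rintegral_itvoc_cst B xy).
  apply: le_Rintegral => //; apply: integrable_continuous => s.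
    by apply: cvg_norm; exact: cphi'.
  exact: cst_continuous.
pose E s := g s * (phi s - phi t) + (G s - G t) * phi' s.
have i1 : mu.-integrable `]u, v] (EFin \o (fun s => phi t * g s)).
  by apply: integrable_fctZ => //; exact: igS.
have i2 : mu.-integrable `]u, v] (EFin \o (fun s => G t * phi' s)).
  by apply: integrable_continuous => s; apply: cvgM; [exact: cvg_cst|exact: cphi'].
have i3 := integrable_fctD (measurable_itv `]u, v]) i1 i2.
have EE : Rintegral mu `]u, v] E =
    Rintegral mu `]u, v] F - (phi t * (G v - G u) + G t * (phi v - phi u)).
  rewrite GB// -(Rintegral_derive uv dphi cphi').
  rewrite -!RintegralZl//; [|exact: integrable_continuous|exact: igS].
  rewrite -RintegralD// -RintegralB//; apply: eq_Rintegral => s _.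
  by rewrite /E /F; ring.
have iE : mu.-integrable `]u, v] (EFin \o E).
  have := integrable_fctB (measurable_itv `]u, v]) (iF u v) i3.
  by apply: eq_integrable => // s _ /=; congr _%:E; rewrite /E /F; ring.
have i4 : mu.-integrable `]u, v] (EFin \o (fun s => e * absg s)).
  by apply: integrable_fctZ => //; exact: (integrableS measurableT).
have i5 : mu.-integrable `]u, v] (EFin \o (fun=> e * B)).
  by apply: integrable_continuous => s; exact: cst_continuous.
have bE : `|Rintegral mu `]u, v] E| <= e * (H v - H u) + e * B * (v - u).
  rewrite (le_trans (le_normr_Rintegral _ _))//.
  have -> : e * (H v - H u) + e * B * (v - u) =
      Rintegral mu `]u, v] (fun s => e * absg s + e * B).
    rewrite RintegralD// Rintegral_itvoc_cst//.
    rewrite RintegralZl//; last exact: (integrableS measurableT).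
    by rewrite cumulB.
  apply: le_Rintegral => //; [exact: integrable_abs|exact: integrable_fctD|].
  move=> s; rewrite /= in_itv/= => /andP[us sv].
  have [n1 n2] := near s ltac:(by rewrite (ltW us)).
  rewrite /E (le_trans (ler_normD _ _))// !normrM lerD//.
    by rewrite mulrC ler_wpM2r.
  by apply: ler_pM.
have [v1 v2] := near v ltac:(by rewrite uv lexx).
have [u1 u2] := near u ltac:(by rewrite uv lexx).
apply: (@le_trans _ _ `|(G v - G t) * (phi v - phi t) - (G u - G t) * (phi u - phi t) -
    Rintegral mu `]u, v] E|).
  by rewrite EE le_eqVlt; apply/orP; left; apply/eqP; congr `|_|; ring.
rewrite (le_trans (ler_normB _ _))//.
have b1 : `|(G v - G t) * (phi v - phi t)| <= e * (B * (v - t)).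
  by rewrite normrM ler_pM// phiL.
have b2 : `|(G u - G t) * (phi u - phi t)| <= e * (B * (t - u)).
  by rewrite normrM ler_pM// distrC phiL.
have b3 := ler_normB ((G v - G t) * (phi v - phi t)) ((G u - G t) * (phi u - phi t)).
have -> : e * (H v - H u + 2 * B * (v - u)) =
  (e * (B * (v - t)) + e * (B * (t - u))) + (e * (H v - H u) + e * B * (v - u)) by ring.
by rewrite lerD// (le_trans b3)// lerD.
Qed.

(** The product is compared with the integral on short intervals, where g phi
    and G phi' may be replaced by phi(t) g and G(t) phi'. *)
Lemma integration_by_parts x y : x <= y ->
  Rintegral mu `]x, y] (fun t => g t * phi t) =
  G y * phi y - G x * phi x - Rintegral mu `]x, y] (fun t => G t * phi' t).
Proof.
move=> xy; apply/eqP; rewrite eq_sym subr_eq -RintegralD//; last exact: igM cphi phiB.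
rewrite -subr_eq0 -normr_le0 -/F.
pose K := (H y - H x) + 2 * B * (y - x).
have B0 : 0 <= B := le_trans (normr_ge0 _) (phiB 0).
have K0 : 0 <= K.
  by rewrite addr_ge0 ?subr_ge0 ?cumul_mono// !mulr_ge0 ?subr_ge0.
suff bound e : 0 < e -> `|G y * phi y - G x * phi x - Rintegral mu `]x, y] F| <= e * K.
  apply/ler_addgt0Pr => e e0; rewrite add0r.
  have K1 : 0 < K + 1 by lra.
  apply: (le_trans (bound _ (divr_gt0 e0 K1))).
  by rewrite mulrAC ler_pdivrMr// ler_wpM2l ?ltW//; lra.
move=> e0; pose P u v := `|G v * phi v - G u * phi u - Rintegral mu `]u, v] F| <=
  e * ((H v - H u) + 2 * B * (v - u)).
apply: (@cousin _ P) => //.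
- move=> u v w uv vw; rewrite /P => h1 h2.
  have -> : Rintegral mu `]u, w] F = Rintegral mu `]u, v] F + Rintegral mu `]v, w] F.
    by rewrite -(@Rintegral_itvB _ F (BRight u) (BRight w) v)//; ring.
  have -> : G w * phi w - G u * phi u - (Rintegral mu `]u, v] F + Rintegral mu `]v, w] F) =
    (G v * phi v - G u * phi u - Rintegral mu `]u, v] F) +
    (G w * phi w - G v * phi v - Rintegral mu `]v, w] F) by ring.
  by rewrite (le_trans (ler_normD _ _))// (le_trans (lerD h1 h2))//; lra.
- move=> t txy; have [d d0 Hd] := local_ibp t e0.
  by exists d => // u v _ ut tv _ tu vt; exact: Hd.
Qed.

End integration_by_parts.

(** All that the integration by parts needs of a test function: it is of class C^1,
    bounded with its derivative, and lives on a compact subinterval. *)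
Lemma test_functionP (R : realType) (a b : R) (phi : R -> R) : a < b ->
  test_function a b phi ->
  exists x y B : R, [/\ [/\ a < x, x < y & y < b],
    (forall t : R, is_derive t 1 phi (derive1 phi t)), continuous (derive1 phi),
    (forall t, ~~ (x < t < y) -> phi t = 0 /\ derive1 phi t = 0) &
    forall t, `|phi t| <= B /\ `|derive1 phi t| <= B].
Proof.
move=> ab [dphi [K [cK KI K0]]].
have d0 t : derivable phi t 1 := dphi 0%N t.
have d1 t : derivable (derive1 phi) t 1 := dphi 1%N t.
have isd t : is_derive t (1 : R) phi (derive1 phi t) by apply: DeriveDef => //; rewrite derive1E.
have cont (f : R -> R) (t : R) : derivable f t 1 -> {for t, continuous f}.
  by move=> df; apply/differentiable_continuous/derivable1_diffP.
have c1 : continuous (derive1 phi) by move=> t; exact: cont (d1 t).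
have c0 : continuous phi by move=> t; exact: cont (d0 t).
have [x [y [ax xy yb Kxy]]] : exists x y, [/\ a < x, x < y, y < b & K `<=` `]x, y[].
  have [/set0P K1|/negPn/eqP ->] := boolP (K != set0); last first.
    by exists (a + (b - a) / 3), (a + (b - a) / 3 * 2); split => //; lra.
  have cid : {within K, continuous (@idfun R)} by apply: continuous_subspaceT => ?; exact: cvg_id.
  have [M /set_mem KM HM] := compact_EVT_max K1 cK cid.
  have [m /set_mem Km Hm] := compact_EVT_min K1 cK cid.
  have /= := KI _ KM; have /= := KI _ Km; rewrite !in_itv/= => /andP[am mb] /andP[aM Mb].
  have mM : m <= M by apply: Hm; rewrite inE.
  exists ((a + m) / 2), ((b + M) / 2); split; [lra|lra|lra|] => t Kt /=.
  have := Hm t (mem_set Kt); have := HM t (mem_set Kt); rewrite /= in_itv/= => h1 h2.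
  by apply/andP; split; lra.
exists x, y.
have out t : ~~ (x < t < y) -> phi t = 0.
  by move=> h; apply: K0 => /Kxy /=; rewrite in_itv/= (negbTE h).
have small (l : R) : (forall eta, 0 < eta -> `|l| <= eta) -> l = 0.
  move=> h; apply/eqP; rewrite -normr_le0; apply/ler_addgt0Pr => e e0.
  by rewrite add0r h.
have out1 t : ~~ (x < t < y) -> derive1 phi t = 0.
  move=> h; apply: small => eta eta0.
  have [d dd0 Hd] := derive_strict (isd t) eta0.
  pose s := if t <= x then t - d / 2 else t + d / 2.
  have ps : phi s = 0.
    apply: out; apply/negP => /andP[xs sy]; move: h; rewrite /s in xs sy.
    by case: (leP t x) xs sy => tx xs sy; [lra|rewrite -leNgt; lra].
  have st : `|s - t| = d / 2.
    rewrite /s; case: leP => _; last by rewrite addrC addKr gtr0_norm ?divr_gt0.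
    by rewrite addrC addKr normrN gtr0_norm ?divr_gt0.
  have := Hd s; rewrite st => /(_ ltac:(lra)).
  rewrite ps out// subrr sub0r normrN normrM st ler_pM2r// divr_gt0//.
have bnd (f : R -> R) : continuous f -> (forall t, ~~ (x < t < y) -> f t = 0) ->
    exists2 B, 0 <= B & forall t, `|f t| <= B.
  move=> cf f0; have cn : {within `[x, y], continuous (fun t => `|f t|)}.
    by apply: continuous_subspaceT => t; apply: cvg_norm; exact: cf.
  have [c _ Hc] := EVT_max (ltW xy) cn.
  exists `|f c| => // t; have [xty|h] := boolP (x < t < y).
    by apply: Hc; rewrite in_itv/=; case/andP: xty => /ltW -> /ltW ->.
  by rewrite f0// normr0.
have [B B0 HB] := bnd _ c0 out; have [B' B'0 HB'] := bnd _ c1 out1.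
exists (B + B'); split => //.
- by move=> t h; split; [exact: out|exact: out1].
- by move=> t; have := HB t; have := HB' t; split; lra.
Qed.

(** The boundary terms vanish because the support of the test function is inside. *)
Lemma density_weak_derivative (R : realType) (a b : R) (f g phi : R -> R) : a < b ->
  (@lebesgue_measure R).-integrable setT (EFin \o g) ->
  (forall x y, a < x -> x <= y -> y < b ->
     f y - f x = Rintegral (@lebesgue_measure R) `]x, y] g) ->
  test_function a b phi ->
  - Rintegral (@lebesgue_measure R) `]a, b[ (fun t => f t * derive1 phi t) =
  Rintegral (@lebesgue_measure R) `]a, b[ (fun t => g t * phi t).
Proof.
move=> ab ig fg tphi.
have [x [y [B [[ax xy yb] dphi cphi' out phiB]]]] := test_functionP ab tphi.
have supp (k : R -> R) : (forall t, ~~ (x < t < y) -> k t = 0) ->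
    Rintegral (@lebesgue_measure R) `]a, b[ k = Rintegral (@lebesgue_measure R) `]x, y] k.
  move=> k0; rewrite Rintegral_mkcond [RHS]Rintegral_mkcond; congr Rintegral.
  apply/funext => t; rewrite !patchE !mem_setE !in_itv/=.
  have [xty|/k0 ->] := boolP (x < t < y); last by case: ifP; case: ifP.
  case/andP: xty => xt ty; rewrite xt (ltW ty) /= ifT//.
  by apply/andP; split; lra.
rewrite supp; last by move=> t /out[_ ->]; rewrite mulr0.
rewrite supp; last by move=> t /out[-> _]; rewrite mulr0.
pose c := f x - Rintegral (@lebesgue_measure R) `]-oo, x] g.
have igS A : measurable A -> (@lebesgue_measure R).-integrable A (EFin \o g).
  by move=> mA; exact: (integrableS measurableT).
rewrite (integration_by_parts c ig dphi cphi' (fun t => (phiB t).1) (fun t => (phiB t).2) (ltW xy)).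
have [-> _] : phi x = 0 /\ derive1 phi x = 0 by apply: out; rewrite ltxx.
have [-> _] : phi y = 0 /\ derive1 phi y = 0 by apply: out; rewrite ltxx andbF.
rewrite !mulr0 subrr sub0r; congr (- _); apply: eq_Rintegral => t.
rewrite mem_setE in_itv/= => /andP[xt ty].
have := @Rintegral_itvB _ g (BInfty _ true) (BRight t) x (igS _ _) => /(_ _ isT _).
rewrite -fg ?(ltW xt)//; last by lra.
move=> /(_ ltac:(done) ltac:(by rewrite bnd_simp ltW)) E.
by rewrite -[in LHS](subrK (f x) (f t)) -E /c; ring.
Qed.

(** * Lebesgue and weak Lebesgue bounds *)

Section complex_density.
Context (R : realType) (a b C : R) (h : R -> R) (lam : R -> R[i]).
Local Notation mu := (@lebesgue_measure R).
Hypothesis ab : a < b.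
Hypothesis C0 : 0 < C.
Hypothesis h0 : forall t, 0 <= h t.
Hypothesis ih : mu.-integrable setT (EFin \o h).
Hypothesis lamh : forall x y, a < x -> x <= y -> y < b ->
  normc (lam y - lam x) <= C * (cumul h y - cumul h x).

(** Real and imaginary parts are treated separately, whence the factor 2. *)
Lemma complex_weak_derivative : exists g : R -> R[i],
  [/\ represents a b g (distr_deriv a b lam), cmeasurable `]a, b[ g &
    forall t, normc (g t) <= 2 * C * h t].
Proof.
have [g1 [m1 g1h g1E]] : exists g1 : R -> R, [/\ measurable_fun setT g1,
    forall t, `|g1 t| <= C * h t & forall x y, a < x -> x <= y -> y < b ->
      reF lam y - reF lam x = Rintegral mu `]x, y] g1].
  apply: (dominated_density ab C0 h0 ih) => x y ax xy yb.
  apply: le_trans (lamh ax xy yb); apply: le_trans (Re_le_normc _).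
  by rewrite /reF; case: (lam x) => ? ?; case: (lam y).
have [g2 [m2 g2h g2E]] : exists g2 : R -> R, [/\ measurable_fun setT g2,
    forall t, `|g2 t| <= C * h t & forall x y, a < x -> x <= y -> y < b ->
      imF lam y - imF lam x = Rintegral mu `]x, y] g2].
  apply: (dominated_density ab C0 h0 ih) => x y ax xy yb.
  apply: le_trans (lamh ax xy yb); apply: le_trans (Im_le_normc _).
  by rewrite /imF; case: (lam x) => ? ?; case: (lam y).
have int (k : R -> R) : measurable_fun setT k -> (forall t, `|k t| <= C * h t) ->
    mu.-integrable setT (EFin \o k).
  move=> mk kh; have iCh := integrable_fctZ C measurableT ih.
  apply: le_integrable iCh => //; first exact/measurable_EFinP.
  by move=> t _ /=; rewrite lee_fin (le_trans (kh t))// ler_norm.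
have i1 := int _ m1 g1h; have i2 := int _ m2 g2h.
have loc (k : R -> R) : mu.-integrable setT (EFin \o k) -> locally_integrable `]a, b[ k.
  move=> ik; apply: open_integrable_locally; first exact: interval_open.
  exact: (integrableS measurableT).
exists (fun t => g1 t +i* g2 t); split.
- split; [exact: loc|exact: loc|] => phi tphi.
  rewrite /distr_deriv /distr_of /cintegral.
  have reM (z : R -> R[i]) (r : R -> R) : reF (fun t => z t * (r t)%:C) = (fun t => reF z t * r t).
    by apply/funext => t; rewrite /reF; case: (z t) => u v /=; rewrite mulr0 subr0.
  have imM (z : R -> R[i]) (r : R -> R) : imF (fun t => z t * (r t)%:C) = (fun t => imF z t * r t).
    by apply/funext => t; rewrite /imF; case: (z t) => u v /=; rewrite mulr0 add0r.
  rewrite !reM !imM; apply/eqP; rewrite eq_complex /=; apply/andP; split; apply/eqP.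
    exact: density_weak_derivative i1 g1E tphi.
  exact: density_weak_derivative i2 g2E tphi.
- by split; exact: measurable_funTS.
- move=> t; have := normc_le_add (g1 t +i* g2 t); move=> /le_trans; apply => /=.
  by have := g1h t; have := g2h t; lra.
Qed.

End complex_density.

Lemma normc_measurable (R : realType) (D : set R) (g : R -> R[i]) :
  cmeasurable D g -> measurable_fun D (fun t => normc (g t)).
Proof.
move=> [mr mi].
have -> : (fun t => normc (g t)) = (fun t => Num.sqrt (reF g t ^+ 2 + imF g t ^+ 2)).
  by apply/funext => t; rewrite /reF /imF; case: (g t).
apply: (@measurableT_comp _ _ _ _ _ _ (@Num.sqrt R)).
  exact: continuous_measurable_fun (@sqrt_continuous R).
by apply: measurable_funD; exact: measurable_funX.
Qed.

Lemma itvoo_finite (R : realType) (a b : R) :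
  (@lebesgue_measure R `]a, b[ < +oo)%E.
Proof. by rewrite lebesgue_measure_itv/=; case: ifP => _; rewrite -?EFinB ltry. Qed.

Section integral_bounds.
Context (R : realType) (a b p K : R) (h : R -> R) (g : R -> R[i]).
Local Notation mu := (@lebesgue_measure R).
Hypothesis p1 : 1 <= p.
Hypothesis h0 : forall t, 0 <= h t.
Hypothesis mh : measurable_fun `]a, b[ h.
Hypothesis hK : (\int[mu]_(t in `]a, b[) (h t `^ p)%:E <= K%:E)%E.
Hypothesis mg : cmeasurable `]a, b[ g.
Hypothesis gh : forall t, normc (g t) <= h t.

Let mhp : measurable_fun `]a, b[ (fun t => (h t `^ p)%:E).
Proof. by apply/measurable_EFinP; exact: (measurableT_comp (measurable_powR p)). Qed.

(** Chebyshev's inequality. *)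
Lemma weakL_norm_le : (weakL_norm p a b g <= (K `^ p^-1)%:E)%E.
Proof.
have p0 : 0 < p by exact: lt_le_trans p1.
apply: ge_ereal_sup => _ [r /= r0 <-].
set A := `]a, b[ `&` _.
have mA : measurable A.
  have -> : A = `]a, b[ `&` (fun t => normc (g t)) @^-1` `]r, +oo[.
    by apply/seteqP; split => t /= [h1 h2]; split => //; move: h2; rewrite in_itv/= ?andbT.
  exact: normc_measurable.
have K0 : 0 <= K.
  by rewrite -lee_fin; apply: le_trans hK; apply: integral_ge0 => t _; rewrite lee_fin powR_ge0.
have [->|rn0] := eqVneq r 0; first by rewrite mul0e lee_fin powR_ge0.
have rp : 0 < r by rewrite lt_neqAle eq_sym rn0.
have rpp : 0 < r `^ p by exact: powR_gt0.
have cheb : ((r `^ p)%:E * mu A <= K%:E)%E.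
  rewrite -(integral_cst mu mA); apply: le_trans hK.
  apply: (@le_trans _ _ (\int[mu]_(t in A) (h t `^ p)%:E)%E).
    apply: ge0_le_integral => //.
    - by move=> t _; rewrite lee_fin ltW.
    - by apply: measurable_funS mhp => //; exact: subIsetl.
    move=> t [_ /= rt]; rewrite lee_fin ge0_ler_powR ?nnegrE ?(ltW p0)//.
    by rewrite ltW// (lt_le_trans rt).
  apply: ge0_subset_integral => //; last exact: subIsetl.
  by move=> t _; rewrite lee_fin powR_ge0.
have m0 : (0 <= mu A)%E by exact: measure_ge0.
case: (mu A) cheb m0 => [m| |] cheb m0 //; last first.
  by move: cheb; rewrite gt0_muley ?lte_fin// leye_eq.
rewrite poweR_EFin -EFinM lee_fin; rewrite -EFinM lee_fin in cheb; rewrite lee_fin in m0.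
have -> : r * m `^ p^-1 = (r `^ p * m) `^ p^-1.
  by rewrite powRM ?powR_ge0// -powRrM divff ?gt_eqF// powRr1// ltW.
by rewrite ge0_ler_powR ?nnegrE ?invr_ge0 ?(ltW p0)// mulr_ge0// powR_ge0.
Qed.

Lemma weakL_density : weakL p a b g.
Proof. by split => //; exact: le_lt_trans weakL_norm_le (ltry _). Qed.

(** On a bounded interval |g|^q <= 1 + h^p is integrable. *)
Lemma Lq_density q : 0 <= q -> q <= p -> Lq q a b g.
Proof.
move=> q0 qp; split => //.
have p0 : 0 < p by exact: lt_le_trans p1.
apply: (@le_lt_trans _ _ (\int[mu]_(t in `]a, b[) ((1%:E + (h t `^ p)%:E)))%E).
  apply: ge0_le_integral => //.
  - by move=> t _; rewrite lee_fin powR_ge0.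
  - by apply/measurable_EFinP; apply: (measurableT_comp (measurable_powR q)); exact: normc_measurable.
  - by apply: emeasurable_funD.
  move=> t _; rewrite -EFinD lee_fin.
  have n0 := normc_ge0 (g t).
  have [n1|n1] := leP (normc (g t)) 1.
    apply: (@le_trans _ _ 1); last by rewrite lerDl powR_ge0.
    have -> : 1 = 1 `^ q :> R by rewrite powR1.
    by rewrite ge0_ler_powR ?nnegrE.
  apply: (@le_trans _ _ (normc (g t) `^ p)).
    by rewrite ler_powR// ltW.
  apply: (@le_trans _ _ (h t `^ p)); last by rewrite lerDr.
  by rewrite ge0_ler_powR ?nnegrE ?(ltW p0)// (le_trans _ (gh t)).
rewrite ge0_integralD//; last by move=> t _; rewrite lee_fin powR_ge0.
apply: lte_add_pinfty; last exact: le_lt_trans hK (ltry _).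
by rewrite integral_cst// mul1e; exact: itvoo_finite.
Qed.

End integral_bounds.

Lemma Lq_bounded (R : realType) (q a b B : R) (f : R -> R[i]) : 0 <= q ->
  cmeasurable `]a, b[ f -> (forall t, a < t < b -> normc (f t) <= B) -> Lq q a b f.
Proof.
move=> q0 mf fB; split => //.
apply: (@le_lt_trans _ _ (\int[@lebesgue_measure R]_(t in `]a, b[) (B `^ q)%:E)%E).
  apply: ge0_le_integral => //.
  - by move=> t _; rewrite lee_fin powR_ge0.
  - by apply/measurable_EFinP; apply: (measurableT_comp (measurable_powR q)); exact: normc_measurable.
  move=> t /=; rewrite in_itv/= => tab; rewrite lee_fin.
  have n0 := normc_ge0 (f t); have n1 := fB t tab.
  by rewrite ge0_ler_powR ?nnegrE// (le_trans n0).
rewrite integral_cst//; apply: lte_mul_pinfty; last exact: itvoo_finite.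
- by rewrite lee_fin powR_ge0.
- by [].
Qed.

(** * The weak derivative of a root *)

Lemma pow65_add (R : realType) (x y : R) : 0 <= x -> 0 <= y ->
  (x + y) `^ (6 / 5) <= 2 `^ (6 / 5) * (x `^ (6 / 5) + y `^ (6 / 5)).
Proof.
move=> x0 y0; have p0 : (0 : R) <= 6 / 5 by lra.
have key u v : 0 <= u -> u <= v ->
    (u + v) `^ (6 / 5) <= 2 `^ (6 / 5) * (u `^ (6 / 5) + v `^ (6 / 5)).
  move=> u0 uv; have v0 := le_trans u0 uv.
  apply: (@le_trans _ _ ((2 * v) `^ (6 / 5))).
    by rewrite ge0_ler_powR ?nnegrE//; lra.
  by rewrite powRM// ler_wpM2l ?powR_ge0// lerDr powR_ge0.
have [xy|yx] := leP x y; first exact: key.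
rewrite [x + y]addrC [x `^ _ + _]addrC; apply: key => //; exact: ltW.
Qed.

Section total_density.
Context (R : realType) (a b M : R) (d : cubic_data a b M).
Local Notation mu := (@lebesgue_measure R).
Hypotheses (ab : a < b) (M1 : 1 <= M).

(** The density of the roots of the reduced cubic, plus a constant that dominates the
    derivative of the barycenter by which the roots are shifted. *)
Definition tdens (t : R) : R := if a < t < b then hdens d 0 t + M else 0.

Lemma tdens_ge0 t : 0 <= tdens t.
Proof. by rewrite /tdens; case: ifP => // _; have := hdens_ge0 d 0 t; have := M1; lra. Qed.

Lemma tdensE t : a < t < b -> tdens t = hdens d 0 t + M.
Proof. by rewrite /tdens => ->. Qed.

Let mhM : measurable_fun `]a, b[ (fun t => hdens d 0 t + M).
Proof. by apply: measurable_funD => //; exact: measurable_hdens. Qed.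

Lemma measurable_tdens : measurable_fun `]a, b[ tdens.
Proof.
apply: eq_measurable_fun mhM => t; rewrite mem_setE in_itv/= => tab.
by rewrite tdensE.
Qed.

Lemma tdens_integral K :
  (\int[mu]_(t in `]a, b[) (hdens d 0 t `^ (6 / 5))%:E <= K%:E)%E ->
  (\int[mu]_(t in `]a, b[) (tdens t `^ (6 / 5))%:E <=
    (2 `^ (6 / 5) * (K + M `^ (6 / 5) * (b - a)))%:E)%E.
Proof.
move=> HK.
have mp : measurable_fun `]a, b[ (fun t => (hdens d 0 t `^ (6 / 5))%:E).
  apply/measurable_EFinP; apply: (measurableT_comp (measurable_powR _)).
  exact: measurable_hdens.
apply: (@le_trans _ _ (\int[mu]_(t in `]a, b[)
  ((2 `^ (6 / 5))%:E * ((hdens d 0 t `^ (6 / 5))%:E + (M `^ (6 / 5))%:E)))%E).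
  apply: ge0_le_integral => //.
  - by move=> t _; rewrite lee_fin powR_ge0.
  - apply/measurable_EFinP; apply: (measurableT_comp (measurable_powR _)).
    exact: measurable_tdens.
  - by apply: emeasurable_funM => //; exact: emeasurable_funD.
  move=> t /=; rewrite in_itv/= => tab; rewrite tdensE// -EFinD -EFinM lee_fin.
  by apply: pow65_add; [exact: hdens_ge0|have := M1; lra].
rewrite ge0_integralZl//; last 2 first.
- exact: emeasurable_funD.
- by move=> t _; rewrite -EFinD lee_fin addr_ge0// powR_ge0.
rewrite EFinM; apply: lee_pmul => //.
- by apply: integral_ge0 => t _; rewrite -EFinD lee_fin addr_ge0// powR_ge0.
rewrite ge0_integralD//; last 2 first.
- by move=> t _; rewrite lee_fin powR_ge0.
- by move=> t _; rewrite lee_fin powR_ge0.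
rewrite EFinD; apply: leeD => //.
have len : mu `]a, b[ = (b - a)%:E by rewrite lebesgue_measure_itv/= lte_fin ab.
by rewrite integral_cst// [X in (_ * X)%E]len.
Qed.

Lemma tdens_integrable K :
  (\int[mu]_(t in `]a, b[) (tdens t `^ (6 / 5))%:E <= K%:E)%E ->
  mu.-integrable setT (EFin \o tdens).
Proof.
move=> HK; have mt := measurable_tdens.
have mp : measurable_fun `]a, b[ (fun t => (tdens t `^ (6 / 5))%:E).
  by apply/measurable_EFinP; exact: (measurableT_comp (measurable_powR _)).
have iD : mu.-integrable `]a, b[ (EFin \o tdens).
  apply/integrableP; split; first exact/measurable_EFinP.
  apply: (@le_lt_trans _ _ (\int[mu]_(t in `]a, b[) (1%:E + (tdens t `^ (6 / 5))%:E))%E).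
    apply: ge0_le_integral => //.
    - by apply/measurable_EFinP; exact: measurableT_comp.
    - exact: emeasurable_funD.
    move=> t _ /=; rewrite -EFinD lee_fin ger0_norm ?tdens_ge0//.
    have t0 := tdens_ge0 t; have p0 := powR_ge0 (tdens t) (6 / 5).
    have [t1|t1] := leP (tdens t) 1; first lra.
    have : tdens t `^ 1 <= tdens t `^ (6 / 5) by rewrite ler_powR// ?(ltW t1)//; lra.
    by rewrite powRr1//; lra.
  rewrite ge0_integralD//; last by move=> t _; rewrite lee_fin powR_ge0.
  apply: lte_add_pinfty; last exact: le_lt_trans HK (ltry _).
  by rewrite integral_cst// mul1e; exact: itvoo_finite.
have mD : measurable (`]a, b[%classic : set (measurableTypeR R)) by [].
have := (@integrable_mkcond _ _ _ mu _ (EFin \o tdens) mD).1 iD.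
apply: eq_integrable => // t _ /=.
by rewrite patchE mem_setE in_itv/= /tdens; case: (a < t < b).
Qed.

End total_density.

Lemma ccont_parts (R : realType) (f : R -> R[i]) t : ccont f t ->
  {for t, continuous (reF f)} /\ {for t, continuous (imF f)}.
Proof.
move=> cf; split; apply/cvgrPdist_lt => e e0; have [d d0 Hd] := cf e e0;
  apply/nbhs_ballP; exists d => // s; rewrite /ball/= distrC => /Hd;
  apply: le_lt_trans; rewrite distrC.
- by apply: le_trans (Re_le_normc _); rewrite /reF; case: (f s) => ? ?; case: (f t).
- by apply: le_trans (Im_le_normc _); rewrite /imF; case: (f s) => ? ?; case: (f t).
Qed.

(** The density tdens dominates the increments of the root, and its bound in L^(6/5)
    does not depend on the root. *)
Lemma root_weak_derivative (R : realType) (a b M : R) : a < b -> 1 <= M ->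
  exists K : R, forall (d : cubic_data a b M) (lam s : R -> R[i]),
  (forall t, a < t < b -> (lam t + s t) ^+ 3 + pc d t * (lam t + s t) + qc d t = 0) ->
  (forall t, a < t < b -> ccont lam t) -> (forall t, a < t < b -> ccont s t) ->
  (forall x y, a < x -> x <= y -> y < b -> normc (s y - s x) <= M * (y - x)) ->
  exists g, [/\ represents a b g (distr_deriv a b lam), weakL (6 / 5) a b g,
    (weakL_norm (6 / 5) a b g <= K%:E)%E &
    forall q, 0 <= q -> q <= 6 / 5 -> Lq q a b g /\ Lq q a b lam].
Proof.
move=> ab M1; have [K0 K00 HK0] := hdens_integral ab M1.
pose C : R := 353; have C0 : 0 < C by rewrite ltr0n.
pose K1 := 2 `^ (6 / 5) * (K0 + M `^ (6 / 5) * (b - a)).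
pose K2 := (2 * C) `^ (6 / 5) * K1.
exists (K2 `^ (6 / 5)^-1) => d lam s roots clam cs sM.
have hK := tdens_integral ab M1 (HK0 d); rewrite -/K1 in hK.
have ih := tdens_integrable M1 hK.
have h0 := tdens_ge0 d M1.
set H := cumul (tdens d).
have HM x y : a < x -> x <= y -> y < b -> M * (y - x) <= H y - H x.
  move=> ax xy yb; rewrite cumulB// -Rintegral_itvoc_cst//; apply: le_Rintegral => //.
  - by apply: integrable_continuous => ?; exact: cst_continuous.
  - exact: (integrableS measurableT).
  move=> t txy; have : x < t <= y by move: txy; rewrite /= in_itv.
  case/andP=> xt ty; have tab : a < t < b by apply/andP; split; lra.
  by rewrite /tdens tab lerDr hdens_ge0.
have incr x y : a < x -> x <= y -> y < b -> normc (lam y - lam x) <= C * (H y - H x).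
  move=> ax xy yb.
  have := @root_increments _ a b M d (fun t => lam t + s t) roots
    (fun t tab => ccontD (clam t tab) (cs t tab)) H.
  move=> /(_ (fun u v _ uv _ => cumul_mono h0 ih uv)) => /(_ _ x y ax xy yb) inc.
  have {}inc : normc (lam y + s y - (lam x + s x)) <= 352 * (H y - H x).
    apply: inc => t k tab ck kh eta eta0.
    apply: (cumul_low ih tab ck _ eta0) => u uab.
    by rewrite tdensE// (le_trans (kh u))// lerDl; lra.
  have -> : lam y - lam x = (lam y + s y - (lam x + s x)) - (s y - s x) by ring.
  rewrite (le_trans (normcB _ _))//.
  have := sM x y ax xy yb; have := HM x y ax xy yb; rewrite /C; lra.
have [g [rep mg gh]] := complex_weak_derivative ab C0 h0 ih incr.
exists g.
have mt := measurable_tdens d.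
pose h t := 2 * C * tdens d t.
have hh0 t : 0 <= h t by rewrite mulr_ge0// ltW// mulr_gt0.
have mh : measurable_fun `]a, b[ h by exact: measurable_funM.
have hK2 : (\int[@lebesgue_measure R]_(t in `]a, b[) (h t `^ (6 / 5))%:E <= K2%:E)%E.
  under eq_integral do rewrite powRM ?h0// ?(ltW (mulr_gt0 _ C0))// EFinM.
  rewrite ge0_integralZl//.
  - by rewrite EFinM lee_wpmul2l// lee_fin powR_ge0.
  - by apply/measurable_EFinP; exact: (measurableT_comp (measurable_powR _)).
  - by move=> t _; rewrite lee_fin powR_ge0.
  - by rewrite lee_fin powR_ge0.
have p1 : (1 : R) <= 6 / 5 by lra.
split => //.
- exact: (weakL_density p1 hh0 mh hK2 mg gh).
- exact: (weakL_norm_le p1 hh0 mh hK2 mg gh).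
move=> q q0 q65; split; first exact: (Lq_density p1 hh0 mh hK2 mg gh).
pose m := (a + b) / 2.
have mab : a < m < b by rewrite /m; apply/andP; split; lra.
pose B := normc (lam m) + C * Rintegral (@lebesgue_measure R) setT (tdens d).
apply: (@Lq_bounded _ _ _ _ B) => //.
  by split; apply: open_cts_measurable => t tab; have [] := ccont_parts (clam t tab).
move=> t tab.
have diff : normc (lam t - lam m) <= C * Rintegral (@lebesgue_measure R) setT (tdens d).
  have up u v : H v - H u <= Rintegral (@lebesgue_measure R) setT (tdens d).
    by have := cumul_ge0 h0 u; have := cumul_le h0 ih v; rewrite -/H; lra.
  case/andP: tab => ta tb; case/andP: mab => ma mb.
  have [tm|mt'] := leP t m.
    by rewrite normcBC (le_trans (incr t m ta tm mb))// ler_wpM2l// ltW.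
  by rewrite (le_trans (incr m t ma (ltW mt') tb))// ler_wpM2l// ltW.
have -> : lam t = lam m + (lam t - lam m) by ring.
by rewrite (le_trans (le_normcD _ _))// lerD.
Qed.

(** * C^6 bounds of the coefficients *)

Lemma ccontinuous_onP (R : realType) (D : set R) (f : R -> R[i]) t :
  ccontinuous_on D f -> D t -> forall e, 0 < e -> exists2 d, 0 < d &
    forall s, D s -> `|s - t| < d -> normc (f s - f t) < e.
Proof.
move=> /subspace_continuousP cf Dt e e0.
have e0' : 0 < e%:C by rewrite ltcR.
have := cf t Dt => /cvgrPdist_lt /(_ _ e0').
rewrite near_withinE => /nbhs_ballP[d /= d0 H].
exists d => // s Ds st.
have /H/(_ Ds) : ball t d s by rewrite /ball/= distrC.
by rewrite distrC -[`|f s - f t|]/((normc (f s - f t))%:C) ltcR.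
Qed.

Lemma ccontinuous_on_ccont (R : realType) (a b : R) (f : R -> R[i]) t :
  ccontinuous_on `]a, b[ f -> a < t < b -> ccont f t.
Proof.
move=> cf tab e e0.
have [|d d0 Hd] := ccontinuous_onP cf _ e0 (t := t); first by rewrite /= in_itv.
exists (Num.min d (Num.min (t - a) (b - t))).
  by rewrite !lt_min d0 !subr_gt0.
move=> s; rewrite !lt_min => /andP[sd /andP[sa sb]]; apply: Hd => //=.
by move: sa sb; rewrite !ltr_norml in_itv/= => /andP[? ?] /andP[? ?]; apply/andP; split; lra.
Qed.

(** Compactness of the closed interval, by real induction. *)
Lemma ccontinuous_bounded (R : realType) (a b : R) (g : R -> R[i]) : a <= b ->
  ccontinuous_on `[a, b] g ->
  exists B, forall t, a <= t <= b -> normc (g t) <= B.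
Proof.
move=> ab cg.
apply: (@cousin _ (fun u v => exists B, forall t, u <= t <= v -> normc (g t) <= B)) => //.
- move=> u v w uv vw [B HB] [B' HB']; exists (Num.max B B') => t /andP[ut tw].
  rewrite le_max; have [tv|vt] := leP t v; first by rewrite HB ?ut.
  by rewrite HB' ?orbT// (ltW vt).
- move=> t tab; have [|d d0 Hd] := ccontinuous_onP cg _ ltr01 (t := t); first by rewrite /= in_itv.
  exists d => // u v au ut tv vb tu vt; exists (normc (g t) + 1) => s /andP[us sv].
  have -> : g s = g t + (g s - g t) by ring.
  rewrite (le_trans (le_normcD _ _))// lerD2l ltW// Hd//=.
    by rewrite in_itv/=; apply/andP; split; lra.
  by rewrite ltr_norml; apply/andP; split; lra.
Qed.

(** The continuous extensions to the closed interval bound the derivatives. *)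
Lemma Cn_closure_bound (R : realType) n (a b : R) (f : R -> R[i]) : a < b ->
  Cn_closure n a b f ->
  exists B, forall k t, (k <= n)%N -> a < t < b -> normc (cderiv k f t) <= B.
Proof.
move=> ab [_ ext].
suff H m : (m <= n)%N ->
    exists B, forall k t, (k <= m)%N -> a < t < b -> normc (cderiv k f t) <= B.
  exact: H.
have one k : (k <= n)%N -> exists B, forall t, a < t < b -> normc (cderiv k f t) <= B.
  move=> kn; have [g [cg gE]] := ext k kn.
  have [B HB] := ccontinuous_bounded (ltW ab) cg.
  exists B => t tab; rewrite -gE ?in_itv//; apply: HB.
  by case/andP: tab => /ltW -> /ltW ->.
elim: m => [|m IH] mn.
  have [B HB] := one 0%N mn; exists B => k t; rewrite leqn0 => /eqP ->; exact: HB.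
have [B HB] := IH (ltnW mn); have [B' HB'] := one _ mn.
exists (Num.max B B') => k t; rewrite leq_eqVlt ltnS => /orP[/eqP ->|km] tab.
  by rewrite le_max HB' ?orbT.
by rewrite le_max HB.
Qed.

Lemma Cn_norm_bound (R : realType) n (a b M : R) (f : R -> R[i]) :
  (Cn_norm n a b f <= M%:E)%E ->
  forall k t, (k <= n)%N -> a < t < b -> normc (cderiv k f t) <= M.
Proof.
move=> H k t kn tab; rewrite -lee_fin; apply: le_trans H.
by apply: ereal_sup_ubound; exists k, t; split => //; rewrite in_itv.
Qed.

Lemma Cn_closure_Ckb (R : realType) n (a b B : R) (f : R -> R[i]) :
  Cn_closure n a b f ->
  (forall k t, (k <= n)%N -> a < t < b -> normc (cderiv k f t) <= B) ->
  Ckb n a b B (reF f) /\ Ckb n a b B (imF f).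
Proof.
move=> [df _] fB.
suff H (F : R -> R) : (forall k t, (k < n)%N -> a < t < b -> derivable (derive1n k F) t 1) ->
    (forall k t, (k <= n)%N -> a < t < b -> `|derive1n k F t| <= B) -> Ckb n a b B F.
  split; apply: H => k t kn tab.
  - by have [] := df k t kn; rewrite ?in_itv.
  - exact: le_trans (Re_le_normc _) (fB k t kn tab).
  - by have [] := df k t kn; rewrite ?in_itv.
  - exact: le_trans (Im_le_normc _) (fB k t kn tab).
move=> dF FB.
suff G m k : (k + m = n)%N -> Ckb m a b B (derive1n k F) by exact: (G n 0%N).
elim: m k => [|m IH] k kmn; split => //.
- by move=> t tab; apply: FB => //; rewrite -kmn addn0.
- by move=> t tab; apply: FB => //; rewrite -kmn leq_addr.
exists (derive1n k.+1 F); split; last by apply: IH; rewrite -kmn addSnnS.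
move=> t tab; apply: DeriveDef; last by rewrite derive1nS derive1E.
by apply: dF => //; rewrite -kmn -addSnnS leq_addr.
Qed.

(** * Reduction to a cubic without quadratic term *)

Lemma near_oo_eq (R : realType) (a b t : R) (f g : R -> R) : a < t < b ->
  (forall s, a < s < b -> f s = g s) -> \near t, f t = g t.
Proof.
move=> tab fg; have tI : t \in `]a, b[ by rewrite in_itv/= tab.
by apply: filterS (near_in_itvoo tI) => s; rewrite in_itv/=; exact: fg.
Qed.

Lemma Ckb_ext (R : realType) k (a b M : R) (f g : R -> R) :
  (forall s, a < s < b -> f s = g s) -> Ckb k a b M f -> Ckb k a b M g.
Proof.
move=> fg; case: k => [|k] [Hf H]; split => //.
- by move=> t tab; rewrite -fg// Hf.
- by move=> t tab; rewrite -fg// Hf.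
case: H => f' [df Cf']; exists f'; split => // t tab.
exact: near_eq_is_derive (near_oo_eq tab fg) (df t tab).
Qed.

Lemma smooth_Ckb6 (R : realType) (a b M : R) (g g' : R -> R) :
  Ckb 6 a b M g -> (forall t, a < t < b -> is_derive t 1 g (g' t)) -> smooth a b M g g'.
Proof.
move=> [gM [f' [df Cf']]] dg; split => //.
apply: (@Ckb_ext _ 5 a b M f') => // t tab.
by have [_ <-] := df t tab; have [_ <-] := dg t tab.
Qed.

(** The derivatives of D1 and D2 have to be those of the formulas disc1' and disc2'. *)
Lemma cubic_data_ex (R : realType) (a b M : R) (q1 q2 p1 p2 : R -> R) :
  Ckb 6 a b M q1 -> Ckb 6 a b M q2 -> Ckb 6 a b M p1 -> Ckb 6 a b M p2 ->
  Ckb 6 a b M (fun t => disc1 (q1 t) (q2 t) (p1 t) (p2 t)) ->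
  Ckb 6 a b M (fun t => disc2 (q1 t) (q2 t) (p1 t) (p2 t)) ->
  exists d : cubic_data a b M, (forall t, pc d t = p1 t +i* p2 t) /\
    (forall t, qc d t = q1 t +i* q2 t).
Proof.
move=> Cq1 Cq2 Cp1 Cp2 CD1 CD2.
have isd f : Ckb 6 a b M f -> forall t, a < t < b -> is_derive t (1 : R) f (derive1 f t).
  move=> [_ [f' [df _]]] t tab; have [dft _] := df t tab.
  by apply: DeriveDef => //; rewrite derive1E.
have dq1 := isd _ Cq1; have dq2 := isd _ Cq2; have dp1 := isd _ Cp1; have dp2 := isd _ Cp2.
have sD1 : smooth a b M (fun t => disc1 (q1 t) (q2 t) (p1 t) (p2 t))
  (fun t => disc1' (q1 t) (q2 t) (p1 t) (p2 t) (derive1 q1 t) (derive1 q2 t) (derive1 p1 t) (derive1 p2 t)).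
  apply: smooth_Ckb6 CD1 _ => t tab; rewrite /disc1 /disc1'.
  have d1 := dq1 t tab; have d2 := dq2 t tab; have d3 := dp1 t tab; have d4 := dp2 t tab.
  by apply: is_derive_eq; rewrite /GRing.scale/=; ring.
have sD2 : smooth a b M (fun t => disc2 (q1 t) (q2 t) (p1 t) (p2 t))
  (fun t => disc2' (q1 t) (q2 t) (p1 t) (p2 t) (derive1 q1 t) (derive1 q2 t) (derive1 p1 t) (derive1 p2 t)).
  apply: smooth_Ckb6 CD2 _ => t tab; rewrite /disc2 /disc2'.
  have d1 := dq1 t tab; have d2 := dq2 t tab; have d3 := dp1 t tab; have d4 := dp2 t tab.
  by apply: is_derive_eq; rewrite /GRing.scale/=; ring.
by exists (CubicData (smooth_Ckb6 Cq1 dq1) (smooth_Ckb6 Cq2 dq2) (smooth_Ckb6 Cp1 dp1)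
  (smooth_Ckb6 Cp2 dp2) sD1 sD2).
Qed.

Section uniform_bounds.
Context (R : realType) (a b B : R).
Implicit Types F G : ('I_3 -> R -> R[i]) -> R -> R.

Definition coef_bounded (c : 'I_3 -> R -> R[i]) : Prop :=
  forall j, Ckb 6 a b B (reF (c j)) /\ Ckb 6 a b B (imF (c j)).

(** The order of the quantifiers makes the bound uniform over families of
    coefficients. *)
Definition uniform_Ckb F : Prop :=
  exists2 M, 0 <= M & forall c, coef_bounded c -> Ckb 6 a b M (F c).

Lemma uniformD F G : uniform_Ckb F -> uniform_Ckb G ->
  uniform_Ckb (fun c t => F c t + G c t).
Proof.
move=> [M M0 HF] [N N0 HG]; exists (M + N); first exact: addr_ge0.
by move=> c cB; apply: CkbD; [exact: HF|exact: HG].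
Qed.

Lemma uniformM F G : uniform_Ckb F -> uniform_Ckb G ->
  uniform_Ckb (fun c t => F c t * G c t).
Proof.
move=> [M M0 HF] [N N0 HG]; exists (2 ^+ 6 * (M * N)).
  by apply: mulr_ge0; [exact: exprn_ge0|exact: mulr_ge0].
by move=> c cB; apply: CkbM => //; [exact: HF|exact: HG].
Qed.

Lemma uniformC (k : R) : uniform_Ckb (fun _ _ => k).
Proof. by exists `|k| => // c _; exact: CkbC. Qed.

Lemma uniformN F : uniform_Ckb F -> uniform_Ckb (fun c t => - F c t).
Proof.
move=> uF; have [M M0 H] := uniformM (uniformC (-1)) uF; exists M => // c cB.
by apply: Ckb_ext (H c cB) => t _; rewrite mulN1r.
Qed.

Lemma uniform_expr F n : uniform_Ckb F -> uniform_Ckb (fun c t => F c t ^+ n).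
Proof.
move=> uF; elim: n => [|n IH]; first exact: uniformC.
have [M M0 H] := uniformM uF IH; exists M => // c cB.
by apply: Ckb_ext (H c cB) => t _; rewrite exprS.
Qed.

Lemma uniform_re j : uniform_Ckb (fun c t => complex.Re (c j t)).
Proof. by exists `|B| => // c /(_ j)[H _]; exact: Ckb_le (ler_norm _) H. Qed.

Lemma uniform_im j : uniform_Ckb (fun c t => complex.Im (c j t)).
Proof. by exists `|B| => // c /(_ j)[_ H]; exact: Ckb_le (ler_norm _) H. Qed.

End uniform_bounds.

Ltac uniform_poly := repeat first
  [ exact: uniform_re | exact: uniform_im | exact: uniformC | apply: uniformD
  | apply: uniformN | apply: uniform_expr | apply: uniformM ].

Section tschirnhaus.
Context (R : realType).
Variables (c : 'I_3 -> R -> R[i]) (t : R).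
Let x j := complex.Re (c j t).
Let y j := complex.Im (c j t).
Let j0 : 'I_3 := ord0.
Let j1 : 'I_3 := lift ord0 ord0.
Let j2 : 'I_3 := lift ord0 (lift ord0 ord0).

(** The coefficients c1 - c0^2 / 3 and 2 c0^3 / 27 - c0 c1 / 3 + c2 of the cubic
    without quadratic term that is obtained by the shift by c0 / 3, in terms of real
    and imaginary parts and in the shape of the closure rules of uniform_Ckb. *)
Definition dep_p1 : R := x j1 + - ((x j0 ^+ 2 + - y j0 ^+ 2) * 3^-1).
Definition dep_p2 : R := y j1 + - (2 * x j0 * y j0 * 3^-1).
Definition dep_q1 : R := 2 * 27^-1 * (x j0 ^+ 3 + - (3 * x j0 * y j0 ^+ 2)) +
  - ((x j0 * x j1 + - (y j0 * y j1)) * 3^-1) + x j2.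
Definition dep_q2 : R := 2 * 27^-1 * (3 * x j0 ^+ 2 * y j0 + - y j0 ^+ 3) +
  - ((x j0 * y j1 + y j0 * x j1) * 3^-1) + y j2.

Definition shift_third : R[i] := (x j0 * 3^-1) +i* (y j0 * 3^-1).

Lemma root_cubicE (z : R[i]) : (cubic c t).[z] =
  (z + shift_third) ^+ 3 + (dep_p1 +i* dep_p2) * (z + shift_third) + (dep_q1 +i* dep_q2).
Proof.
have -> : (cubic c t).[z] = z ^+ 3 + (c j0 t * z ^+ 2 + (c j1 t * z + c j2 t)).
  by rewrite /cubic !big_ord_recl big_ord0 addr0 !hornerE.
rewrite /dep_p1 /dep_p2 /dep_q1 /dep_q2 /shift_third /x /y.
case: (c j0 t) => u0 v0; case: (c j1 t) => u1 v1; case: (c j2 t) => u2 v2; case: z => r s /=.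
apply/eqP; rewrite eq_complex /=; apply/andP; split; apply/eqP; by field.
Qed.
End tschirnhaus.

Lemma Ckb_lipschitz (R : realType) (a b B : R) (f : R -> R[i]) x y :
  Ckb 6 a b B (reF f) -> Ckb 6 a b B (imF f) -> a < x -> x <= y -> y < b ->
  normc (f y - f x) <= 2 * B * (y - x).
Proof.
move=> Cr Ci ax xy yb.
have lip (g : R -> R) : Ckb 6 a b B g -> `|g y - g x| <= B * (y - x).
  move=> [_ [g' [dg Cg']]]; move: xy; rewrite le_eqVlt => /predU1P[->|xy].
    by rewrite !subrr normr0 mulr0.
  have [z /andP[xz zy] ->] := mvt_oo dg ax xy yb.
  rewrite normrM [`|y - x|]ger0_norm ?subr_ge0 ?(ltW xy)// ler_wpM2r ?subr_ge0 ?(ltW xy)//.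
  by apply: (Ckb_bound (Cg' : Ckb 5 a b B g')); apply/andP; split; lra.
have := normc_le_add (f y - f x); move=> /le_trans; apply.
have := lip _ Cr; have := lip _ Ci; rewrite /reF /imF.
by case: (f x) => ? ?; case: (f y) => ? ? /=; lra.
Qed.

(** The coefficients of the reduced cubic and its discriminant are polynomials in the
    coefficients, so that their C^6 bound depends only on the one of the
    coefficients. *)
Lemma cubic_root_weak_derivative (R : realType) (a b B : R) : a < b ->
  exists K : R, forall (c : 'I_3 -> R -> R[i]) (lam : R -> R[i]),
  coef_bounded a b B c ->
  (forall t, a < t < b -> ccont lam t) ->
  (forall t, a < t < b -> root (cubic c t) (lam t)) ->
  exists g, [/\ represents a b g (distr_deriv a b lam), weakL (6 / 5) a b g,
    (weakL_norm (6 / 5) a b g <= K%:E)%E &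
    forall q, 0 <= q -> q <= 6 / 5 -> Lq q a b g /\ Lq q a b lam].
Proof.
move=> ab.
have [Mq1 Mq1_0 uq1] : uniform_Ckb a b B (@dep_q1 R) by rewrite /dep_q1; uniform_poly.
have [Mq2 Mq2_0 uq2] : uniform_Ckb a b B (@dep_q2 R) by rewrite /dep_q2; uniform_poly.
have [Mp1 Mp1_0 up1] : uniform_Ckb a b B (@dep_p1 R) by rewrite /dep_p1; uniform_poly.
have [Mp2 Mp2_0 up2] : uniform_Ckb a b B (@dep_p2 R) by rewrite /dep_p2; uniform_poly.
have [MD1 MD1_0 uD1] : uniform_Ckb a b B
    (fun c t => disc1 (dep_q1 c t) (dep_q2 c t) (dep_p1 c t) (dep_p2 c t)).
  by rewrite /disc1 /dep_q1 /dep_q2 /dep_p1 /dep_p2; uniform_poly.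
have [MD2 MD2_0 uD2] : uniform_Ckb a b B
    (fun c t => disc2 (dep_q1 c t) (dep_q2 c t) (dep_p1 c t) (dep_p2 c t)).
  by rewrite /disc2 /dep_q1 /dep_q2 /dep_p1 /dep_p2; uniform_poly.
pose M := 1 + (Mq1 + Mq2 + Mp1 + Mp2 + MD1 + MD2 + `|B|).
have B0 := normr_ge0 B.
have M1 : 1 <= M by rewrite /M; lra.
have [K HK] := root_weak_derivative ab M1.
exists K => c lam cB clam rlam.
have [d [dp dq]] : exists d : cubic_data a b M,
    (forall t, pc d t = dep_p1 c t +i* dep_p2 c t) /\
    (forall t, qc d t = dep_q1 c t +i* dep_q2 c t).
  apply: cubic_data_ex.
  - by apply: Ckb_le (uq1 c cB); rewrite /M; lra.
  - by apply: Ckb_le (uq2 c cB); rewrite /M; lra.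
  - by apply: Ckb_le (up1 c cB); rewrite /M; lra.
  - by apply: Ckb_le (up2 c cB); rewrite /M; lra.
  - by apply: Ckb_le (uD1 c cB); rewrite /M; lra.
  - by apply: Ckb_le (uD2 c cB); rewrite /M; lra.
have [C1 C2] := cB ord0.
have sE t : shift_third c t = c ord0 t * (3^-1)%:C.
  rewrite /shift_third; case: (c ord0 t) => u v /=.
  by apply/eqP; rewrite eq_complex /= !mulr0 subr0 add0r !eqxx.
have sC x y : a < x -> x <= y -> y < b -> normc (shift_third c y - shift_third c x) <= M * (y - x).
  move=> ax xy yb; rewrite !sE -mulrBl normcM normc_real ger0_norm ?invr_ge0//.
  have h := Ckb_lipschitz C1 C2 ax xy yb.
  have h1 : B * (y - x) <= `|B| * (y - x) by rewrite ler_wpM2r ?subr_ge0// ler_norm.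
  have h2 : `|B| * (y - x) <= M * (y - x) by rewrite ler_wpM2r ?subr_ge0// /M; lra.
  have h3 : 0 <= `|B| * (y - x) by rewrite mulr_ge0// subr_ge0.
  rewrite ler_pdivrMr//; lra.
apply: (HK d lam (shift_third c)) => //.
- move=> t tab; rewrite dp dq -root_cubicE.
  by apply/eqP; exact: rlam.
- move=> t tab; apply: ccont_Complex.
  + have [_ [g' [dg _]]] := C1; have := is_derive_cont (dg t tab).
    by move=> cc; apply: cvgM; [exact: cc|exact: cvg_cst].
  + have [_ [g' [dg _]]] := C2; have := is_derive_cont (dg t tab).
    by move=> cc; apply: cvgM; [exact: cc|exact: cvg_cst].
Qed.

(** * Sobolev regularity of the roots *)

Theorem theorem10p1 (R : realType) (a b : R) (hab : a < b) :
  (forall c : 'I_3 -> R -> R[i],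
     (forall j, Cn_closure 6 a b (c j)) ->
     forall lambda : 'I_3 -> R -> R[i],
       continuous_parameterization a b (cubic c) lambda ->
       forall j,
         distr_in a b (weakL (6 / 5) a b) (distr_deriv a b (lambda j)) /\
         (forall q : R, 1 <= q -> q < 6 / 5 -> sobolev_W1 q a b (lambda j)))
  /\
  (forall (N : Type) (c : N -> 'I_3 -> R -> R[i]),
     bounded_in_Cn 6 a b [set f | exists nu j, f = c nu j] ->
     distr_bounded_in_weakL (6 / 5) a b
       [set T | exists nu (lambda : R -> R[i]),
          [/\ ccontinuous_on `]a, b[ lambda,
              forall t, t \in `]a, b[ -> root (cubic (c nu) t) (lambda t) &
              T = distr_deriv a b lambda]]).
Proof.
split.
- move=> c Cc lambda [clam fact] j.
  have [B cB] : exists B, coef_bounded a b B c.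
    have /choice[f Hf] : forall i, exists B, forall k t, (k <= 6)%N -> a < t < b ->
        normc (cderiv k (c i) t) <= B by move=> i; exact: Cn_closure_bound (Cc i).
    exists (\sum_i `|f i|) => i; apply: Cn_closure_Ckb => // k t k6 tab.
    rewrite (le_trans (Hf i k t k6 tab))// (le_trans (ler_norm _))//.
    by rewrite (bigD1 i)//= lerDl sumr_ge0.
  have [K HK] := cubic_root_weak_derivative B hab.
  have [|t tab|g [rep wg _ Lg]] := HK c (lambda j) cB.
  + by move=> t tab; exact: ccontinuous_on_ccont (clam j) tab.
  + rewrite fact ?in_itv//; apply/rootP; rewrite horner_prod (bigD1 j)//=.
    by rewrite hornerXsubC subrr mul0r.
  split; first by exists g.
  move=> q q1 q65; have [Lgq Llq] := Lg q (le_trans ler01 q1) (ltW q65).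
  by split => //; exists g.
- move=> N c [Cc [M HM]].
  have [K HK] := cubic_root_weak_derivative M hab.
  exists K => _ [nu [lam [clam rlam ->]]].
  have [|||g [rep wg gK _]] := HK (c nu) lam.
  + move=> j; have Scj : [set f | exists nu j, f = c nu j] (c nu j) by exists nu, j.
    by apply: Cn_closure_Ckb; [exact: Cc|exact: Cn_norm_bound (HM _ Scj)].
  + by move=> t tab; exact: ccontinuous_on_ccont clam tab.
  + by move=> t tab; apply: rlam; rewrite in_itv.
  by exists g.
Qed.
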